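(* Let $\psi_0\in\mathcal{S}(\mathbb{R}^D)$ with $\|\psi_0\|_{L^2}=1$. Let $\tau>0$ be a fixed time, $n\in\mathbb{N}$, $j\in\{1,\dots,D\}$, and let $\hat A$ be one of the operators $\mathrm{Id}$, $\hat q_j^n$, $\hat p_j^n$, $T$, $V$ or $\hat H$. Then for all times $t\in[0,\tau]$: 1. the variance of the Husimi approach, $$\mathbb{V}_t[\hat A,\psi_0,\rho_{\rm H}^{\rm dbl}]=(2\pi\epsilon)^{-2D}\int_{\mathbb{R}^{4D}}|\Phi_t(w)O_t[\hat A](w)|^2\,dw-|\langle\hat A\rangle_t|^2,$$ is finite if and only if $\hat A=0$; 2. the variance of the sqrt-Husimi approach, $$\mathbb{V}_t[\hat A,\psi_0,\rho_{\text{sqrt-H}}^{\rm dbl}]=\kappa_{\text{sqrt-H}}^2\int_{\mathbb{R}^{4D}}|f_0(w)|\,|\Phi_t(w)|^2\,|O_t[\hat A](w)|^2\,dw-|\langle\hat A\rangle_t|^2,$$ is finite.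
   Context: Fix a dimension $D\ge 1$, a semiclassical parameter $\epsilon>0$ (thought of as $0<\epsilon\ll 1$), a real symmetric positive-definite matrix $\Gamma\in\mathbb{R}^{D\times D}$, and a smooth potential $V:\mathbb{R}^D\to\mathbb{R}$ that is sub-quadratic, meaning that all partial derivatives of $V$ of order at least $2$ are bounded. $\langle\cdot,\cdot\rangle$ is the $L^2(\mathbb{R}^D)$ inner product $\langle\phi,\psi\rangle=\int\overline{\phi}\,\psi\,dx$. Operators: $\hat q_j$ is multiplication by $x_j$, $\hat p_j=-i\epsilon\partial_{x_j}$, $T=-\frac{\epsilon^2}{2}\Delta$, $V$ also denotes multiplication by $V(x)$, and $\hat H=T+V$. Gaussians: for $z=(q,p)\in\mathbb{R}^{2D}$, $$g_z(x)=\left(\frac{\det\Gamma}{\pi^D\epsilon^D}\right)^{1/4}\exp\left(-\frac{1}{2\epsilon}(x-q)^T\Gamma(x-q)+\frac{i}{\epsilon}p^T(x-q)\right).$$ Classical quantities: let $h(q,p)=\frac12|p|^2+V(q)$ and $J=\begin{pmatrix}0&\mathrm{Id}_D\\-\mathrm{Id}_D&0\end{pmatrix}$. For $z\in\mathbb{R}^{2D}$, $z(t)=(q(t),p(t))$ solves $\dot z(t)=J\nabla h(z(t))$, $z(0)=z$; the action solves $\dot S_t(z)=\frac12|p(t)|^2-V(q(t))$, $S_0(z)=0$; the stability matrix $M(t)=\partial z(t)/\partial z$ solves $\dot M(t)=J\,\mathrm{Hess}\,h(z(t))\,M(t)$, $M(0)=\mathrm{Id}_{2D}$, with $D\times D$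 blocks $M_{qq},M_{qp},M_{pq},M_{pp}$ ($M_{\alpha\beta}=\partial\alpha(t)/\partial\beta$). The Herman--Kluk prefactor is $$R_t(z)=2^{-D/2}\det\left(M_{qq}+\Gamma^{-1}M_{pp}\Gamma-iM_{qp}\Gamma+i\Gamma^{-1}M_{pq}\right)^{1/2},$$ with the branch of the square root chosen continuously in $t$ and $R_0=1$. For $w=(y,z)\in\mathbb{R}^{4D}$ with $y,z\in\mathbb{R}^{2D}$, define $$f_0(y,z)=(2\pi\epsilon)^{-2D}\langle\psi_0,g_y\rangle\langle g_z,\psi_0\rangle,$$ $$\Phi_t(y,z)=\overline{R_t(y)}R_t(z)\exp[i(S_t(z)-S_t(y))/\epsilon],\qquad O_t[\hat A](y,z)=\langle g_{y(t)},\hat A g_{z(t)}\rangle,$$ and $\langle\hat A\rangle_t=\int_{\mathbb{R}^{4D}}f_0(w)\Phi_t(w)O_t[\hat A](w)\,dw$. For a probability density $\rho>0$ on $\mathbb{R}^{4D}$ (possibly vanishing on Lebesgue null sets) the variance of the Monte Carlo integrand is $$\mathbb{V}_t[\hat A,\psi_0,\rho]=\int_{\mathbb{R}^{4D}}\frac{1}{\rho(w)}|f_0(w)\Phi_t(w)O_t[\hat A](w)|^2\,dw-|\langle\hat A\rangle_t|^2.$$ The Husimi density is $\rho_{\rm H}(z)=(2\pi\epsilon)^{-D}|\langle g_z,\psi_0\rangle|^2$ on $\mathbb{R}^{2D}$, the sqrt-Husimi density is $\rho_{\text{sqrt-H}}(z)=\frac{(2\pi\epsilon)^{-D}}{\kappa_{\text{sqrt-H}}}|\langle\psi_0,g_z\rangle|$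 with $\kappa_{\text{sqrt-H}}=(2\pi\epsilon)^{-D}\int_{\mathbb{R}^{2D}}|\langle\psi_0,g_\zeta\rangle|\,d\zeta$, and $\rho_{\rm H}^{\rm dbl}=\rho_{\rm H}\otimes\rho_{\rm H}$, $\rho_{\text{sqrt-H}}^{\rm dbl}=\rho_{\text{sqrt-H}}\otimes\rho_{\text{sqrt-H}}$ on $\mathbb{R}^{4D}$. The displayed formulas in the claim are $\mathbb{V}_t[\hat A,\psi_0,\rho]$ for these two choices of $\rho$. *)

(* Defs.v *)
(* MathComp / MathComp-Analysis, over an arbitrary R : realType. *)
From HB Require Import structures.
From mathcomp Require Import all_boot all_order all_algebra.
From mathcomp Require Import complex.
From mathcomp Require Import all_classical all_reals all_analysis.
Set Implicit Arguments.
Unset Strict Implicit.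
Unset Printing Implicit Defensive.
Import Order.TTheory GRing.Theory Num.Theory.
Import numFieldNormedType.Exports.
Import ComplexField.Normc.
Local Open Scope classical_set_scope.
Local Open Scope complex_scope.
Local Open Scope ring_scope.

(* Matrices carry the sigma-algebra generated by their entries; on 'cV[R]_n
   this is the Borel sigma-algebra of R^n. *)
Definition mx_display : measure_display -> measure_display.
Proof. exact. Qed.

Section MatrixMeasurable.
Context d (T : measurableType d) (m n : nat).

Definition mx_cylinders : set (set 'M[T]_(m, n)) :=
  [set A | exists i j (B : set T),
     measurable B /\ A = (fun x : 'M[T]_(m, n) => x i j) @^-1` B].

HB.instance Definition _ := @isMeasurable.Build (mx_display d) 'M[T]_(m, n)
  <<s mx_cylinders >> (@sigma_algebra0 _ setT mx_cylinders)
  (fun A mA => (eq_ind _ <<s mx_cylinders >>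
     (@sigma_algebraCD _ setT mx_cylinders A mA) _ (setTD A)))
  (@sigma_algebra_bigcup _ setT mx_cylinders).

End MatrixMeasurable.

Section LebesgueStep.
Context {R : realType} (n : nat).

Definition cons_cV (p : measurableTypeR R * 'cV[R]_n) : 'cV[R]_n.+1 :=
  col_mx (p.1 : R)%:M p.2.

Lemma measurable_mx_entry k l (i : 'I_k) (j : 'I_l) :
  measurable_fun setT (fun x : 'M[R]_(k, l) => x i j).
Proof.
by move=> _ C mC; rewrite setTI; apply: sub_sigma_algebra; exists i, j, C.
Qed.

Lemma measurable_to_mx d (T : measurableType d) k l (f : T -> 'M[R]_(k, l)) :
  (forall i j, measurable_fun setT (fun x => f x i j)) -> measurable_fun setT f.
Proof.
move=> mf _ Y mY; rewrite setTI.
move: Y mY; apply: smallest_sub.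
  split=> [|A mA|F mF].
  - by rewrite /= preimage_set0; exact: measurable0.
  - by rewrite /= setTD -preimage_setC; exact: measurableC.
  - by rewrite /= preimage_bigcup; exact: bigcup_measurable.
by move=> _ [i [j [B [mB ->]]]]; rewrite /= -[X in measurable X]setTI; exact: mf.
Qed.

Lemma measurable_cons_cV : measurable_fun setT cons_cV.
Proof.
apply: measurable_to_mx => i j.
rewrite (ord1 j); case: (split_ordP (i : 'I_(1 + n))) => k ->.
  rewrite (_ : (fun _ => _) = fun p => p.1 : R).
    exact: measurable_fst.
  apply/funext => p.
  by rewrite /cons_cV (@col_mxEu R 1 n 1) (ord1 k) mxE eqxx mulr1n.
rewrite (_ : (fun _ => _) = (fun x : 'cV[R]_n => x k 0) \o snd); last first.
  by apply/funext => p /=; rewrite /cons_cV (@col_mxEd R 1 n 1).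
by apply: measurableT_comp => //; exact: measurable_mx_entry.
Qed.

Variable mu : {sigma_finite_measure set 'cV[R]_n -> \bar R}.

Definition lebesgue_cons : set 'cV[R]_n.+1 -> \bar R :=
  pushforward (lebesgue_measure \x mu)%E cons_cV.

Let mcons (A : set 'cV[R]_n.+1) : measurable A -> measurable (cons_cV @^-1` A).
Proof.
by move=> mA; rewrite -[X in measurable X]setTI; exact: measurable_cons_cV.
Qed.

Let lebesgue_cons0 : lebesgue_cons set0 = 0%E.
Proof. by rewrite /lebesgue_cons /pushforward preimage_set0 measure0. Qed.

Let lebesgue_cons_ge0 A : (0 <= lebesgue_cons A)%E.
Proof. exact: (measure_ge0 (lebesgue_measure \x mu)%E). Qed.

Let lebesgue_cons_sigma_additive : semi_sigma_additive lebesgue_cons.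
Proof.
move=> F mF tF mUF; rewrite /lebesgue_cons /pushforward preimage_bigcup.
apply: measure_semi_sigma_additive.
- by move=> k; exact: mcons.
- apply/trivIsetP => /= i j _ _ ij; rewrite -preimage_setI.
  by move/trivIsetP : tF => /(_ _ _ _ _ ij) ->//; rewrite preimage_set0.
- by rewrite -preimage_bigcup; exact: mcons.
Qed.

HB.instance Definition _ := isMeasure.Build _ _ _ lebesgue_cons
  lebesgue_cons0 lebesgue_cons_ge0 lebesgue_cons_sigma_additive.

Let lebesgue_cons_sigma_finite : sigma_finite setT lebesgue_cons.
Proof.
pose g (x : 'cV[R]_n.+1) : measurableTypeR R * 'cV[R]_n :=
  (x ord0 0, dsubmx (x : 'cV[R]_(1 + n))).
have mg : measurable_fun setT g.
  apply: measurable_fun_pair => /=; first exact: measurable_mx_entry.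
  apply: measurable_to_mx => i j.
  by under eq_fun do rewrite mxE; exact: measurable_mx_entry.
have gK : cancel cons_cV g.
  move=> [x y]; rewrite /g /cons_cV /= (@col_mxKd R 1 n 1); congr pair.
  rewrite [LHS](_ : _ = (col_mx x%:M y : 'cV[R]_(1 + n)) (lshift n ord0) 0).
    by rewrite col_mxEu mxE eqxx mulr1n.
  by congr (fun_of_matrix _ _ _); apply/val_inj.
have [F TF mF] : sigma_finite setT (lebesgue_measure \x mu)%E.
  have /sigma_finiteP[F [TF ndF Foo]] := sigma_finiteT (@lebesgue_measure R).
  have /sigma_finiteP[G [TG ndG Goo]] := sigma_finiteT mu.
  exists (fun k => F k `*` G k).
    rewrite -setXTT TF TG predeqE => -[x y]; split.
      move=> [/= [i _ Fix] [j _ Gjy]]; exists (maxn i j) => //; split.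
      - by move: x Fix; exact/subsetPset/ndF/leq_maxl.
      - by move: y Gjy; exact/subsetPset/ndG/leq_maxr.
    by move=> [i _ []/= ? ?]; split; exists i.
  move=> k; have [? ?] := Foo k; have [? ?] := Goo k.
  split; first exact: measurableX.
  by rewrite product_measure1E// lte_mul_pinfty// ge0_fin_numE.
exists (fun k => g @^-1` F k); first by rewrite -preimage_bigcup -TF.
move=> k; have [mFk Fk] := mF k; split.
  by rewrite -[X in measurable X]setTI; exact: mg.
rewrite /lebesgue_cons /pushforward -comp_preimage.
by rewrite (_ : g \o cons_cV = id) //; exact/funext.
Qed.

HB.instance Definition _ := Measure_isSigmaFinite.Build _ _ _ lebesgue_cons
  lebesgue_cons_sigma_finite.
End LebesgueStep.

(* Lebesgue measure on R^n, as the n-fold product of the one on R. *)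
Fixpoint lebesgue_cV (R : realType) (n : nat) :
    {sigma_finite_measure set 'cV[R]_n -> \bar R} :=
  match n with
  | 0 => dirac (0 : 'cV[R]_0)
  | n.+1 => lebesgue_cons (lebesgue_cV R n)
  end.

Section Analysis.
Context {R : realType}.

Definition cexp (z : R[i]) : R[i] :=
  (expR (complex.Re z) * cos (complex.Im z)) +i*
  (expR (complex.Re z) * sin (complex.Im z)).

Definition cintegral d (T : measurableType d) (mu : {measure set T -> \bar R})
    (f : T -> R[i]) : R[i] :=
  (\int[mu]_x complex.Re (f x)) +i* (\int[mu]_x complex.Im (f x)).

Section Functions.
Variable n : nat.
Implicit Types (f : 'cV[R]_n -> R) (phi psi : 'cV[R]_n -> R[i]).

Definition pderiv (j : 'I_n) f : 'cV[R]_n -> R :=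
  fun x => 'D_(delta_mx j 0) f x.

Definition cpderiv (j : 'I_n) phi : 'cV[R]_n -> R[i] :=
  fun x => pderiv j (@complex.Re R \o phi) x +i*
           pderiv j (@complex.Im R \o phi) x.

(* For s = [:: j1; ...; jk], iter_pderiv s f = d_j1 ... d_jk f. *)
Definition iter_pderiv (s : seq 'I_n) f := foldr pderiv f s.
Definition iter_cpderiv (s : seq 'I_n) phi := foldr cpderiv phi s.

Definition grad f (x : 'cV[R]_n) : 'cV[R]_n := \col_i pderiv i f x.

Definition hess f (x : 'cV[R]_n) : 'M[R]_n :=
  \matrix_(i, j) pderiv i (pderiv j f) x.

Definition smooth f := forall s x, differentiable (iter_pderiv s f) x.

Definition subquadratic f := forall s : seq 'I_n, (2 <= size s)%N ->
  exists c : R, forall x, `|iter_pderiv s f x| <= c.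

Definition schwartz phi :=
  [/\ smooth (@complex.Re R \o phi), smooth (@complex.Im R \o phi) &
    forall (alpha : 'I_n -> nat) (s : seq 'I_n), exists c : R,
      forall x : 'cV[R]_n,
      (\prod_(i < n) `|x i 0| ^+ alpha i) * normc (iter_cpderiv s phi x) <= c].

Definition inner phi psi : R[i] :=
  cintegral (lebesgue_cV R n) (fun x => (phi x)^*%C * psi x).

Definition l2norm phi : \bar R :=
  Lnorm (lebesgue_cV R n) 2%:E (fun x => (normc (phi x))%:E).

Definition dot (x y : 'cV[R]_n) : R := (x^T *m y) 0 0.

End Functions.
End Analysis.

Definition operator (R : realType) (D : nat) :=
  ('cV[R]_D -> R[i]) -> ('cV[R]_D -> R[i]).

Section Operators.
Context {R : realType} (D : nat) (eps : R).
Local Notation operator := (operator R D).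
Implicit Types (psi : 'cV[R]_D -> R[i]) (V : 'cV[R]_D -> R).

Definition potential_op V : operator := fun psi x => (V x)%:C * psi x.

Definition position_op (j : 'I_D) : operator := fun psi x => (x j 0)%:C * psi x.

Definition momentum_op (j : 'I_D) : operator :=
  fun psi x => - 'i%C * eps%:C * cpderiv j psi x.

Definition kinetic_op : operator :=
  fun psi x => - (eps ^+ 2 / 2)%:C * \sum_(j < D) cpderiv j (cpderiv j psi) x.

Definition hamiltonian_op V : operator :=
  fun psi x => kinetic_op psi x + potential_op V psi x.

(* The functions above are total on 'cV[R]_D -> R[i]; as operators they are
   considered on the Schwartz space. *)
Definition zero_operator (A : operator) :=
  forall psi, schwartz psi -> forall x, A psi x = 0.

End Operators.

(* A phase-space point z = (q, p) is the column vector col_mx q p. *)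
Section PhaseSpace.
Context {R : realType} (D : nat).
Local Notation phase := 'cV[R]_(D + D).

Definition gaussian (eps : R) (Gamma : 'M[R]_D) (z : phase) :
    'cV[R]_D -> R[i] :=
  fun x =>
    let q := usubmx z in let p := dsubmx z in
    ((\det Gamma / (pi ^+ D * eps ^+ D)) `^ (1 / 4))%:C *
    cexp (- (1 / (2 * eps))%:C * (dot (x - q) (Gamma *m (x - q)))%:C
          + 'i%C / eps%:C * (dot p (x - q))%:C).

Definition energy (V : 'cV[R]_D -> R) (z : phase) : R :=
  1 / 2 * dot (dsubmx z) (dsubmx z) + V (usubmx z).

(* The matrix J. *)
Definition symplectic_mx : 'M[R]_(D + D) := block_mx 0 1%:M (- 1%:M) 0.

(* zt t z is the point z(t) of the trajectory starting at z. *)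
Definition hamiltonian_flow (V : 'cV[R]_D -> R) (zt : R -> phase -> phase) :=
  forall z, zt 0 z = z /\
    forall t : R, is_derive t 1 (fun s => zt s z)
      (symplectic_mx *m grad (energy V) (zt t z)).

Definition classical_action (V : 'cV[R]_D -> R) (zt : R -> phase -> phase)
    (S : R -> phase -> R) :=
  forall z, S 0 z = 0 /\
    forall t : R, is_derive t 1 (fun s => S s z)
      (1 / 2 * dot (dsubmx (zt t z)) (dsubmx (zt t z)) - V (usubmx (zt t z))).

Definition stability_matrix (V : 'cV[R]_D -> R) (zt : R -> phase -> phase)
    (M : R -> phase -> 'M[R]_(D + D)) :=
  forall z,
    [/\ M 0 z = 1%:M,
        forall t : R, is_derive t 1 (fun s => M s z)
          (symplectic_mx *m hess (energy V) (zt t z) *m M t z) &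
        forall t i j,
          is_derive z (delta_mx j 0) (fun y => zt t y i 0) (M t z i j)].

Definition hk_matrix (Gamma : 'M[R]_D) (M : 'M[R]_(D + D)) : 'M[R[i]]_D :=
  let Mqq := ulsubmx M in let Mqp := ursubmx M in
  let Mpq := dlsubmx M in let Mpp := drsubmx M in
  let toC := map_mx (real_complex R) in
  toC (Mqq + invmx Gamma *m Mpp *m Gamma)
    - ('i%C : R[i]) *: toC (Mqp *m Gamma)
    + ('i%C : R[i]) *: toC (invmx Gamma *m Mpq).

(* The continuity in t and the value 1 at t = 0 select the branch of the
   square root. *)
Definition hk_prefactor (Gamma : 'M[R]_D) (M : R -> phase -> 'M[R]_(D + D))
    (Rt : R -> phase -> R[i]) :=
  forall z,
    [/\ Rt 0 z = 1,
        continuous (fun t => complex.Re (Rt t z)),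
        continuous (fun t => complex.Im (Rt t z)) &
        forall t, exists2 s : R[i], s ^+ 2 = \det (hk_matrix Gamma (M t z)) &
          Rt t z = (2 `^ (- (D%:R / 2)))%:C * s].

End PhaseSpace.

(* R^4D is the product of two phase spaces, with points w = (y, z). *)
Definition lebesgue_dbl (R : realType) (D : nat) :
    {measure set ('cV[R]_(D + D) * 'cV[R]_(D + D)) -> \bar R} :=
  (lebesgue_cV R (D + D) \x lebesgue_cV R (D + D))%E.

Section Variance.
Context {R : realType} (D : nat) (eps : R).
Local Notation phase := 'cV[R]_(D + D).
Variables (Gamma : 'M[R]_D) (psi0 : 'cV[R]_D -> R[i]).
Variables (zt : R -> phase -> phase) (S : R -> phase -> R).
Variables (Rt : R -> phase -> R[i]) (A : operator R D).
Local Notation g := (gaussian eps Gamma).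

Definition f0 (w : phase * phase) : R[i] :=
  ((2 * pi * eps) ^- (2 * D))%:C * inner psi0 (g w.1) * inner (g w.2) psi0.

Definition hk_phase (t : R) (w : phase * phase) : R[i] :=
  (Rt t w.1)^*%C * Rt t w.2 * cexp ('i%C * (S t w.2 - S t w.1)%:C / eps%:C).

Definition matrix_element (t : R) (w : phase * phase) : R[i] :=
  inner (g (zt t w.1)) (A (g (zt t w.2))).

Definition mc_mean (t : R) : R[i] :=
  cintegral (lebesgue_dbl R D) (fun w => f0 w * hk_phase t w * matrix_element t w).

(* The value of the integrand where rho vanishes is irrelevant, the densities
   of interest being positive almost everywhere. *)
Definition mc_variance (t : R) (rho : phase * phase -> R) : \bar R :=
  (\int[lebesgue_dbl R D]_w
      ((rho w)^-1 * normc (f0 w * hk_phase t w * matrix_element t w) ^+ 2)%:E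
   - (normc (mc_mean t) ^+ 2)%:E)%E.

Definition husimi (z : phase) : R :=
  (2 * pi * eps) ^- D * normc (inner (g z) psi0) ^+ 2.

Definition kappa_sqrt_husimi : R :=
  (2 * pi * eps) ^- D *
  \int[lebesgue_cV R (D + D)]_z normc (inner psi0 (g z)).

Definition sqrt_husimi (z : phase) : R :=
  (2 * pi * eps) ^- D / kappa_sqrt_husimi * normc (inner psi0 (g z)).

Definition dbl (rho : phase -> R) (w : phase * phase) : R := rho w.1 * rho w.2.

End Variance.

(* Main.v *)
Require Import Defs.
From HB Require Import structures.
From mathcomp Require Import all_boot all_order all_algebra.
From mathcomp Require Import complex.
From mathcomp Require Import all_classical all_reals all_analysis.
From mathcomp Require Import perm measurable_realfun ring lra zify.

(** Write g_z for the Gaussians, Phi and O for the phase factor and the matrix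
    element at time t.

    Against the double Husimi density the integrand of the variance is, off the zeros
    of the overlaps <g_z, psi0>, a constant times |Phi O|^2. These zeros form a null
    set: along every coordinate line of phase space the overlap is a nowhere vanishing
    factor times an entire function, hence zero identically or only on a null set
    ([analytic_zeros], [null_of_lines], [null_coherent_zeros]); and it is not zero
    everywhere, because at position 0 it is the Fourier transform of psi0 times a
    Gaussian ([fourier_uniqueness], [coherent_injective]).

    The integral of |Phi O|^2 is infinite because of translations in momentum. Each of
    the operators acts on g_z as multiplication by a symbol that is polynomial in the
    momentum of z ([has_symbol], [operator_symbol]). Adding the same momentum s to y and
    to z changes conj(g_y) g_z by a phase that is constant in x, so <g_y, A g_z> equals
    s^m <g_y, F g_z> up to lower order, where m is the degree and F the leading
    coefficient of the symbol ([matrix_element_lower]). Unless A is multiplication by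
    V = 0, the function F is not zero and the matrix element stays away from 0 on
    infinitely many translates of a product of two balls. The flow is a bi-Lipschitz
    bijection, by Gronwall's inequality ([flow_bilipschitz], [flowNK]), so the preimages
    of these translates contain disjoint boxes of a fixed size ([momentum_boxes]). There
    |Phi| is bounded below as well: M is symplectic, which makes the Herman-Kluk matrix
    coercive and its inverse bounded ([hk_coercive], [prefactor_bounds]). So both sides
    of the first formula are +oo, unless A = 0, when both integrals are 0.

    For the sqrt-Husimi density the formula already holds between the integrands. What
    remains is the integral of |f0| |Phi|^2 |O|^2, with one overlap for each of y and z.
    The overlaps decay faster than any power, by integration by parts
    ([coherent_rapid]), while the prefactor is bounded and the matrix element grows at
    most polynomially ([prefactor_bounds], [matrix_element_bound], [flow_bracket]). *)

Set Implicit Arguments.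
Unset Strict Implicit.
Unset Printing Implicit Defensive.
Import Order.TTheory GRing.Theory Num.Theory.
Import numFieldNormedType.Exports.
Import ComplexField.Normc.
Local Open Scope classical_set_scope.
Local Open Scope complex_scope.
Local Open Scope ring_scope.

(** * Derivatives along a direction *)

Section DirectionalDerivatives.
Context {R : realType} {V : normedModType R}.
Implicit Types (f g : V -> R) (x v : V).

Lemma is_derive_line (f : V -> R) x v (d : R) (s : R) :
  is_derive (x + s *: v) v f d <-> is_derive s 1 (fun t : R => f (x + t *: v)) d.
Proof.
have E : (fun h : R => h^-1 *: (f (h *: v + (x + s *: v)) - f (x + s *: v))) =
         (fun h : R => h^-1 *: (f (x + (h *: 1 + s) *: v) - f (x + s *: v))).
  apply/funext => h; congr (_ *: (f _ - _)).
  by rewrite scalerDl addrCA; congr (_ + (_ + _)); rewrite [h *: 1]mulr1.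
split=> -[h1 h2]; split.
- by rewrite /derivable -E; exact: h1.
- by rewrite -h2 /derive -E.
- by rewrite /derivable E; exact: h1.
- by rewrite -h2 /derive E.
Qed.

Lemma is_derive_at0 f x v (d : R) :
  is_derive x v f d <-> is_derive (0 : R) 1 (fun t : R => f (x + t *: v)) d.
Proof. by rewrite -is_derive_line scale0r addr0. Qed.

Lemma drv_add f g x v (df dg : R) : is_derive x v f df -> is_derive x v g dg ->
  is_derive x v (fun y => f y + g y) (df + dg).
Proof. exact: is_deriveD. Qed.

Lemma drv_sub f g x v (df dg : R) : is_derive x v f df -> is_derive x v g dg ->
  is_derive x v (fun y => f y - g y) (df - dg).
Proof. exact: is_deriveB. Qed.

Lemma drv_opp f x v (df : R) : is_derive x v f df ->
  is_derive x v (fun y => - f y) (- df).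
Proof. exact: is_deriveN. Qed.

Lemma drv_mul f g x v (df dg : R) : is_derive x v f df -> is_derive x v g dg ->
  is_derive x v (fun y => f y * g y) (df * g x + f x * dg).
Proof.
move=> hf hg; apply: (is_derive_eq (is_deriveM hf hg)).
by rewrite addrC [_ *: df]mulrC.
Qed.

Lemma drv_const (c : R) x v : is_derive x v (fun=> c) 0.
Proof. exact: is_derive_cst. Qed.

Lemma drv_scale (c : R) f x v (df : R) : is_derive x v f df ->
  is_derive x v (fun y => c * f y) (c * df).
Proof.
by move=> hf; have := drv_mul (drv_const c x v) hf; rewrite mul0r add0r.
Qed.

Lemma drv_exp f n x v (df : R) : is_derive x v f df ->
  is_derive x v (fun y => f y ^+ n) (n%:R * f x ^+ n.-1 * df).
Proof.
move=> hf; elim: n => [|n IH].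
  by under eq_fun do rewrite expr0; rewrite !mul0r; exact: drv_const.
under eq_fun do rewrite exprS.
apply: (is_derive_eq (drv_mul hf IH)) => /=.
by case: n {IH} => [|n]; [rewrite expr0; ring|rewrite exprS -!natr1; ring].
Qed.

Lemma drv_comp f (h : R -> R) x v (df dh : R) : is_derive (f x) 1 h dh ->
  is_derive x v f df -> is_derive x v (fun y => h (f y)) (dh * df).
Proof.
move=> hh /is_derive_at0 hf; apply/is_derive_at0.
have := @is_derive1_comp R h (fun t => f (x + t *: v)) 0 dh df.
by apply => //; rewrite scale0r addr0.
Qed.

Lemma drv_sum (I : Type) (r : seq I) (P : pred I) (f : I -> V -> R) x v (df : I -> R) :
  (forall i, is_derive x v (f i) (df i)) ->
  is_derive x v (fun y => \sum_(i <- r | P i) f i y) (\sum_(i <- r | P i) df i).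
Proof.
move=> h; elim: r => [|i r IH].
  by under eq_fun do rewrite big_nil; rewrite big_nil; exact: drv_const.
under eq_fun do rewrite big_cons; rewrite big_cons; case: ifP => // _.
exact: drv_add.
Qed.

Lemma drv_id (x v : R) : is_derive x v (fun y : R => y) v.
Proof. exact: is_derive_id. Qed.

Lemma drv_ext f g x v (d : R) : f =1 g -> is_derive x v f d -> is_derive x v g d.
Proof. by move=> /funext ->. Qed.

End DirectionalDerivatives.

(** * Boxes and Borel sets of column vectors *)

Section CoordinateMeasurability.
Context {R : realType} {n : nat}.
Implicit Types (x c : 'cV[R]_n) (f : 'cV[R]_n -> R).

(** The ball of the sup norm, in a form whose measure splits over the coordinates. *)
Definition box c (r : R) : set 'cV[R]_n := [set x | forall i, `|x i 0 - c i 0| < r].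

Lemma boxE c r : 0 < r -> box c r = [set x | `|x - c| < r].
Proof.
move=> r0; apply/seteqP; split => x /= h.
  rewrite [ltLHS]/Num.Def.normr/= mx_normrE; apply: bigmax_lt => // -[i j] _ /=.
  by rewrite !mxE (ord1 j); exact: h.
move=> i; apply: le_lt_trans h; rewrite [leRHS]/Num.Def.normr/= mx_normrE.
by have := le_bigmax (0 : R) (fun ij : 'I_n * 'I_1 => `|(x - c) ij.1 ij.2|) (i, 0);
  rewrite /= !mxE.
Qed.

Lemma ler_entry_norm x i : `|x i 0| <= `|x|.
Proof.
rewrite [leRHS]/Num.Def.normr/= mx_normrE.
exact: (le_bigmax (0 : R) (fun ij : 'I_n * 'I_1 => `|x ij.1 ij.2|) (i, 0)).
Qed.

Lemma cV_norm_le x (r : R) : 0 <= r -> (forall i, `|x i 0| <= r) -> `|x| <= r.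
Proof.
move=> r0 h; rewrite [leLHS]/Num.Def.normr/= mx_normrE.
by apply: bigmax_le => // -[i j] _ /=; rewrite (ord1 j).
Qed.

Lemma measurable_box c r : measurable (box c r).
Proof.
rewrite (_ : box c r = \bigcap_(i in [set: 'I_n])
    ((fun x => x i 0) @^-1` [set s | `|s - c i 0| < r])).
  apply: fin_bigcap_measurable => // i _.
  rewrite -[X in measurable X]setTI; apply: measurable_mx_entry => //.
  rewrite (_ : [set _ | _] = ball (c i 0) r).
    by apply: open_measurable; exact: ball_open.
  by apply/seteqP; split => s /=; rewrite /ball /= distrC.
by apply/seteqP; split => x /= h i; [move=> _|]; exact: h.
Qed.

(** The sigma-algebra is generated by the entries, so an open set has to be exhibited as a
    countable union of boxes with rational centres. *)
Lemma open_measurable_cV (U : set 'cV[R]_n) : open U -> measurable U.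
Proof.
move=> oU.
pose B (ck : 'cV[rat]_n * nat) : set 'cV[R]_n :=
  box (map_mx ratr ck.1) (ck.2.+1%:R^-1).
pose F ck := if pselect (B ck `<=` U) then B ck else set0.
have -> : U = \bigcup_ck F ck; last first.
  apply: countable_bigcupT_measurable; first exact: countableP.
  by move=> ck; rewrite /F; case: pselect => //= _; exact: measurable_box.
apply/seteqP; split => [x Ux|x [ck _]]; last first.
  by rewrite /F; case: pselect => //= h /h.
have /nbhs_ballP[e /= e0 xeU] := open_nbhs_nbhs (conj oU Ux).
(* Half of the radius for the box, the other half for its rational centre. *)
have [k ke] : exists k : nat, (k.+1%:R^-1 : R) < e / 2.
  have h := ltr_add_invr; exists (Num.truncn (2 / e)).
  rewrite invf_plt ?posrE ?divr_gt0// invf_div.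
  by have := truncnS_gt (2 / e); rewrite ?mulr1n.
have /choice[c hc] : forall i, exists q : rat, `|x i 0 - ratr q| < k.+1%:R^-1.
  move=> i; have h : x i 0 - k.+1%:R^-1 < x i 0 + k.+1%:R^-1.
    by rewrite ltrD2l; apply: (@lt_trans _ _ 0); rewrite ?oppr_lt0 ?invr_gt0.
  have [q] := rat_in_itvoo h; rewrite in_itv /= => /andP[h1 h2].
  exists q; move: h1 h2; move: (ratr q) (k.+1%:R^-1) => s d h1 h2.
  by rewrite ltr_norml; apply/andP; split; lra.
exists (\col_i c i, k) => //; rewrite /F; case: pselect => /= [_|[]].
  by move=> i; rewrite /= !mxE.
move=> y /= yB; apply: xeU; rewrite mx_norm_ball /ball_ /=.
have : box x e y.
  move=> i; have := yB i; have := hc i; rewrite /= !mxE.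
  move: ke; set d := k.+1%:R^-1 => ke; rewrite !ltr_norml => /andP[h1 h2] /andP[h3 h4].
  by apply/andP; split; lra.
by rewrite boxE//= distrC.
Qed.

Lemma continuous_measurable_cV f : continuous f -> measurable_fun setT f.
Proof.
move=> cf; apply: (measurability _ (RGenOpens.measurableE R)).
move=> _ [_ [a [b ->]] <-]; rewrite setTI; apply: open_measurable_cV.
by move/continuousP : cf; apply; exact: interval_open.
Qed.

End CoordinateMeasurability.

(** * Iterated integrals and an integrable weight *)

Section IteratedIntegrals.
Context {R : realType} (n : nat).
Local Notation mu := (lebesgue_cV R n).
Local Notation mu1 := (lebesgue_cV R n.+1).
Local Notation leb := (@lebesgue_measure R).

Lemma cons_cV0 (s : R) (x : 'cV[R]_n) : cons_cV (s, x) ord0 0 = s.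
Proof.
rewrite /cons_cV /=.
rewrite [LHS](_ : _ = (col_mx s%:M x : 'cV[R]_(1 + n)) (lshift n ord0) 0).
  by rewrite col_mxEu mxE eqxx mulr1n.
by congr (fun_of_matrix _ _ _); apply/val_inj.
Qed.

Lemma cons_cVS (s : R) (x : 'cV[R]_n) i : cons_cV (s, x) (lift ord0 i) 0 = x i 0.
Proof.
rewrite /cons_cV /=.
rewrite [LHS](_ : _ = (col_mx s%:M x : 'cV[R]_(1 + n)) (rshift 1 i) 0).
  by rewrite col_mxEd.
by congr (fun_of_matrix _ _ _); apply/val_inj.
Qed.

Lemma cons_cV_eta (y : 'cV[R]_n.+1) :
  y = cons_cV (y ord0 0, \col_i y (lift ord0 i) 0).
Proof.
apply/matrixP => i j; rewrite (ord1 j); case: (unliftP ord0 i) => [k|] ->.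
  by rewrite cons_cVS mxE.
by rewrite cons_cV0.
Qed.

Lemma cons_cV_shift0 (s t : R) (x : 'cV[R]_n) :
  cons_cV (s, x) + t *: delta_mx ord0 0 = cons_cV (s + t, x).
Proof.
apply/matrixP => i j; rewrite (ord1 j) [LHS]mxE [X in _ + X = _]mxE [X in _ * X]mxE.
case: (unliftP ord0 i) => [k|] ->; first by rewrite !cons_cVS /= mulr0 addr0.
by rewrite !cons_cV0 eqxx /= mulr1.
Qed.

Lemma cons_cV_shiftS (s t : R) (x : 'cV[R]_n) i :
  cons_cV (s, x) + t *: delta_mx (lift ord0 i) 0 = cons_cV (s, x + t *: delta_mx i 0).
Proof.
apply/matrixP => k j; rewrite (ord1 j) [LHS]mxE [X in _ + X = _]mxE [X in _ * X]mxE.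
case: (unliftP ord0 k) => [l|] ->.
  by rewrite !cons_cVS !mxE (inj_eq lift_inj).
by rewrite !cons_cV0 /= mulr0 addr0.
Qed.

Lemma measurable_cons_cVl (x : 'cV[R]_n) : measurable_fun setT (fun s : R => cons_cV (s, x)).
Proof.
apply: (measurableT_comp (@measurable_cons_cV R n)).
by apply/measurable_fun_pair => //=; exact: measurable_cst.
Qed.

Lemma measurable_cons_cVr (s : R) : measurable_fun setT (fun x : 'cV[R]_n => cons_cV (s, x)).
Proof.
apply: (measurableT_comp (@measurable_cons_cV R n)).
by apply/measurable_fun_pair => //=; exact: measurable_cst.
Qed.

(** The measure in dimension n + 1 is the image of a product measure under [cons_cV], so
    Tonelli's theorem separates the first coordinate. *)
Lemma ge0_integral_cons (f : 'cV[R]_n.+1 -> \bar R) :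
  measurable_fun setT f -> (forall y, 0 <= f y)%E ->
  (\int[mu1]_y f y = \int[leb]_s \int[mu]_x f (cons_cV (s, x)))%E.
Proof.
move=> mf f0.
transitivity (\int[leb \x mu]_w (f \o @cons_cV R n) w)%E.
  have h := (ge0_integral_pushforward (@measurable_cons_cV R n) (leb \x mu)%E
    measurableT mf (fun y _ => f0 y)).
  rewrite preimage_setT in h.  exact: h.
rewrite fubini_tonelli1//; last by move=> w; exact: f0.
exact: (measurableT_comp mf (@measurable_cons_cV R n)).
Qed.

Lemma ge0_integral_cons_swap (f : 'cV[R]_n.+1 -> \bar R) :
  measurable_fun setT f -> (forall y, 0 <= f y)%E ->
  (\int[mu1]_y f y = \int[mu]_x \int[leb]_s f (cons_cV (s, x)))%E.
Proof.
move=> mf f0.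
transitivity (\int[leb \x mu]_w (f \o @cons_cV R n) w)%E.
  have h := (ge0_integral_pushforward (@measurable_cons_cV R n) (leb \x mu)%E
    measurableT mf (fun y _ => f0 y)).
  rewrite preimage_setT in h.  exact: h.
rewrite fubini_tonelli2//; last by move=> w; exact: f0.
exact: (measurableT_comp mf (@measurable_cons_cV R n)).
Qed.

Lemma integrable_cons (f : 'cV[R]_n.+1 -> \bar R) : mu1.-integrable setT f ->
  (leb \x mu)%E.-integrable setT (f \o @cons_cV R n).
Proof.
move=> /integrableP[mf fi]; apply/integrableP; split.
  exact: (measurableT_comp mf (@measurable_cons_cV R n)).
have maf : measurable_fun setT (fun y => `|f y|)%E by exact: measurableT_comp.
have := ge0_integral_pushforward (@measurable_cons_cV R n) (leb \x mu)%E
    measurableT maf (fun y _ => abse_ge0 (f y)).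
by move=> <-.
Qed.

Lemma integral_cons (f : 'cV[R]_n.+1 -> \bar R) : mu1.-integrable setT f ->
  (\int[mu1]_y f y = \int[leb]_s \int[mu]_x f (cons_cV (s, x)))%E.
Proof.
move=> fi; have := integrable_cons fi; move/integrableP : fi => [mf _] fi.
transitivity (\int[leb \x mu]_w (f \o @cons_cV R n) w)%E.
  exact: (integral_pushforward (@measurable_cons_cV R n) mf fi measurableT).
by rewrite -integral12_prod_meas1.
Qed.

Lemma integral_cons_swap (f : 'cV[R]_n.+1 -> \bar R) : mu1.-integrable setT f ->
  (\int[mu1]_y f y = \int[mu]_x \int[leb]_s f (cons_cV (s, x)))%E.
Proof.
move=> fi; have := integrable_cons fi; move/integrableP : fi => [mf _] fi.
transitivity (\int[leb \x mu]_w (f \o @cons_cV R n) w)%E.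
  exact: (integral_pushforward (@measurable_cons_cV R n) mf fi measurableT).
by rewrite -integral21_prod_meas1.
Qed.

End IteratedIntegrals.

Section Weight.
Context {R : realType}.
Local Notation leb := (@lebesgue_measure R).

Definition wt1 (s : R) : R := (1 + s ^+ 2)^-1.

(** A weight that is integrable and factors over the coordinates; its multiples
    dominate the integrands over configuration space and over phase space. *)
Definition wt (n : nat) (x : 'cV[R]_n) : R := \prod_(i < n) wt1 (x i 0).

Lemma wt1_gt0 s : 0 < wt1 s.
Proof. by rewrite invr_gt0 ltr_pwDl// sqr_ge0. Qed.

Lemma wt_gt0 n (x : 'cV[R]_n) : 0 < wt x.
Proof. by apply: prodr_gt0 => i _; exact: wt1_gt0. Qed.

Lemma wt_cons n (s : R) (x : 'cV[R]_n) : wt (cons_cV (s, x)) = wt1 s * wt x.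
Proof.
rewrite /wt big_ord_recl cons_cV0; congr (_ * _).
by apply: eq_bigr => i _; rewrite cons_cVS.
Qed.

Lemma continuous_wt1 : continuous wt1.
Proof. exact: continuous_oneDsqrV. Qed.

Lemma measurable_wt1 : measurable_fun setT wt1.
Proof. exact: continuous_measurable_fun continuous_wt1. Qed.

Lemma measurable_wt n : measurable_fun setT (@wt n).
Proof.
apply: measurable_prod => i _.
by apply: (measurableT_comp measurable_wt1); exact: measurable_mx_entry.
Qed.

Lemma emeasurable_wt1 : measurable_fun setT (fun s => (wt1 s)%:E).
Proof. by apply: measurableT_comp => //; exact: measurable_wt1. Qed.

Lemma emeasurable_wt n : measurable_fun setT (fun x : 'cV[R]_n => (wt x)%:E).
Proof. by apply: measurableT_comp => //; exact: measurable_wt. Qed.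

Lemma integral_wt1 : (\int[leb]_s (wt1 s)%:E < +oo)%E.
Proof.
rewrite ge0_symfun_integralT; first last.
- by move=> s; rewrite /wt1 /= sqrrN.
- exact: continuous_wt1.
- by move=> s; exact/ltW/wt1_gt0.
have -> : [set x : R | 0 <= x] = `[0, +oo[%classic.
  by apply/seteqP; split => x /=; rewrite in_itv /= andbT.
by rewrite integral0y_oneDsqr -EFinM ltry.
Qed.

Lemma integral_wt n : (\int[lebesgue_cV R n]_x (wt x)%:E < +oo)%E.
Proof.
elim: n => [|n IH].
  rewrite integral_dirac//=; last exact: emeasurable_wt.
  by rewrite diracT mul1e ltry.
rewrite ge0_integral_cons//; first last.
- by move=> x; rewrite lee_fin ltW// wt_gt0.
- exact: emeasurable_wt.
under eq_integral => s _.
  under eq_integral do rewrite wt_cons EFinM.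
  rewrite ge0_integralZl//; first last.
  - by rewrite lee_fin ltW// wt1_gt0.
  - by move=> x _; rewrite lee_fin ltW// wt_gt0.
  - exact: emeasurable_wt.
  over.
rewrite ge0_integralZr//; first last.
- by apply: integral_ge0 => x _; rewrite lee_fin ltW// wt_gt0.
- by move=> x _; rewrite lee_fin ltW// wt1_gt0.
- exact: emeasurable_wt1.
rewrite lte_mul_pinfty//.
  by apply: integral_ge0 => x _; rewrite lee_fin ltW// wt1_gt0.
rewrite ge0_fin_numE//; first exact: integral_wt1.
by apply: integral_ge0 => x _; rewrite lee_fin ltW// wt1_gt0.
Qed.

Lemma integrable_wt n (C : R) :
  (lebesgue_cV R n).-integrable setT (fun x => (C * wt x)%:E).
Proof.
under eq_fun do rewrite EFinM.
apply: integrableZl => //; apply/integrableP; split.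
  exact: emeasurable_wt.
under eq_integral do rewrite gee0_abs ?lee_fin ?ltW ?wt_gt0//.
exact: integral_wt.
Qed.

Lemma integrable_le_wt n (C : R) (f : 'cV[R]_n -> R) :
  measurable_fun setT f -> (forall x, `|f x| <= C * wt x) ->
  (lebesgue_cV R n).-integrable setT (EFin \o f).
Proof.
move=> mf fC; apply: (le_integrable measurableT _ _ (integrable_wt n C)).
  exact/measurable_EFinP.
by move=> x _ /=; rewrite lee_fin (le_trans (fC x))// ler_norm.
Qed.

Lemma integrable_le_wt1 (C : R) (f : R -> R) :
  measurable_fun setT f -> (forall x, `|f x| <= C * wt1 x) ->
  leb.-integrable setT (EFin \o f).
Proof.
move=> mf fC.
have wi : leb.-integrable setT (fun s => (C * wt1 s)%:E).
  under eq_fun do rewrite EFinM.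
  apply: integrableZl => //; apply/integrableP; split; first exact: emeasurable_wt1.
  under eq_integral do rewrite gee0_abs ?lee_fin ?ltW ?wt1_gt0//.
  exact: integral_wt1.
apply: (le_integrable measurableT _ _ wi).
  exact/measurable_EFinP.
by move=> x _ /=; rewrite lee_fin (le_trans (fC x))// ler_norm.
Qed.

End Weight.

Lemma lebesgue_box (R : realType) n (c : 'cV[R]_n) (r : R) : 0 < r ->
  lebesgue_cV R n (box c r) = ((r *+ 2) ^+ n)%:E.
Proof.
move=> r0; elim: n c => [|n IH] c.
  by rewrite /= diracE mem_set// => -[].
rewrite /= /lebesgue_cons /pushforward.
rewrite (_ : _ @^-1` _ = ball (c ord0 0) r `*` box (\col_i c (lift ord0 i) 0) r).
  rewrite product_measure1E//; first last.
  - exact: measurable_box.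
  - by apply: open_measurable; exact: ball_open.
  rewrite exprS EFinM; congr (_ * _)%E; last exact: IH.
  exact: lebesgue_measure_ball (ltW r0).
apply/seteqP; split => -[s x] /=.
  move=> h; split; first by have := h ord0; rewrite cons_cV0 distrC.
  by move=> i; have := h (lift ord0 i); rewrite cons_cVS !mxE.
move=> [h1 h2] i; case: (unliftP ord0 i) => [k|] ->.
  by rewrite cons_cVS; have := h2 k; rewrite mxE.
by rewrite cons_cV0 distrC.
Qed.

(** * Calculus in one variable *)

Section RealLine.
Context {R : realType}.
Local Notation leb := (@lebesgue_measure R).
Implicit Types (f g df : R -> R) (a b s : R).

Lemma is_derive_continuous f df : (forall s, is_derive s 1 f (df s)) -> continuous f.
Proof.
move=> dfE s; apply/differentiable_continuous/derivable1_diffP.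
by have [] := dfE s.
Qed.

Lemma derive_mean_value f df a b : (forall s, is_derive s 1 f (df s)) -> a <= b ->
  exists2 c, a <= c <= b & f b - f a = df c * (b - a).
Proof.
move=> dfE ab.
have cf : {within `[a, b], continuous f}.
  exact/continuous_subspaceT/is_derive_continuous.
have [c] := MVT_segment ab (fun x _ => dfE x) cf.
by rewrite in_itv /= => cab ?; exists c.
Qed.

Lemma derive_ge0_homo f df a b : (forall s, is_derive s 1 f (df s)) -> a <= b ->
  (forall s, a <= s <= b -> 0 <= df s) -> f a <= f b.
Proof.
move=> dfE ab h; have [c cab E] := derive_mean_value dfE ab.
by rewrite -subr_ge0 E mulr_ge0 ?h// subr_ge0.
Qed.

Lemma derive_norm_le f df (L : R) a b : (forall s, is_derive s 1 f (df s)) ->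
  (forall s, `|df s| <= L) -> `|f b - f a| <= L * `|b - a|.
Proof.
move=> dfE h; wlog ab : a b / a <= b => [H|].
  by case: (leP a b) => [/H //|/ltW/H]; rewrite distrC (distrC a).
have [c _ ->] := derive_mean_value dfE ab.
by rewrite normrM ler_wpM2r.
Qed.

Lemma expr_le_fact_expR (y : R) m : 0 <= y -> y ^+ m <= m`!%:R * expR y.
Proof.
move=> y0; case: m => [|m].
  by rewrite expr0 fact0 mul1r -expR0 ler_expR.
have := expR_ge1Dxn m y0; rewrite -ler_pdivrMl ?ltr0n ?fact_gt0// mulrC.
by apply: le_trans; rewrite lerDr.
Qed.

(** A zero at which the derivative does not vanish is isolated, and a set has only
    countably many isolated points. *)
Lemma negligible_zeros_derive f df : (forall s, is_derive s 1 f (df s)) ->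
  leb.-negligible [set s | f s = 0 /\ df s != 0].
Proof.
move=> dfE.
have I0 : leb.-negligible (isolated ([set s | f s = 0] : set R)).
  have cI := @countable_isolated R [set s | f s = 0].
  apply/negligibleP; first exact: countable_measurable.
  exact: countable_lebesgue_measure0.
apply: negligibleS I0.
move=> a /= [fa0 dfa0]; split; first exact/mem_set.
have [/= df1 df2] := dfE a.
have H : (h^-1 * (f (h + a) - f a)) @[h --> 0^'] --> df a.
  have : h^-1 *: (f (h *: 1 + a) - f a) @[h --> 0^'] --> df a by rewrite -df2; exact: df1.
  by under eq_fun do rewrite scaler1.
have [e /= e0 he] := cvgr_neq0 _ H dfa0.
exists (ball a e); first exact: nbhsx_ballx.
apply/seteqP; split => s /=; last by move=> ->; split => //; exact: ballxx.
move=> [sae fs0]; apply/eqP/negPn/negP => sa.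
have := he (s - a); rewrite /ball /= sub0r normrN distrC in sae * => /(_ sae).
by rewrite subr_eq0 => /(_ sa); rewrite subrK fs0 fa0 subrr mulr0 eqxx.
Qed.

(** The Taylor remainder at a point where all the derivatives vanish. The order [m] is
    general because the induction on [k] passes from [f m] to [f m.+1]. *)
Lemma vanishing_taylor_bound (f : nat -> R -> R) (a H B : R) k m :
  (forall m s, is_derive s 1 (f m) (f m.+1 s)) -> (forall m, f m a = 0) ->
  (forall s, `|s - a| <= H -> `|f (m + k)%N s| <= B) ->
  forall s, `|s - a| <= H -> `|f m s| <= B * `|s - a| ^+ k / k`!%:R.
Proof.
move=> df fa; elim: k m => [|k IH] m hB s sH.
  by rewrite expr0 fact0 mulr1 divr1; have := hB s sH; rewrite addn0.
have {}IH := IH m.+1; rewrite addSnnS in IH; have {}IH := IH hB.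
(* The signs e = 1 and e = -1 give the two halves of the absolute value. *)
have key (e : R) : `|e| = 1 -> e * f m s <= B * `|s - a| ^+ k.+1 / k.+1`!%:R.
  move=> e1.
  have bound u : `|u - a| <= H -> `|e * f m.+1 u| <= B * `|u - a| ^+ k / k`!%:R.
    by move=> uH; rewrite normrM e1 mul1r; exact: IH.
  pose P u : R := B * (u - a) ^+ k.+1 / k.+1`!%:R.
  have dP (u : R) : is_derive u 1 P (B * (u - a) ^+ k / k`!%:R).
    have := drv_exp k.+1 (drv_sub (drv_id u 1) (drv_const a u 1)).
    move=> /(drv_scale (B / k.+1`!%:R)); rewrite subr0 mulr1.
    under eq_fun do rewrite mulrAC.
    move=> /is_derive_eq; apply; rewrite /= factS natrM invfM.
    by field; rewrite pnatr_eq0 -lt0n fact_gt0 /= addrC natr1 pnatr_eq0.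
  have dE (u : R) : is_derive u 1 (fun w => e * f m w) (e * f m.+1 u).
    exact: drv_scale.
  have [as_|sa] := leP a s.
    have := @derive_ge0_homo (fun u => P u - e * f m u) _ a s
      (fun u => drv_sub (dP u) (dE u)) as_.
    rewrite /P subrr fa mulr0 subr0 expr0n /= mulr0 mul0r subr_ge0.
    rewrite ger0_norm ?subr_ge0//; apply => u /andP[au us].
    have : `|u - a| <= H.
      apply: le_trans sH; rewrite !ger0_norm ?subr_ge0 ?(le_trans au)//.
      by rewrite lerD2r.
    by move=> /bound; rewrite subr_ge0 [`|u - a|]ger0_norm ?subr_ge0// ler_norml => /andP[].
  (* To the left of a the power of u - a changes its sign with the parity of k. *)
  have dQ (u : R) : is_derive u 1 (fun w => (- 1) ^+ k.+1 * P w + - (e * f m w))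
       ((- 1) ^+ k.+1 * (B * (u - a) ^+ k / k`!%:R) + - (e * f m.+1 u)).
    exact: drv_add (drv_scale _ (dP u)) (drv_opp (dE u)).
  have := @derive_ge0_homo (fun u => - ((- 1) ^+ k.+1 * P u + - (e * f m u))) _ s a
      (fun u => drv_opp (dQ u)) (ltW sa).
  have PE u : u <= a -> (- 1) ^+ k.+1 * P u = B * `|u - a| ^+ k.+1 / k.+1`!%:R.
    move=> ua; rewrite /P ler0_norm ?subr_le0// [(- (u - a)) ^+ _]exprNn; ring.
  rewrite (PE _ (ltW sa)) PE// fa subrr normr0 mulr0 subr0 expr0n /= mulr0 mul0r oppr0.
  rewrite oppr_le0 subr_ge0; apply => u /andP[su ua].
  have uH : `|u - a| <= H.
    apply: le_trans sH; rewrite !ler0_norm ?subr_le0 ?(le_trans su)//.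
    by rewrite lerN2 lerD2r.
  have := bound u uH; rewrite [`|u - a|]ler0_norm ?subr_le0//.
  rewrite [(- (u - a)) ^+ _]exprNn ler_norml => /andP[h1 _].
  rewrite [X in 0 <= X](_ : _ =
    e * f m.+1 u + B * ((-1) ^+ k * (u - a) ^+ k) / k`!%:R); last first.
    by rewrite exprS; ring.
  by rewrite -lerBlDr sub0r.
rewrite ler_norml; apply/andP; split; last by rewrite -[f m s]mul1r key ?normr1.
by rewrite lerNl -mulN1r key// normrN1.
Qed.

End RealLine.

(** * Zeros of entire functions of one variable *)

Section AnalyticZeros.
Context {R : realType}.
Local Notation leb := (@lebesgue_measure R).

(** The bounds on the derivatives, with arbitrary radius, say that [f 0] is entire. A zero
    of [f 0] outside the countable union of the simple zeros of the derivatives is a zero of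
    all of them, and then the Taylor remainders force [f 0] to vanish everywhere. *)
Lemma analytic_zeros (f : nat -> R -> R) :
  (forall m (s : R), is_derive s 1 (f m) (f m.+1 s)) ->
  (forall r rho : R, 0 < rho -> exists C, forall m s, `|s| <= r ->
     `|f m s| <= C * m`!%:R / rho ^+ m) ->
  (forall s, f 0%N s = 0) \/ leb.-negligible [set s | f 0%N s = 0].
Proof.
move=> df fC.
(* The points where some derivative vanishes and the next one does not. *)
pose N := \bigcup_m [set s | f m s = 0 /\ f m.+1 s != 0].
have nN : leb.-negligible N.
  by apply: negligible_bigcup => m; exact: negligible_zeros_derive (df m).
have [Z|] := pselect ([set s | f 0%N s = 0] `<=` N).
  by right; apply: negligibleS nN.
move=> /existsNP[a /not_implyP[/= fa0 Na]]; left.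
have fa m : f m a = 0.
  elim: m => [//|m IH]; apply/eqP/negPn/negP => h; apply: Na; by exists m.
move=> s; pose H := `|s - a|; pose r := `|a| + H.
have H0 : 0 <= H by exact: normr_ge0.
have rho0 : 0 < H *+ 2 + 1 by rewrite ltr_wpDl// mulrn_wge0.
have [C hC] := fC r _ rho0.
have C0 : 0 <= C.
  have := le_trans (normr_ge0 _) (hC 0%N a _).
  by rewrite /= fact0 expr0 mulr1 divr1; apply; rewrite /r lerDl.
have bound m : `|f 0%N s| <= C * 2^-1 ^+ m.
  have := @vanishing_taylor_bound _ f a H (C * m`!%:R / (H *+ 2 + 1) ^+ m) m 0%N df fa.
  move=> /(_ _ s (lexx _)) h; apply: le_trans (h _) _.
    move=> u uH; apply: hC; rewrite -(subrK a u) addrC (le_trans (ler_normD _ _))//.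
    by rewrite /r lerD2l.
  rewrite -/H (_ : _ / _ = C * (H / (H *+ 2 + 1)) ^+ m).
    rewrite ler_wpM2l// lerXn2r ?nnegrE ?invr_ge0// ?divr_ge0//; first exact: ltW.
    by rewrite ler_pdivrMr// mulrC; lra.
  rewrite expr_div_n; field.
  by rewrite pnatr_eq0 -lt0n fact_gt0 expf_neq0 ?gt_eqF.
apply/eqP; rewrite -normr_le0; apply/ler_addgt0Pl => e e0; rewrite addr0.
have : C * 2^-1 ^+ m @[m --> \oo] --> C * 0.
  by apply: cvgM; [exact: cvg_cst|apply: cvg_expr]; rewrite ger0_norm ?invr_ge0// invf_lt1 ?ltr1n.
rewrite mulr0 => /cvgr0_norm_le/(_ _ e0)[m _ /(_ m (leqnn m))] /=.
rewrite ger0_norm ?mulr_ge0 ?exprn_ge0 ?invr_ge0//.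
exact: le_trans (bound m).
Qed.

(** Here [k m s x] stands for the m-th derivative in s of an integrand such as
    exp(s alpha(x)) Phi(x). The factor |alpha|^m is absorbed by m! rho^-m exp(rho |alpha|), so
    exponential integrability makes the parametric integral entire. *)
Lemma parametric_integral_zeros n (k : nat -> R -> 'cV[R]_n -> R)
    (alpha Phi : 'cV[R]_n -> R) :
  (forall m (s : R) x, is_derive s 1 (k m ^~ x) (k m.+1 s x)) ->
  (forall m s, measurable_fun setT (k m s)) ->
  (forall m s x, `|k m s x| <= `|alpha x| ^+ m * expR (`|s| * `|alpha x|) * Phi x) ->
  (forall r : R, exists C, forall x, expR (r * `|alpha x|) * Phi x <= C * wt x) ->
  let f s := \int[lebesgue_cV R n]_x (k 0%N s x) in
  (forall s, f s = 0) \/ leb.-negligible [set s | f s = 0].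
Proof.
move=> dk mk kb eb f.
pose F m s : R := \int[lebesgue_cV R n]_x (k m s x).
have Phi0 x : 0 <= Phi x.
  have := le_trans (normr_ge0 _) (kb 0%N 0 x).
  by rewrite expr0 mul1r normr0 mul0r expR0 mul1r.
have bound (r rho : R) : 0 < rho -> exists C, 0 <= C /\ forall m s x, `|s| <= r ->
    `|k m s x| <= C * m`!%:R / rho ^+ m * wt x.
  move=> rho0; have [C hC] := eb (rho + r); exists C; split.
    have := le_trans (mulr_ge0 (expR_ge0 _) (Phi0 0)) (hC 0).
    by rewrite pmulr_lge0// wt_gt0.
  move=> m s x sr; apply: le_trans (kb m s x) _.
  (* From y^m <= m! exp(y) at y = rho |alpha|. *)
  have h1 : `|alpha x| ^+ m <= m`!%:R / rho ^+ m * expR (rho * `|alpha x|).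
    rewrite mulrAC ler_pdivlMr ?exprn_gt0// mulrC -exprMn.
    by apply: expr_le_fact_expR; rewrite mulr_ge0// ltW.
  apply: le_trans (_ : m`!%:R / rho ^+ m * (expR ((rho + r) * `|alpha x|) * Phi x) <= _).
    rewrite mulrDl expRD [leRHS]mulrA [X in _ <= X * _]mulrA ler_wpM2r//.
    apply: ler_pM => //; rewrite ?exprn_ge0 ?expR_ge0//.
    by rewrite ler_expR ler_wpM2r.
  rewrite (_ : C * m`!%:R / rho ^+ m * wt x = m`!%:R / rho ^+ m * (C * wt x)); last ring.
  by rewrite ler_wpM2l// mulr_ge0 ?ler0n// invr_ge0 exprn_ge0// ltW.
have intk m s : (lebesgue_cV R n).-integrable setT (EFin \o k m s).
  have [C [C0 hC]] := bound `|s| 1 ltr01.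
  by apply: (integrable_le_wt (mk m s)) => x; exact: hC.
apply: (@analytic_zeros F) => [m s|r rho rho0]; last first.
  have [C [C0 hC]] := bound r rho rho0.
  exists (C * \int[lebesgue_cV R n]_x wt x) => m s sr.
  apply: le_trans (le_normr_Rintegral measurableT (intk m s)) _.
  have iw : (lebesgue_cV R n).-integrable setT (EFin \o @wt R n).
    have := @integrable_wt R n 1; congr (_.-integrable _ _).
    by apply/funext => x; rewrite mul1r.
  rewrite [leRHS](_ : _ = \int[lebesgue_cV R n]_x (C * m`!%:R / rho ^+ m * wt x));
    last by rewrite RintegralZl//; ring.
  apply: le_Rintegral => //.
  - have := integrable_norm (intk m s); exact.
  - exact: integrable_wt.
  by move=> x _; have := hC m s x sr.
have [C [C0 hC]] := bound (`|s| + 1) 1 ltr01.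
have sI : `](s - 1), (s + 1)[%classic s by rewrite /= in_itv /= ltrBlDr ltrDl ltr01.
have cC (x : 'cV[R]_n) : 0 <= C * m.+1`!%:R / 1 ^+ m.+1 * wt x.
  by rewrite !mulr_ge0 ?invr_ge0 ?exprn_ge0// ltW// wt_gt0.
have Ib (u : R) : `](s - 1), (s + 1)[%classic u -> `|u| <= `|s| + 1.
  rewrite /= in_itv /= => /andP[u1 u2]; rewrite -(subrK s u) addrC.
  rewrite (le_trans (ler_normD _ _))// lerD2l ler_norml; apply/andP; split; lra.
have d1 u x : partial1of2 (k m) u x = k m.+1 u x.
  by rewrite partial1of2E; have [_ ->] := dk m u x.
have := @cvg_differentiation_under_integral R _ _ (lebesgue_cV R n) (k m) setT
  measurableT s (s - 1) (s + 1) sI (fun u _ => intk m u)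
  (fun u x _ _ => @ex_derive _ _ _ _ _ _ _ (dk m u x))
  (fun x => C * m.+1`!%:R / 1 ^+ m.+1 * wt x) cC
  (integrable_wt n _) _.
move=> H.
have {}H : h^-1 *: (F m (h + s) - F m s) @[h --> 0^'] --> F m.+1 s.
  rewrite /F (_ : \int[_]_x k m.+1 s x = \int[lebesgue_cV R n]_x (partial1of2 (k m) s x)).
    by apply: H => u x uI _; rewrite d1; apply: hC; exact: Ib.
  by apply: eq_Rintegral => x _; rewrite d1.
have E : (fun h : R => h^-1 *: (F m (h *: 1 + s) - F m s)) =
   (fun h : R => h^-1 *: (F m (h + s) - F m s)).
  by apply/funext => h; rewrite [h *: 1]mulr1.
split; first by rewrite /derivable E; apply/cvg_ex; exists (F m.+1 s).
by rewrite /derive E; exact: cvg_lim H.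
Qed.

End AnalyticZeros.

(** * Null sets and integration by parts *)

Section NullSets.
Context {R : realType}.
Local Notation leb := (@lebesgue_measure R).

(** Induction on the dimension. By induction [Z] is null in the slice through the given
    point outside [Z]; a line that crosses the slice outside [Z] meets [Z] in a null set, and
    Fubini's theorem concludes. *)
Lemma null_of_lines n (Z : set 'cV[R]_n) : measurable Z -> (exists x, ~ Z x) ->
  (forall x i, (forall s : R, Z (x + s *: delta_mx i 0)) \/
     leb.-negligible [set s : R | Z (x + s *: delta_mx i 0)]) ->
  lebesgue_cV R n Z = 0%E.
Proof.
elim: n Z => [|n IH] Z mZ [x0 Zx0] ZL.
  suff -> : Z = set0 by rewrite measure0.
  apply/seteqP; split => x //= Zx; apply: Zx0.
  by rewrite (_ : x0 = x)//; apply/matrixP => -[].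
pose a := x0 ord0 0; pose Za : set 'cV[R]_n := [set x | Z (cons_cV (a, x))].
have mZa : measurable Za.
  by rewrite -[X in measurable X]setTI; exact: measurable_cons_cVr.
have Za0 : lebesgue_cV R n Za = 0%E.
  apply: IH => //; first by exists (\col_i x0 (lift ord0 i) 0); rewrite /Za /= -cons_cV_eta.
  move=> x i; case: (ZL (cons_cV (a, x)) (lift ord0 i)) => h.
    by left => s; rewrite /Za /= -cons_cV_shiftS; exact: h.
  right; apply: negligibleS h => s; rewrite /Za /=.
  by rewrite -[in X in X -> _]cons_cV_shiftS.
have mI : measurable_fun setT (fun x : 'cV[R]_n.+1 => (\1_Z x : R)%:E).
  by apply/measurable_EFinP; exact: measurable_indic.
have mIc : measurable_fun setT (fun w => (\1_Z (@cons_cV R n w) : R)%:E).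
  exact: (measurableT_comp mI (@measurable_cons_cV R n)).
rewrite -[Z]setIT -integral_indic// ge0_integral_cons_swap//.
rewrite (ge0_negligible_integral mZa)//; first last.
- by move=> x _; apply: integral_ge0 => s _; rewrite lee_fin.
- exact: (measurable_fun_fubini_tonelli_G (m1 := leb)
    (fun w => (\1_Z (@cons_cV R n w) : R)%:E) mIc (fun w => _)).
apply: integral0_eq => x [_ Zax].
rewrite integral_indic//; last first.
  by rewrite -[X in measurable X]setTI; exact: measurable_cons_cVl.
rewrite setIT; apply: measure_negligible.
  by rewrite -[X in measurable X]setTI; exact: measurable_cons_cVl.
case: (ZL (cons_cV (0, x)) ord0) => h.
  by exfalso; apply: Zax; have := h a; rewrite cons_cV_shift0 add0r.
apply: negligibleS h => s /=.
by rewrite cons_cV_shift0 add0r.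
Qed.

End NullSets.

Section IntegrationByParts.
Context {R : realType}.
Local Notation leb := (@lebesgue_measure R).

Lemma cvg_wt1_infty (C : R) : (C * wt1 (k%:R : R)) @[k --> \oo] --> (0 : R).
Proof.
apply/cvgr0Pnorm_le => e e0.
near=> k; rewrite normrM (ger0_norm (ltW (wt1_gt0 _))).
rewrite /wt1 ler_pdivrMr ?ltr_pwDl ?sqr_ge0//.
have k1 : `|C| / e + 1 <= k%:R.
  by near: k; exact: nbhs_infty_ger.
have k0 : `|C| <= e * k%:R.
  rewrite mulrC -ler_pdivrMr//; lra.
have kk : (k%:R : R) <= k%:R ^+ 2.
  rewrite expr2 -{1}[k%:R]mul1r ler_wpM2r//.
  by apply: le_trans k1; rewrite lerDr divr_ge0// ltW.
apply: (le_trans k0); rewrite ler_wpM2l ?(ltW e0)//.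
by rewrite (le_trans kk)// lerDr.
Unshelve. all: by end_near. Qed.

(** The fundamental theorem of calculus between -k and k: the boundary terms tend to 0, and the
    integrals converge by domination. *)
Lemma integral_derivative (f g : R -> R) (C : R) :
  (forall s : R, is_derive s 1 f (g s)) -> continuous g ->
  (forall s, `|f s| <= C * wt1 s) -> (forall s, `|g s| <= C * wt1 s) ->
  \int[leb]_s g s = 0.
Proof.
move=> df cg fC gC.
have mg : measurable_fun setT g by exact: continuous_measurable_fun.
have ig := integrable_le_wt1 mg gC.
pose I k : set R := `[- (k%:R), k%:R]%classic.
pose gk (k : nat) (s : R) : \bar R := (g s * \1_(I k) s)%:E.
have cf : continuous f by exact: is_derive_continuous df.
have C0 : 0 <= C.
  by have := le_trans (normr_ge0 _) (fC 0); rewrite pmulr_lge0// wt1_gt0.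
have mI k : measurable (I k) by exact: measurable_itv.
have mgk k : measurable_fun setT (gk k).
  by apply/measurable_EFinP; apply: measurable_funM => //; exact: measurable_indic.
have ftc k : (\int[leb]_s gk k.+1 s)%E = (f k.+1%:R - f (- k.+1%:R))%:E.
  rewrite EFinB -(@continuous_FTC2 R g f (- k.+1%:R) k.+1%:R).
  - rewrite [RHS]integral_mkcond; apply: eq_integral => s _.
    by rewrite /gk patchE indicE; case: ifPn; rewrite ?mulr1 ?mulr0.
  - by rewrite (@lt_trans _ _ 0)// oppr_lt0.
  - exact: continuous_subspaceT.
  - split; [by move=> s _; have [] := df s| |].
    + by apply: cvg_at_right_filter; exact: cf.
    + by apply: cvg_at_left_filter; exact: cf.
  - by move=> s _; rewrite derive1E; have [_ ->] := df s.
have iC : leb.-integrable setT (fun s => (C * wt1 s)%:E).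
  apply: (@integrable_le_wt1 R C (fun s => C * wt1 s)).
    by apply: measurable_funM => //; exact: measurable_wt1.
  by move=> s; rewrite ger0_norm// mulr_ge0// ltW// wt1_gt0.
have lim1 : (\int[leb]_s gk k.+1 s)%E @[k --> \oo] --> (\int[leb]_s (g s)%:E)%E.
  apply: (@dominated_cvg _ _ _ leb setT measurableT (fun k => gk k.+1)
      (EFin \o g) (fun s => (C * wt1 s)%:E)) => //.
  - by move=> k; exact: mgk.
  - move=> s _; suff H : \forall k \near \oo, gk k.+1 s = (g s)%:E.
      by have H2 := @cvg_near_cst _ _ _ _ _ _ H; exact: (H2 _).
    near=> k.
    rewrite /gk indicE mem_set ?mulr1// /I /= in_itv /=.
    have sk : `|s| <= k.+1%:R.
      by rewrite -natr1 (@le_trans _ _ k%:R) ?lerDl//; near: k; exact: nbhs_infty_ger.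
    by move: sk; rewrite ler_norml.
  - move=> k s _; rewrite /gk lee_fin normrM.
    apply: le_trans (gC s); rewrite ler_piMr// indicE.
    by case: (_ \in _); rewrite ?normr1 ?normr0.
have lim2 : (\int[leb]_s gk k.+1 s)%E @[k --> \oo] --> (0 : R)%:E.
  under eq_fun do rewrite ftc.
  apply/fine_cvgP; split; first exact: nearW.
  rewrite /comp /=.
  apply/cvgr0Pnorm_le => e e0.
  have e2 : 0 < e / 2 by rewrite divr_gt0.
  have /cvgr0Pnorm_le/(_ _ e2)[N _ hN] := cvg_wt1_infty C.
  exists N => // k /= Nk; have := hN k.+1 (leqW Nk).
  rewrite ger0_norm ?mulr_ge0 ?(ltW (wt1_gt0 _))// => h.
  rewrite (splitr e) (le_trans (ler_normB _ _))// lerD//.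
    exact: le_trans (fC _) h.
  by apply: le_trans (fC _) _; rewrite /wt1 sqrrN.
by rewrite /Rintegral (cvg_unique _ lim1 lim2).
Unshelve. all: by end_near. Qed.

(** Fubini's theorem reduces the claim to one variable: directly for the first coordinate,
    by induction for the others. *)
Lemma integral_partial_derivative n (i : 'I_n) (f g : 'cV[R]_n -> R) (C : R) :
  (forall x, is_derive x (delta_mx i 0) f (g x)) ->
  measurable_fun setT g ->
  (forall x, continuous (fun s : R => g (x + s *: delta_mx i 0))) ->
  (forall x, `|f x| <= C * wt x) -> (forall x, `|g x| <= C * wt x) ->
  \int[lebesgue_cV R n]_x g x = 0.
Proof.
elim: n i f g C => [[]//|n IH] i f g C df mg cg fC gC.
have ig := integrable_le_wt mg gC.
rewrite /Rintegral; case: (unliftP ord0 i) => [j|] iE; rewrite {i}iE in df cg.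
  rewrite integral_cons//; rewrite (eq_integral (cst 0%E)) ?integral0// => s _.
  have is_ : (lebesgue_cV R n).-integrable setT (EFin \o (fun x => g (cons_cV (s, x)))).
    apply: (@integrable_le_wt R n (C * wt1 s)).
      exact: (measurableT_comp mg (measurable_cons_cVr s)).
    by move=> x; rewrite (le_trans (gC _))// wt_cons mulrA.
  have := IH j (fun x => f (cons_cV (s, x))) (fun x => g (cons_cV (s, x))) (C * wt1 s).
  move=> H; rewrite -[LHS]fineK ?integrable_fin_num//; congr (_%:E).
  apply: H => [x||x|x|x].
  - apply/is_derive_at0; have /is_derive_at0 := df (cons_cV (s, x)).
    by under eq_fun do rewrite cons_cV_shiftS.
  - exact: (measurableT_comp mg (measurable_cons_cVr s)).
  - by have := cg (cons_cV (s, x)); under eq_fun do rewrite cons_cV_shiftS.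
  - by rewrite (le_trans (fC _))// wt_cons mulrA.
  - by rewrite (le_trans (gC _))// wt_cons mulrA.
rewrite integral_cons_swap//; rewrite (eq_integral (cst 0%E)) ?integral0// => x _.
have is_ : leb.-integrable setT (EFin \o (fun s => g (cons_cV (s, x)))).
  apply: (@integrable_le_wt1 R (C * wt x)).
    exact: (measurableT_comp mg (measurable_cons_cVl x)).
  by move=> s; rewrite (le_trans (gC _))// wt_cons mulrA mulrAC.
rewrite -[LHS]fineK ?integrable_fin_num//; congr (_%:E).
apply: (@integral_derivative (fun s => f (cons_cV (s, x))) _ (C * wt x)) => [s||s|s].
- apply/is_derive_at0; have /is_derive_at0 := df (cons_cV (s, x)).
  under eq_fun do rewrite cons_cV_shift0.
  by under [X in _ -> is_derive _ _ X _]eq_fun do rewrite [_ *: 1]mulr1.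
- have := cg (cons_cV (0, x)); under eq_fun do rewrite cons_cV_shift0 add0r.
  exact.
- by rewrite (le_trans (fC _))// wt_cons mulrA mulrAC.
- by rewrite (le_trans (gC _))// wt_cons mulrA mulrAC.
Qed.

End IntegrationByParts.

(** * Positive definite quadratic forms *)

Section DotProduct.
Context {R : realType} {n : nat}.
Implicit Types x y z : 'cV[R]_n.

Lemma dotE (x y : 'cV[R]_n) : dot x y = \sum_(i < n) x i 0 * y i 0.
Proof. by rewrite /dot mxE; apply: eq_bigr => i _; rewrite !mxE. Qed.

Lemma dotDl (x y z : 'cV[R]_n) : dot (x + y) z = dot x z + dot y z.
Proof. by rewrite /dot linearD mulmxDl mxE. Qed.

Lemma dotZl (c : R) (x z : 'cV[R]_n) : dot (c *: x) z = c * dot x z.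
Proof. by rewrite /dot linearZ -scalemxAl mxE. Qed.

Lemma dot_delta (i : 'I_n) (z : 'cV[R]_n) : dot (delta_mx i 0) z = z i 0.
Proof.
rewrite dotE (bigD1 i)//= big1 ?addr0 => [|j ji]; rewrite mxE.
  by rewrite !eqxx mul1r.
by rewrite (negbTE ji) mul0r.
Qed.

Lemma dotC x y : dot x y = dot y x.
Proof. by rewrite !dotE; apply: eq_bigr => i _; rewrite mulrC. Qed.

Lemma dotDr x y z : dot x (y + z) = dot x y + dot x z.
Proof. by rewrite dotC dotDl dotC (dotC z). Qed.

Lemma dotZr (c : R) x y : dot x (c *: y) = c * dot x y.
Proof. by rewrite dotC dotZl dotC. Qed.

Lemma dotNl x y : dot (- x) y = - dot x y.
Proof. by rewrite -scaleN1r dotZl mulN1r. Qed.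

Lemma dotNr x y : dot x (- y) = - dot x y.
Proof. by rewrite dotC dotNl dotC. Qed.

Lemma dot0l x : dot 0 x = 0.
Proof. by rewrite -(scale0r x) dotZl mul0r. Qed.

Lemma dot0r x : dot x 0 = 0.
Proof. by rewrite dotC dot0l. Qed.

Lemma dot_mulmx x y (A : 'M[R]_n) : dot x (A *m y) = dot (A^T *m x) y.
Proof. by rewrite /dot trmx_mul trmxK mulmxA. Qed.

Lemma dot_ge0 x : 0 <= dot x x.
Proof. by rewrite dotE; apply: sumr_ge0 => i _; rewrite -expr2 sqr_ge0. Qed.

End DotProduct.

Section PositiveDefinite.
Context {R : realType} {n : nat}.
Variable G : 'M[R]_n.
Hypothesis G_sym : G^T = G.
Hypothesis G_pos : forall x : 'cV[R]_n, x != 0 -> 0 < dot x (G *m x).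
Implicit Types u v : 'cV[R]_n.

Lemma quad_ge0 v : 0 <= dot v (G *m v).
Proof. by have [->|/G_pos/ltW//] := eqVneq v 0; rewrite mulmx0 dot0r. Qed.

Lemma quad_sym u v : dot u (G *m v) = dot v (G *m u).
Proof. by rewrite dot_mulmx G_sym dotC. Qed.

Lemma posdef_unitmx : G \in unitmx.
Proof.
rewrite -row_free_unit -kermx_eq0; apply/eqP/matrixP => i k; rewrite [RHS]mxE.
apply/eqP/negPn/negP => nz.
have r0 : row i (kermx G) *m G = 0 by rewrite -row_mul mulmx_ker row0.
have : (row i (kermx G))^T != 0.
  by apply/eqP => /matrixP/(_ k 0); rewrite [LHS]mxE [LHS]mxE [RHS]mxE; apply/eqP.
move=> /G_pos; have -> : G *m (row i (kermx G))^T = 0.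
  by apply: trmx_inj; rewrite trmx_mul trmxK G_sym r0 trmx0.
by rewrite dot0r ltxx.
Qed.

(** The form is non-negative at c u - b v, where b and c are the pairings of v with u and v. *)
Lemma quad_cauchy_schwarz u v :
  dot u (G *m v) ^+ 2 <= dot u (G *m u) * dot v (G *m v).
Proof.
have [->|v0] := eqVneq v 0; first by rewrite mulmx0 !dot0r mulr0 expr0n.
have vv := G_pos v0; set b := dot u (G *m v); set c := dot v (G *m v).
have := quad_ge0 (c *: u - b *: v).
rewrite mulmxBr -!scalemxAr !(dotDl, dotDr, dotNl, dotNr, dotZl, dotZr).
rewrite -/b (quad_sym v u) -/b -/c.
rewrite (_ : _ + _ = c * (dot u (G *m u) * c - b ^+ 2)); last by ring.
by rewrite pmulr_rge0// subr_ge0.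
Qed.

(** Cauchy-Schwarz against the vector [invmx G *m e_i], whose pairing with v is v_i. *)
Lemma quad_lower_bound : exists2 c, 0 < c & forall v, c * `|v| ^+ 2 <= dot v (G *m v).
Proof.
pose K : R := 1 + \sum_i `|invmx G i i|.
have K0 : 0 < K by rewrite ltr_pwDl// sumr_ge0.
exists K^-1; first by rewrite invr_gt0.
move=> v; rewrite ler_pdivrMl//.
have entry i : v i 0 ^+ 2 <= K * dot v (G *m v).
  pose u := col i (invmx G).
  have Gu : G *m u = delta_mx i 0.
    by rewrite /u colE mulmxA mulmxV ?posdef_unitmx// mul1mx.
  have := quad_cauchy_schwarz u v.
  rewrite Gu [in X in X <= _]dot_mulmx G_sym Gu dot_delta dotC dot_delta => /le_trans; apply.
  rewrite ler_wpM2r ?quad_ge0// /u mxE (le_trans (ler_norm _))// /K.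
  by rewrite (bigD1 i)//= addrCA lerDl addr_ge0// sumr_ge0.
have qv := quad_ge0 v.
have : `|v| <= Num.sqrt (K * dot v (G *m v)).
  by apply: cV_norm_le => [|i]; rewrite ?sqrtr_ge0// -sqrtr_sqr ler_wsqrtr.
rewrite -(@ler_pXn2r _ 2)// ?nnegrE ?sqrtr_ge0// sqr_sqrtr// mulr_ge0//.
exact: ltW.
Qed.

End PositiveDefinite.

(** * Uniqueness of Fourier transforms *)

Section FourierUniqueness.
Context {R : realType} {n : nat}.
Local Notation mu := (lebesgue_cV R n).
Variables (phi : 'cV[R]_n -> R) (C : R).
Hypotheses (cphi : continuous phi) (phiC : forall x, `|phi x| <= C * wt x).
Implicit Types (T : 'cV[R]_n -> R) (k : 'cV[R]_n).

Lemma measurable_dot k : measurable_fun setT (fun x => dot k x).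
Proof.
under eq_fun do rewrite dotE.
apply: measurable_sum => i; apply: measurable_funM => //.
exact: measurable_mx_entry.
Qed.

Let mphi : measurable_fun setT phi.
Proof. exact: continuous_measurable_cV. Qed.

(** The bounded functions whose trigonometric moments against [phi] all vanish. They are
    stable under linear combinations, bounded pointwise limits and multiplication by
    cosines, which leads from the constant 1 to Gaussians without inverting a Fourier
    transform. *)
Definition orth T := [/\ measurable_fun setT T, exists B, forall x, `|T x| <= B &
  forall k, \int[mu]_x (T x * cos (dot k x) * phi x) = 0 /\
            \int[mu]_x (T x * sin (dot k x) * phi x) = 0].

Let mcosk k : measurable_fun setT (fun x => cos (dot k x)).
Proof.
apply: (measurableT_comp _ (measurable_dot k)).
exact: (continuous_measurable_fun (@continuous_cos R)).
Qed.

Let msink k : measurable_fun setT (fun x => sin (dot k x)).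
Proof.
apply: (measurableT_comp _ (measurable_dot k)).
exact: (continuous_measurable_fun (@continuous_sin R)).
Qed.

Lemma orth_bound T (B : R) (c : 'cV[R]_n -> R) x : `|T x| <= B -> `|c x| <= 1 ->
  `|T x * c x * phi x| <= B * C * wt x.
Proof.
move=> TB c1; rewrite !normrM -mulrA -[leRHS]mulrA ler_pM//.
by rewrite -[leRHS]mul1r ler_pM.
Qed.

Lemma orth_integrable T (B : R) (c : 'cV[R]_n -> R) :
  measurable_fun setT T -> (forall x, `|T x| <= B) ->
  measurable_fun setT c -> (forall x, `|c x| <= 1) ->
  mu.-integrable setT (EFin \o (fun x => T x * c x * phi x)).
Proof.
move=> mT TB mc c1; apply: (@integrable_le_wt R n (B * C)).
  by apply: measurable_funM => //; exact: measurable_funM.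
by move=> x; exact: orth_bound.
Qed.

Lemma orth_lin (a b : R) T T' : orth T -> orth T' ->
  orth (fun x => a * T x + b * T' x).
Proof.
move=> [mT [B TB] TI] [mT' [B' TB'] TI']; split.
- by apply: measurable_funD; apply: measurable_funM.
- exists (`|a| * B + `|b| * B') => x; rewrite (le_trans (ler_normD _ _))// !normrM.
  by rewrite lerD// ler_wpM2l.
have lin (c : 'cV[R]_n -> R) : measurable_fun setT c -> (forall x, `|c x| <= 1) ->
    \int[mu]_x (T x * c x * phi x) = 0 -> \int[mu]_x (T' x * c x * phi x) = 0 ->
    \int[mu]_x ((a * T x + b * T' x) * c x * phi x) = 0.
  move=> mc c1 h h'.
  have i1 := orth_integrable mT TB mc c1; have i2 := orth_integrable mT' TB' mc c1.
  rewrite (@eq_Rintegral _ _ _ _ _ (fun x => a * (T x * c x * phi x) + b * (T' x * c x * phi x))).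
    rewrite RintegralD//; first by rewrite !RintegralZl// h h' !mulr0 addr0.
    - exact: (integrableZl measurableT a i1).
    - exact: (integrableZl measurableT b i2).
  by move=> x _; ring.
move=> k; split.
- exact: (lin _ (mcosk k) (fun x => cos_max _) (TI k).1 (TI' k).1).
- exact: (lin _ (msink k) (fun x => sin_max _) (TI k).2 (TI' k).2).
Qed.

Lemma orth_cvg (T_ : nat -> 'cV[R]_n -> R) T (B : R) : (forall m, orth (T_ m)) ->
  (forall m x, `|T_ m x| <= B) -> (forall x, T_ m x @[m --> \oo] --> T x) -> orth T.
Proof.
move=> oT TB Tcvg.
have mT : measurable_fun setT T.
  apply: (@measurable_fun_cvg _ _ _ _ T_) => //.
  by move=> m; have [] := oT m.
have TBx x : `|T x| <= B.
  have h : `|T_ m x| @[m --> \oo] --> `|T x| by apply: cvg_norm; exact: Tcvg.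
  apply: (cvgr_to_le h); exact: nearW.
split => //; first by exists B.
have lim (c : 'cV[R]_n -> R) : measurable_fun setT c -> (forall x, `|c x| <= 1) ->
    (forall m, \int[mu]_x (T_ m x * c x * phi x) = 0) ->
    \int[mu]_x (T x * c x * phi x) = 0.
  move=> mc c1 h.
  have im m : mu.-integrable setT (EFin \o (fun x => T_ m x * c x * phi x)).
    by apply: (orth_integrable _ (TB m)) => //; have [] := oT m.
  have := @dominated_cvg _ _ _ mu setT measurableT
    (fun m x => (T_ m x * c x * phi x)%:E) (EFin \o (fun x => T x * c x * phi x))
    (fun x => (B * C * wt x)%:E).
  move=> H; have {}H : (\int[mu]_x (T_ m x * c x * phi x)%:E)%E @[m --> \oo] -->
      (\int[mu]_x (T x * c x * phi x)%:E)%E.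
    apply: H => //.
    - by move=> m; have /integrableP[] := im m.
    - move=> x _; apply/fine_cvgP; split; first exact: nearW.
      rewrite /comp /=; apply: cvgM; last exact: cvg_cst.
      by apply: cvgM; [exact: Tcvg|exact: cvg_cst].
    - exact: integrable_wt.
    - by move=> m x _; rewrite lee_fin; exact: orth_bound.
  move: H; rewrite (_ : (fun m => _) = fun=> 0%E); last first.
    apply/funext => m; rewrite -[LHS]fineK; last by apply: integrable_fin_num => //; exact: im.
    by congr (_%:E); exact: h.
  by move=> H; rewrite /Rintegral -(cvg_unique _ (cvg_cst _) H).
move=> k; split.
- by apply: (lim _ (mcosk k) (fun x => cos_max _)) => m; have [_ _ /(_ k)[]] := oT m.
- by apply: (lim _ (msink k) (fun x => sin_max _)) => m; have [_ _ /(_ k)[]] := oT m.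
Qed.

(** The product-to-sum formulas turn the new cosine into a shift of the frequency. *)
Lemma orth_cosM (d a : R) (i : 'I_n) T : orth T ->
  orth (fun x => cos (d * (x i 0 - a)) * T x).
Proof.
move=> [mT [B TB] TI].
have mc : measurable_fun setT (fun x : 'cV[R]_n => cos (d * (x i 0 - a))).
  apply: (@measurableT_comp _ _ _ _ _ _ cos).
    exact: (continuous_measurable_fun (@continuous_cos R)).
  apply: measurable_funM => //; apply: measurable_funB => //.
  exact: measurable_mx_entry.
have kd k (e : R) x : dot (k + e *: delta_mx i 0) x = dot k x + e * x i 0.
  by rewrite dotDl dotZl dot_delta.
split; first exact: measurable_funM.
  exists B => x; rewrite normrM -[B]mul1r ler_pM//; exact: cos_max.
move=> k.
have ip := orth_integrable mT TB (mcosk (k + d *: delta_mx i 0)) (fun x => cos_max _).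
have iq := orth_integrable mT TB (mcosk (k + - d *: delta_mx i 0)) (fun x => cos_max _).
have jp := orth_integrable mT TB (msink (k + d *: delta_mx i 0)) (fun x => sin_max _).
have jq := orth_integrable mT TB (msink (k + - d *: delta_mx i 0)) (fun x => sin_max _).
have [ep fp] := TI (k + d *: delta_mx i 0).
have [eq fq] := TI (k + - d *: delta_mx i 0).
have lin4 (c1 c2 c3 c4 : R) (F : 'cV[R]_n -> R) :
  (forall x, F x = c1 * (T x * cos (dot (k + d *: delta_mx i 0) x) * phi x) +
     c2 * (T x * cos (dot (k + - d *: delta_mx i 0) x) * phi x) +
     (c3 * (T x * sin (dot (k + d *: delta_mx i 0) x) * phi x) +
     c4 * (T x * sin (dot (k + - d *: delta_mx i 0) x) * phi x))) ->
  \int[mu]_x F x = 0.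
  move=> FE; rewrite (@eq_Rintegral _ _ _ _ _ _ _ (fun x _ => FE x)).
  have Ip := integrableZl measurableT c1 ip; have Iq := integrableZl measurableT c2 iq.
  have Jp := integrableZl measurableT c3 jp; have Jq := integrableZl measurableT c4 jq.
  rewrite !RintegralD//.
  - by rewrite !RintegralZl// ep fp eq fq !mulr0 !addr0.
  - exact: (integrableD measurableT Ip Iq).
  - exact: (integrableD measurableT Jp Jq).
split.
- apply: (lin4 (cos (d * a) / 2) (cos (d * a) / 2) (sin (d * a) / 2) (- sin (d * a) / 2)).
  move=> x; rewrite !kd mulrBr !mulNr !(cosB, sinB, cosD, sinD, cosN, sinN).
  by field.
- apply: (lin4 (- sin (d * a) / 2) (sin (d * a) / 2) (cos (d * a) / 2) (cos (d * a) / 2)).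
  move=> x; rewrite !kd mulrBr !mulNr !(cosB, sinB, cosD, sinD, cosN, sinN).
  by field.
Qed.

Lemma orth_ext T T' : T =1 T' -> orth T -> orth T'.
Proof. by move=> /funext ->. Qed.

Lemma orth0 : orth (fun=> 0).
Proof.
split; [exact: measurable_cst|by exists 0 => x; rewrite normr0|move=> k; split].
- by under eq_Rintegral do rewrite !mul0r; rewrite Rintegral_cst// mul0r.
- by under eq_Rintegral do rewrite !mul0r; rewrite Rintegral_cst// mul0r.
Qed.

Lemma orth_scale (c : R) T : orth T -> orth (fun x => c * T x).
Proof.
move=> oT; apply: orth_ext (orth_lin c 0 oT oT) => x.
by rewrite mul0r addr0.
Qed.

(** The partial sums of the exponential series are polynomials in the cosine and converge
    boundedly. *)
Lemma orth_exp_cosM (m d a : R) (i : 'I_n) T : orth T ->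
  orth (fun x => expR (m * cos (d * (x i 0 - a))) * T x).
Proof.
move=> oT; have [mT [B TB] _] := oT.
pose u (x : 'cV[R]_n) : R := m * cos (d * (x i 0 - a)).
have pow (k : nat) : orth (fun x => cos (d * (x i 0 - a)) ^+ k * T x).
  elim: k => [|k IH]; first by apply: orth_ext oT => x; rewrite expr0 mul1r.
  by apply: orth_ext (orth_cosM d a i IH) => x; rewrite exprS mulrA.
have part N : orth (fun x => series (exp_coeff (u x)) N * T x).
  elim: N => [|N IH].
    by apply: orth_ext orth0 => x; rewrite /series /= big_geq// mul0r.
  apply: orth_ext (orth_lin 1 (m ^+ N / N`!%:R) IH (pow N)) => x.
  rewrite mul1r /series /= [in RHS]big_nat_recr//= mulrDl; congr (_ + _).
  by rewrite /exp_coeff /u /= exprMn; ring.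
(* The partial sums are bounded by exp|m|, since |u| <= |m|. *)
apply: (@orth_cvg (fun N x => series (exp_coeff (u x)) N * T x) _ (expR `|m| * B)) => //.
- move=> N x; rewrite normrM ler_pM//.
  have ux : `|u x| <= `|m| by rewrite normrM -[leRHS]mulr1 ler_wpM2l// cos_max.
  apply: le_trans (_ : series (exp_coeff `|u x|) N <= _).
    rewrite /series /=; apply: le_trans (ler_norm_sum _ _ _) _.
    by apply: ler_sum => k _; rewrite /exp_coeff normrM normrX normfV normr_nat.
  apply: le_trans (_ : expR `|u x| <= _); last by rewrite ler_expR.
  apply: nondecreasing_cvgn_le; last exact: is_cvg_series_exp_coeff.
  apply: nondecreasing_series => k _ _; exact: exp_coeff_ge0.
- by move=> x; apply: cvgM; [exact: is_cvg_series_exp_coeff|exact: cvg_cst].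
Qed.

Lemma cvg_one_sub_cos (s : R) :
  N.+1%:R ^+ 2 * (1 - cos (N.+1%:R^-1 * s)) @[N --> \oo] --> s ^+ 2 / 2.
Proof.
have [->|s0] := eqVneq s 0.
  under eq_fun do rewrite mulr0 cos0 subrr mulr0.
  by rewrite expr0n /= mul0r; exact: cvg_cst.
have Hs : h^-1 * sin h @[h --> (0 : R)^'] --> (1 : R).
  have [d1 d2] := @is_derive_sin R 0.
  have : h^-1 *: (sin (h *: 1 + 0) - sin 0) @[h --> (0 : R)^'] --> 'D_1 (@sin R) 0 by exact: d1.
  rewrite d2 cos0 sin0.
  by under eq_fun do rewrite [_ *: 1]mulr1 addr0 subr0.
pose h (k : nat) : R := k.+1%:R^-1 * (s / 2).
have /cvgr_dnbhsP/(_ h) := Hs.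
have h0 (k : nat) : h k != 0 by rewrite !mulf_neq0 ?invr_eq0 ?pnatr_eq0.
have hc : h N @[N --> \oo] --> (0 : R).
  rewrite -[0](mul0r (s / 2)); apply: cvgM; last exact: cvg_cst.
  exact: cvg_harmonic.
move=> /(_ (conj h0 hc)) H.
have -> : s ^+ 2 / 2 = (s ^+ 2 / 2) * (1 * 1) by rewrite !mulr1.
rewrite (_ : (fun N => _) = (fun k : nat => (s ^+ 2 / 2) *
   (((h k)^-1 * sin (h k)) * ((h k)^-1 * sin (h k))))); last first.
  apply/funext => k.
  have -> : k.+1%:R^-1 * s = h k *+ 2 by rewrite /h mulr2n -mulrDr -splitr.
  rewrite cos_mulr2n cos2sin2.
  rewrite (_ : 1 - _ = 2 * sin (h k) ^+ 2); last ring.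
  rewrite /h; move: (sin _) => w; field.
  by rewrite s0 /= nat1r pnatr_eq0.
by apply: cvgM; [exact: cvg_cst|exact: cvgM].
Qed.

(** The Gaussian is the bounded limit of exp(- l k^2 (1 - cos((x_i - a) / k))). *)
Lemma orth_gaussM (l a : R) (i : 'I_n) T : 0 <= l -> orth T ->
  orth (fun x => expR (- (l * (x i 0 - a) ^+ 2 / 2)) * T x).
Proof.
move=> l0 oT; have [mT [B TB] _] := oT.
pose E (k : nat) (x : 'cV[R]_n) : R :=
  - (l * (k.+1%:R ^+ 2 * (1 - cos (k.+1%:R^-1 * (x i 0 - a))))).
apply: (@orth_cvg (fun N x => expR (E N x) * T x) _ B) => //.
- move=> k.
  have := orth_exp_cosM (l * k.+1%:R ^+ 2) (k.+1%:R^-1) a i oT.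
  move=> /(orth_scale (expR (- (l * k.+1%:R ^+ 2)))); apply: orth_ext => x.
  by rewrite mulrA -expRD; congr (expR _ * _); rewrite /E; ring.
- move=> k x; rewrite normrM -[B]mul1r ler_pM// ger0_norm ?expR_ge0// expR_le1.
  by rewrite oppr_le0 !mulr_ge0// ?exprn_ge0// subr_ge0 cos_le1.
- move=> x; rewrite -mulrA; apply: cvgM; last exact: cvg_cst.
  apply: (cvg_comp _ expR); last exact: continuous_expR.
  by apply: cvgN; apply: cvgM; [exact: cvg_cst|exact: cvg_one_sub_cos].
Qed.

Lemma orth_gauss (l : R) (a : 'cV[R]_n) (r : seq 'I_n) : 0 <= l -> orth (fun=> 1) ->
  orth (fun x => expR (- (l * (\sum_(i <- r) (x i 0 - a i 0) ^+ 2) / 2))).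
Proof.
move=> l0 o1; elim: r => [|i r IH].
  by apply: orth_ext o1 => x; rewrite big_nil mulr0 mul0r oppr0 expR0.
apply: orth_ext (orth_gaussM (a i 0) i l0 IH) => x.
by rewrite -expRD big_cons; congr expR; ring.
Qed.

End FourierUniqueness.

(** If phi(a) were not zero, a Gaussian concentrated at [a] would detect it: close to [a] the
    integrand has a sign, and the contribution of the points outside the box of radius r is
    exponentially smaller than that of the box of radius rho = r / (n + 1), because
    n rho^2 < r^2. *)
Lemma fourier_uniqueness (R : realType) n (phi : 'cV[R]_n -> R) (C : R) :
  continuous phi -> (forall x, `|phi x| <= C * wt x) ->
  (forall k, \int[lebesgue_cV R n]_x (cos (dot k x) * phi x) = 0 /\
             \int[lebesgue_cV R n]_x (sin (dot k x) * phi x) = 0) ->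
  forall a, phi a = 0.
Proof.
move=> cphi phiC h a; set mu := lebesgue_cV R n.
have o1 : orth phi (fun=> 1).
  split; [exact: measurable_cst|by exists 1 => x; rewrite normr1|move=> k].
  by have [h1 h2] := h k; split; [rewrite -[RHS]h1|rewrite -[RHS]h2];
    apply: eq_Rintegral => x _; rewrite mul1r.
apply/eqP/negPn/negP => pa0.
pose e := Num.sg (phi a).
have epa : e * phi a = `|phi a| by rewrite normrEsg.
pose c := `|phi a| / 2.
have c0 : 0 < c by rewrite divr_gt0// normr_gt0.
have [r r0 hr] : exists2 r, 0 < r & forall x, box a r x -> c <= e * phi x.
  have /cvgrPdist_le/(_ _ c0)/nbhs_ballP[r /= r0 H] := cphi a.
  exists r => // x xr; have := H x; rewrite mx_norm_ball /ball_ /= distrC.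
  rewrite boxE// in xr => /(_ xr).
  rewrite -[`|_ - _|]mul1r -[1](_ : `|e| = 1); last by rewrite normr_sg pa0.
  rewrite -normrM mulrBr epa ler_distl => /andP[_].
  by rewrite /c => ?; lra.
pose rho := r / n.+1%:R.
have rho0 : 0 < rho by rewrite divr_gt0.
pose I := \int[mu]_x `|phi x|.
have mphi : measurable_fun setT phi by exact: continuous_measurable_cV.
have iphi := integrable_le_wt mphi phiC.
have inphi : mu.-integrable setT (EFin \o (fun x => `|phi x|)).
  by have := integrable_norm iphi.
pose K (l : R) (x : 'cV[R]_n) := expR (- (l * (\sum_i (x i 0 - a i 0) ^+ 2) / 2)).
have K1 (l : R) x : 0 <= l -> K l x <= 1.
  move=> l0; rewrite expR_le1 oppr_le0 divr_ge0// mulr_ge0// sumr_ge0// => i _.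
  exact: sqr_ge0.
have iK (l : R) : 0 <= l -> mu.-integrable setT (EFin \o (fun x => e * (K l x * phi x))).
  move=> l0; have [mK _ _] := orth_gauss cphi phiC a (index_enum _) l0 o1.
  apply: (@integrable_le_wt R n C).
    by apply: measurable_funM => //; exact: measurable_funM.
  move=> x; rewrite normrM normr_sg pa0 mul1r normrM ger0_norm ?expR_ge0//.
  by apply: le_trans (phiC x); rewrite ler_piMl// K1.
have KI (l : R) : 0 <= l -> \int[mu]_x (e * (K l x * phi x)) = 0.
  move=> l0; have [_ _ /(_ (0 *: a))[E _]] := orth_gauss cphi phiC a (index_enum _) l0 o1.
  have iK' : mu.-integrable setT (EFin \o (fun x => K l x * phi x)).
    have := integrableZl measurableT e (iK l l0); congr (_.-integrable _ _).
    apply/funext => x /=; rewrite -EFinM; congr (_%:E).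
    by rewrite mulrA -expr2 sqr_sg pa0 mul1r.
  rewrite RintegralZl// [X in _ * X](_ : _ = 0) ?mulr0// -[RHS]E.
  by apply: eq_Rintegral => x _; rewrite dotZl mul0r cos0 mulr1.
pose v : R := (rho *+ 2) ^+ n.
have v0 : 0 < v by rewrite exprn_gt0// pmulrn_lgt0.
have mB : measurable (box a rho) by exact: measurable_box.
have E1 : (\int[mu]_x (\1_(box a rho) x)%:E = v%:E)%E.
  by rewrite integral_indic// setIT; exact: lebesgue_box.
have i1 : mu.-integrable setT (EFin \o (\1_(box a rho) : 'cV[R]_n -> R)).
  apply/integrableP; split; first by apply/measurable_EFinP; exact: measurable_indic.
  under eq_integral do rewrite gee0_abs ?lee_fin//.
  by rewrite E1 ltry.
have v1 : \int[mu]_x (\1_(box a rho) x : R) = v.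
  by rewrite /Rintegral E1.
have key (l : R) : 0 <= l ->
  c * expR (- (l * (n%:R * rho ^+ 2) / 2)) * v <= expR (- (l * r ^+ 2 / 2)) * I.
  move=> l0; rewrite -subr_le0 -[leRHS](KI l l0).
  set c1 := c * _; set c2 := expR _.
  have j1 := integrableZl measurableT c1 i1; have j2 := integrableZl measurableT c2 inphi.
  rewrite -v1 /I -!RintegralZl// -RintegralB//.
  apply: le_Rintegral => //; [exact: (integrableB measurableT j1 j2)|exact: iK|].
  move=> x _; have c20 : 0 <= c2 * `|phi x| by rewrite mulr_ge0// expR_ge0.
  rewrite indicE.
  have [xr|nxr] := pselect (box a r x); last first.
    have nx : x \notin box a rho.
      apply/negP => /set_mem xb; apply: nxr => i; apply: lt_le_trans (xb i) _.
      by rewrite ler_pdivrMr// ler_peMr// ?(ltW r0)// ler1n.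
    rewrite (negbTE nx) mulr0 sub0r.
    have : `|e * (K l x * phi x)| <= c2 * `|phi x|.
      rewrite normrM normr_sg pa0 mul1r normrM ler_wpM2r// ger0_norm ?expR_ge0//.
      rewrite ler_expR lerN2 ler_pM2r// ler_wpM2l//.
      move/existsNP : nxr => [i /negP]; rewrite -leNgt => ri.
      rewrite (bigD1 i)//= -[leLHS]addr0 lerD//.
        rewrite -[leRHS]real_normK ?num_real//.
        by rewrite lerXn2r// nnegrE// ltW.
      by rewrite sumr_ge0// => j _; exact: sqr_ge0.
    by rewrite ler_norml => /andP[].
  have ec : c <= e * phi x by exact: hr.
  have K0 : 0 <= K l x by exact: expR_ge0.
  rewrite mulrCA; case: (boolP (x \in box a rho)) => xrho; last first.
    rewrite mulr0 sub0r (@le_trans _ _ 0) ?oppr_le0//.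
    by apply: mulr_ge0 => //; exact: le_trans (ltW c0) ec.
  rewrite mulr1 (@le_trans _ _ c1) ?gerBl// /c1 mulrC ler_pM ?expR_ge0 ?(ltW c0)//.
  rewrite ler_expR lerN2 ler_pM2r// ler_wpM2l//.
  rewrite (@le_trans _ _ (\sum_(i < n) rho ^+ 2))//; last first.
    by rewrite sumr_const card_ord mulr_natl.
  apply: ler_sum => i _; rewrite -[leLHS]real_normK ?num_real//.
  have xi := set_mem xrho i.
  by rewrite lerXn2r ?nnegrE// ltW.
have gap : n%:R * rho ^+ 2 < r ^+ 2.
  rewrite /rho expr_div_n mulrA ltr_pdivrMr ?exprn_gt0// mulrC ltr_pM2l ?exprn_gt0//.
  by rewrite -natrX ltr_nat expnS expn1 mulSn mulnS; lia.
pose g := (r ^+ 2 - n%:R * rho ^+ 2) / 2.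
have g0 : 0 < g by rewrite divr_gt0// subr_gt0.
have I0 : 0 <= I by apply: Rintegral_ge0 => x _.
(* This width turns [key] into exp(l g) <= l g, contrary to 1 + y <= exp y. *)
have l0 : 0 <= I / (c * v) / g by apply: divr_ge0; [apply: divr_ge0 => //; apply/ltW; exact: mulr_gt0|exact: ltW].
have := key _ l0; set l := I / (c * v) / g.
rewrite -(ler_pM2l (expR_gt0 (l * r ^+ 2 / 2))) [in leRHS]mulrA -expRD subrr expR0 mul1r.
apply/negP; rewrite -ltNge.
rewrite [ltRHS](_ : _ = c * v * expR (l * g)); last first.
  have -> : l * g = l * r ^+ 2 / 2 + - (l * (n%:R * rho ^+ 2) / 2) by rewrite /g; field.
  by rewrite expRD; ring.
rewrite mulrC -ltr_pdivrMr; last exact: mulr_gt0.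
have -> : I / (c * v) = l * g by rewrite /l divfK// gt_eqF.
by apply: lt_le_trans (expR_ge1Dx _); rewrite ltr_pwDl.
Qed.

(** * Complex-valued functions and rapid decay *)

Section ComplexNumbers.
Context {R : realType}.
Implicit Types z w : R[i].
Local Notation Re := (@complex.Re R).
Local Notation Im := (@complex.Im R).

Lemma cReD z w : Re (z + w) = Re z + Re w. Proof. by case: z w => [a b] [c d]. Qed.
Lemma cImD z w : Im (z + w) = Im z + Im w. Proof. by case: z w => [a b] [c d]. Qed.
Lemma cReM z w : Re (z * w) = Re z * Re w - Im z * Im w.
Proof. by case: z w => [a b] [c d]. Qed.
Lemma cImM z w : Im (z * w) = Re z * Im w + Im z * Re w.
Proof. by case: z w => [a b] [c d] /=; rewrite addrC. Qed.
Lemma complex_eq z w : Re z = Re w -> Im z = Im w -> z = w.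
Proof. by case: z w => [a b] [c d] /= -> ->. Qed.

Lemma normc_sqr z : normc z ^+ 2 = Re z ^+ 2 + Im z ^+ 2.
Proof. by case: z => a b; rewrite sqr_sqrtr// addr_ge0// sqr_ge0. Qed.

Lemma normc_ge0 z : 0 <= normc z.
Proof. by case: z => a b; exact: sqrtr_ge0. Qed.

Lemma norm_Re_le z : `|Re z| <= normc z.
Proof.
rewrite -(@ler_pXn2r _ 2)// ?nnegrE ?normc_ge0// normc_sqr real_normK ?num_real//.
by rewrite lerDl sqr_ge0.
Qed.

Lemma norm_Im_le z : `|Im z| <= normc z.
Proof.
rewrite -(@ler_pXn2r _ 2)// ?nnegrE ?normc_ge0// normc_sqr real_normK ?num_real//.
by rewrite lerDr sqr_ge0.
Qed.

Lemma normc_le_add z : normc z <= `|Re z| + `|Im z|.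
Proof.
rewrite -(@ler_pXn2r _ 2)// ?nnegrE ?normc_ge0 ?addr_ge0// normc_sqr.
rewrite sqrrD !real_normK ?num_real// -addrA lerD2l lerDr.
by rewrite mulrn_wge0// mulr_ge0.
Qed.

Lemma normcJ z : normc z^*%C = normc z.
Proof. by case: z => a b /=; rewrite sqrrN. Qed.

Lemma normc_real (a : R) : normc a%:C = `|a|.
Proof. by rewrite /= expr0n /= addr0 sqrtr_sqr. Qed.

Lemma normcD z w : normc (z + w) <= normc z + normc w.
Proof. exact: le_normcD. Qed.

Lemma normcX z k : normc (z ^+ k) = normc z ^+ k.
Proof. by elim: k => [|k IH]; rewrite ?expr0 ?normc1// !exprS normcM IH. Qed.

Lemma normc_gt0 z : (0 < normc z) = (z != 0).
Proof.
rewrite lt_neqAle normc_ge0 andbT eq_sym; congr (~~ _); apply/eqP/eqP => [|->].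
  exact: eq0_normc.
exact: normc0.
Qed.

Lemma normc_cexp z : normc (cexp z) = expR (Re z).
Proof.
rewrite /cexp /= !exprMn -mulrDr cos2Dsin2 mulr1 sqrtr_sqr.
by rewrite ger0_norm// expR_ge0.
Qed.

Lemma cexpD z w : cexp (z + w) = cexp z * cexp w.
Proof.
apply: complex_eq; rewrite ?cReM ?cImM /= cReD cImD ?cosD ?sinD expRD; ring.
Qed.

Lemma cexp_neq0 z : cexp z != 0.
Proof. by rewrite -normc_gt0 normc_cexp expR_gt0. Qed.

End ComplexNumbers.

Section ComplexDerivatives.
Context {R : realType} {n : nat}.
Local Notation V := 'cV[R]_n.
Local Notation Re := (@complex.Re R).
Local Notation Im := (@complex.Im R).
Implicit Types (phi psi : V -> R[i]).

Definition cdiff phi := forall x, differentiable (Re \o phi) x /\ differentiable (Im \o phi) x.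

Definition is_cpderiv (j : 'I_n) x phi (d : R[i]) :=
  is_derive x (delta_mx j 0) (Re \o phi) (Re d) /\
  is_derive x (delta_mx j 0) (Im \o phi) (Im d).

Lemma is_cpderivP j x phi d : is_cpderiv j x phi d -> cpderiv j phi x = d.
Proof. by move=> [[_ h1] [_ h2]]; rewrite /cpderiv /pderiv h1 h2; case: d {h1 h2}. Qed.

Lemma differentiable_is_derive (f : V -> R) x v : differentiable f x ->
  is_derive x v f ('D_v f x).
Proof. by move=> df; apply: DeriveDef => //; exact: diff_derivable. Qed.

Lemma cdiff_is_cpderiv j x phi : cdiff phi -> is_cpderiv j x phi (cpderiv j phi x).
Proof. by move=> /(_ x)[d1 d2]; split; exact: differentiable_is_derive. Qed.

Lemma is_cpderiv_add j x phi psi d e : is_cpderiv j x phi d -> is_cpderiv j x psi e ->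
  is_cpderiv j x (fun y => phi y + psi y) (d + e).
Proof.
move=> [h1 h2] [h3 h4]; split.
- by rewrite cReD; apply: drv_ext (drv_add h1 h3) => y; rewrite /= cReD.
- by rewrite cImD; apply: drv_ext (drv_add h2 h4) => y; rewrite /= cImD.
Qed.

Lemma is_cpderiv_mul j x phi psi d e : is_cpderiv j x phi d -> is_cpderiv j x psi e ->
  is_cpderiv j x (fun y => phi y * psi y) (d * psi x + phi x * e).
Proof.
move=> [h1 h2] [h3 h4]; split.
- have := drv_sub (drv_mul h1 h3) (drv_mul h2 h4).
  move=> /(drv_ext (g := Re \o (fun y => phi y * psi y))) H.
  apply: (is_derive_eq (H _)); first by move=> y; rewrite /= cReM.
  by rewrite /= cReD !cReM; ring.
- have := drv_add (drv_mul h1 h4) (drv_mul h2 h3).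
  move=> /(drv_ext (g := Im \o (fun y => phi y * psi y))) H.
  apply: (is_derive_eq (H _)); first by move=> y; rewrite /= cImM.
  by rewrite /= cImD !cImM; ring.
Qed.

Lemma is_cpderiv_const j x (c : R[i]) : is_cpderiv j x (fun=> c) 0.
Proof. by split; exact: drv_const. Qed.

Lemma is_cpderiv_conj j x phi d : is_cpderiv j x phi d ->
  is_cpderiv j x (fun y => (phi y)^*%C) d^*%C.
Proof.
move=> [h1 h2]; split.
- by case: d h1 h2 => a b /= h1 _; apply: drv_ext h1 => y /=; case: (phi y).
- case: d h1 h2 => a b /= _ h2; apply: drv_ext (drv_opp h2) => y /=.
  by case: (phi y).
Qed.

Lemma is_cpderiv_real j x (f : V -> R) d : is_derive x (delta_mx j 0) f d ->
  is_cpderiv j x (fun y => (f y)%:C) d%:C.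
Proof. by move=> h; split => //; exact: drv_const. Qed.

Lemma is_cpderiv_cexp j x phi d : is_cpderiv j x phi d ->
  is_cpderiv j x (fun y => cexp (phi y)) (d * cexp (phi x)).
Proof.
move=> [h1 h2].
have he := drv_comp (is_derive_expR (Re (phi x))) h1.
have hc := drv_comp (is_derive_cos (Im (phi x))) h2.
have hs := drv_comp (is_derive_sin (Im (phi x))) h2.
split.
- by apply: (is_derive_eq (drv_mul he hc)); rewrite cReM /=; ring.
- by apply: (is_derive_eq (drv_mul he hs)); rewrite cImM /=; ring.
Qed.

Lemma is_cpderiv_entry j x (k : 'I_n) :
  is_cpderiv j x (fun y => (y k 0)%:C) (k == j)%:R.
Proof.
have := @is_cpderiv_real j x (fun y => y k 0) (k == j)%:R.
rewrite rmorph_nat; apply; apply/is_derive_at0.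
apply: (@drv_ext _ _ (fun t : R => x k 0 + t * (k == j)%:R)).
  by move=> t; rewrite !mxE eqxx andbT.
have := drv_add (drv_const (x k 0) (0 : R) (1 : R))
  (drv_mul (drv_id (0 : R) 1) (drv_const ((k == j)%:R : R) (0 : R) (1 : R))).
by rewrite add0r mul1r mulr0 addr0.
Qed.

Lemma cdiff_add phi psi : cdiff phi -> cdiff psi -> cdiff (fun x => phi x + psi x).
Proof.
move=> h k x; have [h1 h2] := h x; have [k1 k2] := k x; split.
- have := differentiableD h1 k1; congr (differentiable _ _).
  by apply/funext => y; rewrite /= cReD.
- have := differentiableD h2 k2; congr (differentiable _ _).
  by apply/funext => y; rewrite /= cImD.
Qed.

Lemma cdiff_mul phi psi : cdiff phi -> cdiff psi -> cdiff (fun x => phi x * psi x).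
Proof.
move=> h k x; have [h1 h2] := h x; have [k1 k2] := k x; split.
- have := differentiableB (differentiableM h1 k1) (differentiableM h2 k2).
  by congr (differentiable _ _); apply/funext => y; rewrite /= cReM.
- have := differentiableD (differentiableM h1 k2) (differentiableM h2 k1).
  by congr (differentiable _ _); apply/funext => y; rewrite /= cImM.
Qed.

Lemma cdiff_const (c : R[i]) : cdiff (fun=> c).
Proof. by move=> x; split; exact: differentiable_cst. Qed.

Lemma cdiff_real (f : V -> R) : (forall x, differentiable f x) -> cdiff (fun x => (f x)%:C).
Proof. by move=> df x; split; [exact: df|exact: differentiable_cst]. Qed.

Lemma cdiff_conj phi : cdiff phi -> cdiff (fun x => (phi x)^*%C).
Proof.
move=> h x; have [h1 h2] := h x; split.
- have := h1; congr (differentiable _ _).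
  by apply/funext => y /=; case: (phi y).
- have := differentiableN h2; congr (differentiable _ _).
  by apply/funext => y; rewrite -[LHS]/(- Im (phi y)) /=; case: (phi y).
Qed.

Lemma cdiff_entry (k : 'I_n) : cdiff (fun x => (x k 0)%:C).
Proof. by apply: cdiff_real => x; exact: differentiable_coord. Qed.

Lemma cdiff_cexp phi : cdiff phi -> cdiff (fun x => cexp (phi x)).
Proof.
move=> h x; have [h1 h2] := h x.
have de : differentiable (expR \o (Re \o phi)) x.
  by apply: differentiable_comp => //; apply/derivable1_diffP; exact: derivable_expR.
have dc : differentiable (cos \o (Im \o phi)) x.
  apply: differentiable_comp => //; apply/derivable1_diffP.
  by have [] := is_derive_cos (Im (phi x)).
have ds : differentiable (sin \o (Im \o phi)) x.
  apply: differentiable_comp => //; apply/derivable1_diffP.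
  by have [] := is_derive_sin (Im (phi x)).
by split; [exact: differentiableM de dc|exact: differentiableM de ds].
Qed.

Lemma cdiff_continuous phi : cdiff phi ->
  continuous (Re \o phi) /\ continuous (Im \o phi).
Proof. by move=> h; split => x; apply: differentiable_continuous; have [] := h x. Qed.

Lemma cdiff_measurable phi : cdiff phi ->
  measurable_fun setT (Re \o phi) /\ measurable_fun setT (Im \o phi).
Proof.
by move=> /cdiff_continuous[h1 h2]; split; exact: continuous_measurable_cV.
Qed.

End ComplexDerivatives.

Section PolynomialSpan.
Context {R : realType} {n : nat}.
Local Notation V := 'cV[R]_n.
Implicit Types (B : set (V -> R[i])) (phi psi : V -> R[i]).

(** The module over the polynomials in x that is generated by [B]. If the members of [B]
    are rapidly decreasing and their derivatives stay in the module, then all its elements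
    are Schwartz functions; this applies to Gaussians as well as to the derivatives of psi0. *)
Inductive poly_span B : (V -> R[i]) -> Prop :=
| span_base b : B b -> poly_span B b
| span_entry k phi : poly_span B phi -> poly_span B (fun x => (x k 0)%:C * phi x)
| span_scale c phi : poly_span B phi -> poly_span B (fun x => c * phi x)
| span_add phi psi : poly_span B phi -> poly_span B psi ->
    poly_span B (fun x => phi x + psi x).

Lemma span_sum (B : set (V -> R[i])) (I : Type) (r : seq I) (f : I -> V -> R[i]) b :
  poly_span B b -> (forall i, poly_span B (f i)) -> poly_span B (fun x => \sum_(i <- r) f i x).
Proof.
move=> Bb h; elim: r => [|i r IH].
  rewrite (_ : (fun x => _) = fun x => 0 * b x); last first.
    by apply/funext => x; rewrite big_nil mul0r.
  exact: span_scale.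
rewrite (_ : (fun x => _) = fun x => f i x + \sum_(j <- r) f j x); last first.
  by apply/funext => x; rewrite big_cons.
exact: span_add.
Qed.

Definition deriv_stable B := forall b, B b ->
  cdiff b /\ forall j, poly_span B (cpderiv j b).

Lemma span_deriv B phi : deriv_stable B -> poly_span B phi ->
  cdiff phi /\ forall j, poly_span B (cpderiv j phi).
Proof.
move=> hB; elim => {phi} [b /hB//|k phi sp [dp IH]|c phi sp [dp IH]|
   phi psi sp [dp IHp] sq [dq IHq]].
- split; first by apply: cdiff_mul => //; exact: cdiff_entry.
  move=> j; rewrite (_ : cpderiv j _ =
      fun x => (k == j)%:R * phi x + (x k 0)%:C * cpderiv j phi x).
    by apply: span_add; [exact: span_scale|exact: span_entry].
  apply/funext => x; apply: is_cpderivP.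
  by apply: is_cpderiv_mul; [exact: is_cpderiv_entry|exact: cdiff_is_cpderiv].
- split; first by apply: cdiff_mul => //; exact: cdiff_const.
  move=> j; rewrite (_ : cpderiv j _ = fun x => c * cpderiv j phi x).
    exact: span_scale.
  apply/funext => x; apply: is_cpderivP.
  have := is_cpderiv_mul (is_cpderiv_const j x c) (cdiff_is_cpderiv j x dp).
  by rewrite mul0r add0r.
- split; first exact: cdiff_add.
  move=> j; rewrite (_ : cpderiv j _ = fun x => cpderiv j phi x + cpderiv j psi x).
    exact: span_add.
  apply/funext => x; apply: is_cpderivP.
  by apply: is_cpderiv_add; exact: cdiff_is_cpderiv.
Qed.

Lemma span_iter_deriv B phi s : deriv_stable B -> poly_span B phi ->
  poly_span B (iter_cpderiv s phi).
Proof.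
move=> hB sp; elim: s => //= j s IH.
by have [_ /(_ j)] := span_deriv hB IH.
Qed.

Lemma Re_iter_cpderiv s phi :
  iter_pderiv s (@complex.Re R \o phi) = @complex.Re R \o iter_cpderiv s phi.
Proof. by elim: s => //= j s ->. Qed.

Lemma Im_iter_cpderiv s phi :
  iter_pderiv s (@complex.Im R \o phi) = @complex.Im R \o iter_cpderiv s phi.
Proof. by elim: s => //= j s ->. Qed.

Definition bracket (x : V) : R := 1 + `|x|.

Definition rapid phi := forall N, exists C, forall x, normc (phi x) * bracket x ^+ N <= C.

Lemma bracket_ge1 x : 1 <= bracket x. Proof. by rewrite lerDl. Qed.

Lemma bracket_gt0 x : 0 < bracket x.
Proof. exact: lt_le_trans ltr01 (bracket_ge1 x). Qed.

(** Peetre's inequality. *)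
Lemma bracketD x y : bracket (x + y) <= bracket x * bracket y.
Proof.
rewrite /bracket mulrDl mul1r mulrDr mulr1.
have := ler_normD x y; have : 0 <= `|x| * `|y| by rewrite mulr_ge0.
lra.
Qed.

Lemma bracketN x : bracket (- x) = bracket x. Proof. by rewrite /bracket normrN. Qed.

Lemma entry_le_bracket (x : V) i : `|x i 0| <= bracket x.
Proof. by rewrite (le_trans (ler_entry_norm x i))// lerDr. Qed.

(** Turns polynomial decay into domination by the integrable weight. *)
Lemma bracket_wt x : 1 <= bracket x ^+ (2 * n) * wt x.
Proof.
rewrite exprM /wt -[X in _ ^+ X]card_ord -prodr_const -big_split /=.
apply: (big_ind (fun a : R => 1 <= a)) => // [a b a1 b1|i _].
  by rewrite -[1]mulr1 ler_pM.
rewrite /wt1 ler_pdivlMr ?ltr_pwDl ?sqr_ge0// mul1r.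
rewrite (@le_trans _ _ ((1 + `|x i 0|) ^+ 2))//.
  rewrite sqrrD expr1n real_normK ?num_real// mul1r -addrA lerD2l lerDr.
  by rewrite mulrn_wge0.
apply: lerXn2r; rewrite ?nnegrE ?addr_ge0 ?(ltW (bracket_gt0 _))//.
by rewrite lerD2l ler_entry_norm.
Qed.

Lemma span_rapid B phi : (forall b, B b -> rapid b) -> poly_span B phi -> rapid phi.
Proof.
move=> hB; elim => {phi} [b /hB//|k phi _ IH|c phi _ IH|phi psi _ IHp _ IHq] N.
- have [C hC] := IH N.+1; exists C => x; apply: le_trans (hC x).
  rewrite normcM normc_real exprS [leRHS]mulrA ler_wpM2r ?exprn_ge0 ?(ltW (bracket_gt0 _))//.
  by rewrite mulrC ler_wpM2l ?normc_ge0// entry_le_bracket.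
- have [C hC] := IH N; exists (normc c * C) => x.
  by rewrite normcM -mulrA ler_wpM2l ?normc_ge0.
- have [C hC] := IHp N; have [C' hC'] := IHq N; exists (C + C') => x.
  apply: le_trans (_ : (normc (phi x) + normc (psi x)) * bracket x ^+ N <= _).
    by rewrite ler_wpM2r ?exprn_ge0 ?(ltW (bracket_gt0 _))// normcD.
  by rewrite mulrDl lerD.
Qed.

Lemma schwartz_of_span B phi : deriv_stable B -> (forall b, B b -> rapid b) ->
  poly_span B phi -> schwartz phi.
Proof.
move=> hB rB sp.
have dphi s : cdiff (iter_cpderiv s phi).
  by have [] := span_deriv hB (span_iter_deriv s hB sp).
split.
- by move=> s x; rewrite Re_iter_cpderiv; have [] := dphi s x.
- by move=> s x; rewrite Im_iter_cpderiv; have [] := dphi s x.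
move=> alpha s; have [C hC] := span_rapid rB (span_iter_deriv s hB sp) (\sum_i alpha i)%N.
exists C => x; apply: le_trans (hC x); rewrite mulrC ler_wpM2l ?normc_ge0//.
rewrite expr_sum; apply: ler_prod => i _.
by rewrite exprn_ge0//= lerXn2r ?nnegrE ?entry_le_bracket ?(ltW (bracket_gt0 _)).
Qed.

Lemma schwartz_cdiff phi s : schwartz phi -> cdiff (iter_cpderiv s phi).
Proof.
by move=> [h1 h2 _] x; split; [have := h1 s x; rewrite Re_iter_cpderiv|
  have := h2 s x; rewrite Im_iter_cpderiv].
Qed.

(** Reduces powers of the norm to powers of single entries, the form in which the
    seminorms of [schwartz] are given. *)
Lemma bracket_pow_le (x : V) N : bracket x ^+ N <= 2 ^+ N * (1 + \sum_i `|x i 0| ^+ N).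
Proof.
have S0 : 0 <= \sum_i `|x i 0| ^+ N by apply: sumr_ge0 => i _; rewrite exprn_ge0.
have [x1|x1] := leP `|x| 1.
  rewrite -[leLHS]mulr1 ler_pM ?exprn_ge0 ?(ltW (bracket_gt0 _))//.
    by rewrite lerXn2r ?nnegrE ?(ltW (bracket_gt0 _))// /bracket; lra.
  by rewrite lerDl.
have [|i xi] := @mx_norm_neq0 R n 1 x.
  by have : `|x| != 0 by rewrite gt_eqF// (lt_trans ltr01).
have {}xi : `|x| = `|x i.1 0| by rewrite -(ord1 i.2); exact: xi.
apply: le_trans (_ : 2 ^+ N * `|x| ^+ N <= _).
  by rewrite -exprMn lerXn2r ?nnegrE ?(ltW (bracket_gt0 _)) ?mulr_ge0// /bracket; lra.
rewrite ler_wpM2l ?exprn_ge0// xi (bigD1 i.1)//= addrCA lerDl addr_ge0//.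
by apply: sumr_ge0 => j _; rewrite exprn_ge0.
Qed.

Lemma schwartz_rapid phi s : schwartz phi -> rapid (iter_cpderiv s phi).
Proof.
move=> [_ _ h] N; set f := iter_cpderiv s phi.
have [C0 hC0] := h (fun=> 0%N) s.
have /choice[C hC] : forall i : 'I_n, exists c, forall x : 'cV[R]_n, `|x i 0| ^+ N * normc (f x) <= c.
  move=> i; have [c hc] := h (fun k => if k == i then N else 0%N) s; exists c => x.
  apply: le_trans (hc x); rewrite (bigD1 i)//= eqxx big1 ?mulr1// => k ki.
  by rewrite (negbTE ki) expr0.
exists (2 ^+ N * (C0 + \sum_i C i)) => x.
have f0 := normc_ge0 (f x).
apply: le_trans (_ : normc (f x) * (2 ^+ N * (1 + \sum_i `|x i 0| ^+ N)) <= _).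
  by rewrite ler_wpM2l// bracket_pow_le.
rewrite mulrCA ler_wpM2l ?exprn_ge0// mulrDr mulr1 lerD//.
  by apply: le_trans (hC0 x); rewrite big1 ?mul1r// => i _; rewrite expr0.
by rewrite mulr_sumr; apply: ler_sum => i _; rewrite mulrC.
Qed.

End PolynomialSpan.

(** * Dominated complex integrals *)

Section DominatedIntegrals.
Context {R : realType} {n : nat}.
Local Notation mu := (lebesgue_cV R n).
Local Notation V := 'cV[R]_n.
Local Notation Re := (@complex.Re R).
Local Notation Im := (@complex.Im R).
Implicit Types (f g : V -> R[i]).

Definition cmeas f := measurable_fun setT (Re \o f) /\ measurable_fun setT (Im \o f).

Definition wtmass : R := \int[mu]_x wt x.

Lemma cmeas_add f g : cmeas f -> cmeas g -> cmeas (fun x => f x + g x).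
Proof.
move=> [f1 f2] [g1 g2]; split.
- rewrite (_ : _ \o _ = (Re \o f) \+ (Re \o g)); first exact: measurable_funD.
  by apply/funext => x; rewrite /= cReD.
- rewrite (_ : _ \o _ = (Im \o f) \+ (Im \o g)); first exact: measurable_funD.
  by apply/funext => x; rewrite /= cImD.
Qed.

Lemma cmeas_mul f g : cmeas f -> cmeas g -> cmeas (fun x => f x * g x).
Proof.
move=> [f1 f2] [g1 g2]; split.
- rewrite (_ : _ \o _ = (fun x => Re (f x) * Re (g x) - Im (f x) * Im (g x))).
    by apply: measurable_funB; exact: measurable_funM.
  by apply/funext => x; rewrite /= cReM.
- rewrite (_ : _ \o _ = (fun x => Re (f x) * Im (g x) + Im (f x) * Re (g x))).
    by apply: measurable_funD; exact: measurable_funM.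
  by apply/funext => x; rewrite /= cImM.
Qed.

Lemma cmeas_conj f : cmeas f -> cmeas (fun x => (f x)^*%C).
Proof.
move=> [f1 f2]; split.
- by rewrite (_ : _ \o _ = Re \o f)//; apply/funext => x /=; case: (f x).
- rewrite (_ : _ \o _ = \- (Im \o f)); first exact: measurable_funN.
  by apply/funext => x /=; case: (f x).
Qed.

Lemma cmeas_const (c : R[i]) : cmeas (fun=> c).
Proof. by split; exact: measurable_cst. Qed.

(** Domination by the weight, with measurability: under it [cintegral] is linear, bounded
    and continuous in parameters. *)
Definition wt_bounded (C : R) f := cmeas f /\ forall x, normc (f x) <= C * wt x.

Lemma wt_bounded_integrable C f : wt_bounded C f ->
  mu.-integrable setT (EFin \o (Re \o f)) /\ mu.-integrable setT (EFin \o (Im \o f)).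
Proof.
move=> [[m1 m2] fC]; split; apply: (@integrable_le_wt R n C) => // x.
- exact: le_trans (norm_Re_le _) (fC x).
- exact: le_trans (norm_Im_le _) (fC x).
Qed.

Lemma wt_bounded_add C C' f g : wt_bounded C f -> wt_bounded C' g ->
  wt_bounded (C + C') (fun x => f x + g x).
Proof.
move=> [mf fC] [mg gC]; split; first exact: cmeas_add.
by move=> x; rewrite mulrDl (le_trans (normcD _ _))// lerD.
Qed.

Lemma wt_bounded_scale C (c : R[i]) f : wt_bounded C f ->
  wt_bounded (normc c * C) (fun x => c * f x).
Proof.
move=> [mf fC]; split; first by apply: cmeas_mul => //; exact: cmeas_const.
by move=> x; rewrite normcM -mulrA ler_wpM2l ?normc_ge0.
Qed.

Lemma wt_bounded_bracket C f : cmeas f ->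
  (forall x, normc (f x) * bracket x ^+ (2 * n) <= C) -> wt_bounded C f.
Proof.
move=> mf fC; split => // x; have := ler_wpM2r (ltW (wt_gt0 x)) (fC x).
apply: le_trans; rewrite -mulrA ler_peMr ?normc_ge0//.
exact: bracket_wt.
Qed.

Lemma cintegral_add C C' f g : wt_bounded C f -> wt_bounded C' g ->
  cintegral mu (fun x => f x + g x) = cintegral mu f + cintegral mu g.
Proof.
move=> /wt_bounded_integrable[f1 f2] /wt_bounded_integrable[g1 g2].
apply: complex_eq => /=.
- rewrite -RintegralD//; apply: eq_Rintegral => x _; exact: cReD.
- rewrite -RintegralD//; apply: eq_Rintegral => x _; exact: cImD.
Qed.

Lemma cintegral_scale C c f : wt_bounded C f ->
  cintegral mu (fun x => c * f x) = c * cintegral mu f.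
Proof.
move=> /wt_bounded_integrable[f1 f2]; case: c => a b; apply: complex_eq => /=.
- rewrite -!RintegralZl// -RintegralB//; [|exact: (integrableZl measurableT a f1)|
    exact: (integrableZl measurableT b f2)].
  by apply: eq_Rintegral => x _; rewrite cReM.
- rewrite [RHS]addrC -!RintegralZl// -RintegralD//;
    [|exact: (integrableZl measurableT b f1)|exact: (integrableZl measurableT a f2)].
  by apply: eq_Rintegral => x _; rewrite cImM addrC.
Qed.

Lemma normc_cintegral_le C f : wt_bounded C f ->
  normc (cintegral mu f) <= 2 * (C * wtmass).
Proof.
move=> bf; have [f1 f2] := wt_bounded_integrable bf; have [_ fC] := bf.
have iw : mu.-integrable setT (EFin \o @wt R n).
  have := @integrable_wt R n 1; congr (_.-integrable _ _).
  by apply/funext => x; rewrite mul1r.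
have bound (h : V -> R) : mu.-integrable setT (EFin \o h) ->
    (forall x, `|h x| <= normc (f x)) -> `|\int[mu]_x h x| <= C * wtmass.
  move=> ih hf; apply: le_trans (le_normr_Rintegral measurableT ih) _.
  rewrite /wtmass -RintegralZl//; apply: le_Rintegral => //.
  - by have := integrable_norm ih.
  - exact: integrable_wt.
  - by move=> x _; exact: le_trans (hf x) (fC x).
rewrite mulr2n mulrDl mul1r; apply: le_trans (normc_le_add _) _.
by apply: lerD; apply: bound => // x; [exact: norm_Re_le|exact: norm_Im_le].
Qed.

Lemma eq_cintegral f g : f =1 g -> cintegral mu f = cintegral mu g.
Proof. by move=> /funext ->. Qed.

(** Dominated convergence is about sequences; without continuity some sequence converging
    to [z0] would keep the integrals apart. *)
Lemma cintegral_continuous (W : normedModType R) (K : W -> V -> R[i]) (z0 : W) (C : R) :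
  (forall x, continuous (fun z => Re (K z x)) /\ continuous (fun z => Im (K z x))) ->
  (forall z, cmeas (K z)) ->
  (forall z x, `|z - z0| < 1 -> normc (K z x) <= C * wt x) ->
  forall e, 0 < e -> exists2 d, 0 < d & forall z, `|z - z0| < d ->
    normc (cintegral mu (K z) - cintegral mu (K z0)) <= e.
Proof.
move=> cK mK KC e e0; apply: contrapT => H.
have {}H (d : R) : 0 < d -> exists z, `|z - z0| < d /\
    e < normc (cintegral mu (K z) - cintegral mu (K z0)).
  move=> d0; apply: contrapT => H2; apply: H; exists d => // z zd.
  by rewrite leNgt; apply/negP => h; apply: H2; exists z.
have /choice[z_ hz] : forall k : nat, exists z, `|z - z0| < k.+1%:R^-1 /\
    e < normc (cintegral mu (K z) - cintegral mu (K z0)).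
  by move=> k; apply: H; rewrite invr_gt0.
have z1 k : `|z_ k - z0| < 1.
  by apply: lt_le_trans (hz k).1 _; rewrite invf_le1 ?ler1n.
have zc : z_ k @[k --> \oo] --> z0.
  apply/cvgrPdist_lt => r r0.
  have /cvgrPdist_lt/(_ _ r0)[N _ hN] := @cvg_harmonic R.
  exists N => // k Nk; have := hN k Nk.
  rewrite /= sub0r normrN ger0_norm ?invr_ge0// distrC.
  exact: lt_trans (hz k).1.
have K0 x : normc (K z0 x) <= C * wt x by apply: KC; rewrite subrr normr0.
have lim (h : R[i] -> R) : (forall x, continuous (fun z => h (K z x))) ->
    (forall z, measurable_fun setT (h \o K z)) -> (forall c, `|h c| <= normc c) ->
    \int[mu]_x h (K (z_ k) x) @[k --> \oo] --> \int[mu]_x h (K z0 x).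
  move=> ch mh hn.
  apply: fine_cvg; rewrite fineK; last first.
    apply: integrable_fin_num => //; apply: (@integrable_le_wt R n C) => // x.
      exact: mh.
    by rewrite (le_trans (hn _)).
  apply: (@dominated_cvg _ _ _ mu setT measurableT (fun k x => (h (K (z_ k) x))%:E)
    (fun x => (h (K z0 x))%:E) (fun x => (C * wt x)%:E)) => //.
  - by move=> k; apply/measurable_EFinP; exact: mh.
  - move=> x _; apply/fine_cvgP; split; first exact: nearW.
    by rewrite /comp /=; apply: (cvg_comp z_ (fun z => h (K z x)) zc); exact: ch.
  - exact: integrable_wt.
  - by move=> k x _; rewrite lee_fin (le_trans (hn _))// KC.
have lRe := lim Re (fun x => (cK x).1) (fun z => (mK z).1) (@norm_Re_le R).
have lIm := lim Im (fun x => (cK x).2) (fun z => (mK z).2) (@norm_Im_le R).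
have e2 : 0 < e / 2 by rewrite divr_gt0.
have /cvgrPdist_le/(_ _ e2)[N1 _ hN1] := lRe.
have /cvgrPdist_le/(_ _ e2)[N2 _ hN2] := lIm.
have := (hz (maxn N1 N2)).2; apply/negP; rewrite -leNgt.
apply: le_trans (normc_le_add _) _; rewrite (splitr e) lerD//= distrC.
- by apply: hN1 => /=; exact: leq_maxl.
- by apply: hN2 => /=; exact: leq_maxr.
Qed.

End DominatedIntegrals.

(** * Gaussian wave packets *)

(** A square dominates linear terms, and an exponential dominates powers. *)
Lemma expR_gauss_bound (R : realType) (c : R) (K : nat) : 0 < c ->
  exists C, forall s : R, 0 <= s -> expR (- (c * s ^+ 2)) * (1 + s) ^+ K <= C.
Proof.
move=> c0; exists (K`!%:R * expR (1 + (4 * c)^-1)) => s s0.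
apply: le_trans (_ : expR (- (c * s ^+ 2)) * (K`!%:R * expR (1 + s)) <= _).
  by rewrite ler_wpM2l ?expR_ge0// expr_le_fact_expR// addr_ge0.
rewrite mulrCA ler_wpM2l// -expRD ler_expR.
rewrite addrCA lerD2l -subr_ge0.
rewrite (_ : _ - _ = c * (s - (2 * c)^-1) ^+ 2); last by field; rewrite gt_eqF.
by rewrite mulr_ge0 ?sqr_ge0// ltW.
Qed.

Section Differentiability.
Context {R : realType} {W : normedModType R}.
Implicit Types (f g : W -> R) (x : W).

Lemma dif_add f g x : differentiable f x -> differentiable g x ->
  differentiable (fun y => f y + g y) x.
Proof. exact: differentiableD. Qed.

Lemma dif_mul f g x : differentiable f x -> differentiable g x ->
  differentiable (fun y => f y * g y) x.
Proof. exact: differentiableM. Qed.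

Lemma dif_const (c : R) x : differentiable (fun _ : W => c) x.
Proof. exact: differentiable_cst. Qed.

Lemma dif_sum (I : Type) (r : seq I) (f : I -> W -> R) x :
  (forall i, differentiable (f i) x) -> differentiable (fun y => \sum_(i <- r) f i y) x.
Proof.
move=> h; elim: r => [|i r IH].
  by under eq_fun do rewrite big_nil; exact: dif_const.
by under eq_fun do rewrite big_cons; exact: dif_add.
Qed.

Lemma dif_dot k (u v : W -> 'cV[R]_k) x :
  (forall i, differentiable (fun y => u y i 0) x) ->
  (forall i, differentiable (fun y => v y i 0) x) ->
  differentiable (fun y => dot (u y) (v y)) x.
Proof.
move=> hu hv; under eq_fun do rewrite dotE.
by apply: dif_sum => i; exact: dif_mul.
Qed.

Lemma dif_mulmx k l (A : 'M[R]_(l, k)) (v : W -> 'cV[R]_k) x i :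
  (forall i, differentiable (fun y => v y i 0) x) ->
  differentiable (fun y => (A *m v y) i 0) x.
Proof.
move=> hv; under eq_fun do rewrite mxE.
by apply: dif_sum => j; apply: dif_mul => //; exact: dif_const.
Qed.

End Differentiability.

Section GaussianPackets.
Context {R : realType} {D : nat}.
Variables (eps : R) (Gamma : 'M[R]_D).
Hypotheses (heps : 0 < eps) (Gamma_sym : Gamma^T = Gamma).
Hypothesis Gamma_pos : forall x : 'cV[R]_D, x != 0 -> 0 < dot x (Gamma *m x).
Local Notation g := (gaussian eps Gamma).
Local Notation phase := 'cV[R]_(D + D).
Local Notation V := 'cV[R]_D.
Local Notation Re := (@complex.Re R).
Local Notation Im := (@complex.Im R).
Implicit Types (x : V) (z y : phase).

Definition gauss_amp : R := (\det Gamma / (pi ^+ D * eps ^+ D)) `^ (1 / 4).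

Definition gauss_exponent z x : R[i] :=
  (- (dot (x - usubmx z) (Gamma *m (x - usubmx z)) / (2 * eps)))
  +i* (dot (dsubmx z) (x - usubmx z) / eps).

Lemma gauss_amp_gt0 : 0 < gauss_amp.
Proof.
rewrite /gauss_amp /powR ifF ?expR_gt0//; apply/negbTE.
have := posdef_unitmx Gamma_sym Gamma_pos; rewrite unitmxE unitfE => dG.
by rewrite mulf_neq0// invr_eq0 mulf_neq0// expf_neq0// gt_eqF// pi_gt0.
Qed.

Lemma i_over_epsE : 'i%C / eps%:C = 0 +i* eps^-1 :> R[i].
Proof. by rewrite -fmorphV; apply: complex_eq; rewrite ?cReM ?cImM /=; ring. Qed.

Lemma i_over_eps (r : R) : 'i%C / eps%:C * r%:C = 0 +i* (r / eps) :> R[i].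
Proof. by rewrite i_over_epsE; apply: complex_eq; rewrite ?cReM ?cImM /=; ring. Qed.

Lemma gaussianE z x : g z x = gauss_amp%:C * cexp (gauss_exponent z x).
Proof.
rewrite /gaussian -/gauss_amp i_over_eps; congr (_ * cexp _).
apply: complex_eq; rewrite ?cReD ?cImD ?cReM ?cImM /=; field; exact: lt0r_neq0.
Qed.

Lemma normc_gaussian z x : normc (g z x) = gauss_amp *
  expR (- (dot (x - usubmx z) (Gamma *m (x - usubmx z)) / (2 * eps))).
Proof.
by rewrite gaussianE normcM normc_real normc_cexp ger0_norm// ltW// gauss_amp_gt0.
Qed.

Lemma gaussian_neq0 z x : g z x != 0.
Proof.
rewrite gaussianE mulf_neq0 ?cexp_neq0//.
by rewrite -normc_gt0 normc_real normr_gt0 gt_eqF// gauss_amp_gt0.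
Qed.

Lemma gaussian_decay K : exists C, forall z x,
  normc (g z x) * bracket (x - usubmx z) ^+ K <= C.
Proof.
have [c c0 hc] := quad_lower_bound Gamma_sym Gamma_pos.
have c1 : 0 < c / (2 * eps) by rewrite divr_gt0// mulr_gt0.
have [C hC] := expR_gauss_bound K c1.
exists (gauss_amp * C) => z x; rewrite normc_gaussian -mulrA.
rewrite ler_wpM2l ?(ltW gauss_amp_gt0)//.
apply: le_trans (hC `|x - usubmx z| (normr_ge0 _)).
rewrite /bracket ler_wpM2r ?exprn_ge0 ?addr_ge0// ler_expR lerN2.
by rewrite mulrAC ler_pM2r ?invr_gt0 ?mulr_gt0.
Qed.

Lemma gaussian_bounded : exists C, forall z x, normc (g z x) <= C.
Proof.
have [C hC] := gaussian_decay 0; exists C => z x.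
by have := hC z x; rewrite expr0 mulr1.
Qed.

(** As the packet decays away from its centre, polynomial weights in x and in the centre
    can be exchanged against it. *)
Lemma gaussian_bracket K : exists C, forall z x,
  normc (g z x) * bracket x ^+ K <= C * bracket (usubmx z) ^+ K /\
  normc (g z x) * bracket (usubmx z) ^+ K <= C * bracket x ^+ K.
Proof.
have [C hC] := gaussian_decay K; exists C => z x.
have key (a b c : V) : bracket a <= bracket b * bracket c ->
    bracket (x - usubmx z) = bracket b ->
    normc (g z x) * bracket a ^+ K <= C * bracket c ^+ K.
  move=> abc bE; have b0 := bracket_gt0 b; have c0 := bracket_gt0 c.
  apply: le_trans (_ : normc (g z x) * (bracket b * bracket c) ^+ K <= _).
    apply: ler_wpM2l; [exact: normc_ge0|apply: lerXn2r => //].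
      by rewrite nnegrE ltW// bracket_gt0.
    by rewrite nnegrE mulr_ge0// ltW.
  by rewrite exprMn mulrA ler_wpM2r ?exprn_ge0 ?(ltW c0)// -bE.
split.
- apply: (key _ (x - usubmx z)) => //.
  by have := bracketD (x - usubmx z) (usubmx z); rewrite subrK.
- apply: (key _ (- (x - usubmx z))); last by rewrite bracketN.
  by have := bracketD (- (x - usubmx z)) x; rewrite opprB subrK.
Qed.

Lemma cdiff_gaussian z : cdiff (g z).
Proof.
rewrite (_ : g z = fun x => gauss_amp%:C * cexp (gauss_exponent z x)); last first.
  by apply/funext => x; exact: gaussianE.
apply: cdiff_mul; [exact: cdiff_const|apply: cdiff_cexp => x].
have d1 i : differentiable (fun y : V => (y - usubmx z) i 0) x.
  under eq_fun do rewrite !mxE.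
  by apply: dif_add; [exact: differentiable_coord|exact: dif_const].
split.
- rewrite (_ : _ \o _ = fun x => (- (2 * eps)^-1) *
      dot (x - usubmx z) (Gamma *m (x - usubmx z))); last first.
    by apply/funext => u /=; rewrite mulNr mulrC.
  apply: dif_mul; first exact: dif_const.
  by apply: dif_dot => // i; exact: dif_mulmx.
- rewrite (_ : _ \o _ = fun x => eps^-1 * dot (dsubmx z) (x - usubmx z)); last first.
    by apply/funext => u /=; rewrite mulrC.
  apply: dif_mul; first exact: dif_const.
  by apply: dif_dot => // i; exact: dif_const.
Qed.

Lemma cdiff_gaussian_center x : cdiff (fun z => g z x).
Proof.
rewrite (_ : (fun z => _) = fun z => gauss_amp%:C * cexp (gauss_exponent z x)); last first.
  by apply/funext => z; exact: gaussianE.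
apply: cdiff_mul; [exact: cdiff_const|apply: cdiff_cexp => z].
have d1 i : differentiable (fun y : phase => (x - usubmx y) i 0) z.
  under eq_fun do rewrite !mxE -mulN1r.
  apply: dif_add; first exact: dif_const.
  by apply: dif_mul; [exact: dif_const|exact: differentiable_coord].
have d2 i : differentiable (fun y : phase => (dsubmx y) i 0) z.
  by under eq_fun do rewrite !mxE; exact: differentiable_coord.
split.
- rewrite (_ : _ \o _ = fun z => (- (2 * eps)^-1) *
    dot (x - usubmx z) (Gamma *m (x - usubmx z))); last first.
    by apply/funext => u /=; rewrite mulNr mulrC.
  apply: dif_mul; first exact: dif_const.
  by apply: dif_dot => // i; exact: dif_mulmx.
- rewrite (_ : _ \o _ = fun z => eps^-1 * dot (dsubmx z) (x - usubmx z)); last first.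
    by apply/funext => u /=; rewrite mulrC.
  apply: dif_mul; first exact: dif_const.
  by apply: dif_dot.
Qed.

(** The complex velocity p_j + i (Gamma (x - q))_j, by which the j-th momentum operator
    multiplies a Gaussian. *)
Definition gvel (j : 'I_D) z x : R[i] :=
  (dsubmx z j 0) +i* ((Gamma *m (x - usubmx z)) j 0).

Lemma is_derive_entry (j : 'I_D) x (u : V) (i : 'I_D) :
  is_derive x (delta_mx j 0) (fun y : V => (y - u) i 0) ((i == j)%:R).
Proof.
apply/is_derive_at0.
apply: (@drv_ext _ _ (fun t : R => (x - u) i 0 + t * (i == j)%:R)).
  by move=> t; rewrite !mxE eqxx andbT; ring.
have := drv_add (drv_const ((x - u) i 0) (0 : R) (1 : R))
  (drv_mul (drv_id (0 : R) 1) (drv_const ((i == j)%:R : R) (0 : R) (1 : R))).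
by rewrite add0r mul1r mulr0 addr0.
Qed.

Lemma is_derive_Gamma_entry (j : 'I_D) x (u : V) (i : 'I_D) :
  is_derive x (delta_mx j 0) (fun y : V => (Gamma *m (y - u)) i 0) (Gamma i j).
Proof.
apply: (@drv_ext _ _ (fun y : V => \sum_k Gamma i k * (y - u) k 0)).
  by move=> y; rewrite [RHS]mxE.
have := @drv_sum _ _ _ (index_enum 'I_D) xpredT (fun k (y : V) => Gamma i k * (y - u) k 0)
  x (delta_mx j 0) _ (fun k => drv_scale (Gamma i k) (is_derive_entry j x u k)).
move=> /is_derive_eq; apply.
by rewrite (bigD1 j)//= eqxx mulr1 big1 ?addr0// => k /negbTE ->; rewrite mulr0.
Qed.

Lemma is_cpderiv_gvel (j : 'I_D) z x : is_cpderiv j x (gvel j z) ('i%C * (Gamma j j)%:C).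
Proof.
split.
- have := drv_const (dsubmx z j 0) x (delta_mx j 0 : V).
  by move=> /is_derive_eq; apply; rewrite cReM /=; ring.
- apply: (is_derive_eq (is_derive_Gamma_entry j x (usubmx z) j)).
  by rewrite cImM /=; ring.
Qed.

Lemma is_cpderiv_gaussian (j : 'I_D) z x :
  is_cpderiv j x (g z) ('i%C / eps%:C * gvel j z x * g z x).
Proof.
rewrite {1}(_ : g z = fun x => gauss_amp%:C * cexp (gauss_exponent z x)); last first.
  by apply/funext => u; exact: gaussianE.
rewrite gaussianE.
have e0 : eps != 0 by rewrite gt_eqF.
have he : is_cpderiv j x (gauss_exponent z) ('i%C / eps%:C * gvel j z x).
  rewrite i_over_epsE; split.
  - have hq := @drv_sum _ _ _ (index_enum 'I_D) xpredT
      (fun k (y : V) => (y - usubmx z) k 0 * (Gamma *m (y - usubmx z)) k 0) x (delta_mx j 0) _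
      (fun k => drv_mul (is_derive_entry j x (usubmx z) k)
                        (is_derive_Gamma_entry j x (usubmx z) k)).
    have := drv_scale (- (2 * eps)^-1) hq.
    move=> /(@drv_ext _ _ _ (Re \o gauss_exponent z)) H.
    apply: (is_derive_eq (H _)).
      by move=> y /=; rewrite -dotE mulNr mulrC.
    rewrite big_split /= (bigD1 j)//= eqxx mul1r big1 ?addr0; last first.
      by move=> k /negbTE ->; rewrite mul0r.
    rewrite (_ : \sum_(i < D) _ = (Gamma *m (x - usubmx z)) j 0); last first.
      rewrite [RHS]mxE; apply: eq_bigr => k _.
      by rewrite mulrC -{1}Gamma_sym [_^T _ _]mxE.
    by rewrite /=; field.
  - have hq := @drv_sum _ _ _ (index_enum 'I_D) xpredT
      (fun k (y : V) => dsubmx z k 0 * (y - usubmx z) k 0) x (delta_mx j 0) _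
      (fun k => drv_scale (dsubmx z k 0) (is_derive_entry j x (usubmx z) k)).
    have := drv_scale (eps^-1) hq.
    move=> /(@drv_ext _ _ _ (Im \o gauss_exponent z)) H.
    apply: (is_derive_eq (H _)).
      by move=> y /=; rewrite -dotE mulrC.
    rewrite (bigD1 j)//= eqxx mulr1 big1 ?addr0; last first.
      by move=> k /negbTE ->; rewrite mulr0.
    by rewrite /=; ring.
have := is_cpderiv_mul (is_cpderiv_const j x gauss_amp%:C) (is_cpderiv_cexp he).
by congr is_cpderiv; ring.
Qed.

Lemma cpderiv_gaussian (j : 'I_D) z x :
  cpderiv j (g z) x = 'i%C / eps%:C * gvel j z x * g z x.
Proof. exact/is_cpderivP/is_cpderiv_gaussian. Qed.

Lemma gaussian_deriv_stable z : deriv_stable [set g z].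
Proof.
move=> _ ->; split; first exact: cdiff_gaussian.
move=> j; rewrite (_ : cpderiv j (g z) = fun x =>
   'i%C / eps%:C * ((dsubmx z j 0)%:C - 'i%C * ((Gamma *m usubmx z) j 0)%:C) * g z x
   + \sum_k ('i%C / eps%:C * 'i%C * (Gamma j k)%:C) * ((x k 0)%:C * g z x)).
  apply: span_add; first by apply: span_scale; exact: span_base.
  apply: (@span_sum _ _ _ _ _ _ (g z)) => [|k]; first exact: span_base.
  apply: span_scale; apply: span_entry.
  exact: span_base.
apply/funext => x; rewrite cpderiv_gaussian.
rewrite (_ : \sum_k _ = 'i%C / eps%:C * 'i%C * ((Gamma *m x) j 0)%:C * g z x); last first.
  rewrite mxE rmorph_sum /= mulr_sumr mulr_suml; apply: eq_bigr => k _.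
  by rewrite rmorphM /=; ring.
have -> : gvel j z x = (dsubmx z j 0)%:C - 'i%C * ((Gamma *m usubmx z) j 0)%:C
    + 'i%C * ((Gamma *m x) j 0)%:C.
  rewrite /gvel mulmxBr [X in _ +i* X]mxE [X in _ +i* (_ + X)]mxE.
  move: ((Gamma *m x) j 0) ((Gamma *m usubmx z) j 0) (dsubmx z j 0) => a b c.
  by apply: complex_eq => /=; ring.
by ring.
Qed.

Lemma gaussian_rapid z : rapid (g z).
Proof.
move=> N; have [C hC] := gaussian_bracket N.
by exists (C * bracket (usubmx z) ^+ N) => x; exact: (hC z x).1.
Qed.

Lemma schwartz_gaussian z : schwartz (g z).
Proof.
apply: (@schwartz_of_span _ _ [set g z]).
- exact: gaussian_deriv_stable.
- by move=> _ ->; exact: gaussian_rapid.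
- exact: span_base.
Qed.

End GaussianPackets.

(** * Decay of the overlaps with wave packets *)

Section CoherentDecay.
Context {R : realType} {D : nat}.
Variables (eps : R) (Gamma : 'M[R]_D).
Hypotheses (heps : 0 < eps) (Gamma_sym : Gamma^T = Gamma).
Hypothesis Gamma_pos : forall x : 'cV[R]_D, x != 0 -> 0 < dot x (Gamma *m x).
Local Notation g := (gaussian eps Gamma).
Local Notation phase := 'cV[R]_(D + D).
Local Notation V := 'cV[R]_D.
Local Notation mu := (lebesgue_cV R D).
Implicit Types (x : V) (z y : phase) (phi psi : V -> R[i]).

Lemma rapid_wt_bounded phi psi : cmeas phi -> cmeas psi -> rapid phi -> rapid psi ->
  exists C, wt_bounded C (fun x => (phi x)^*%C * psi x).
Proof.
move=> mp mq rp rq; have [C1 h1] := rp (2 * D)%N; have [C2 h2] := rq 0%N.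
exists (C1 * C2); apply: wt_bounded_bracket.
  by apply: cmeas_mul => //; exact: cmeas_conj.
move=> x; rewrite normcM normcJ mulrAC ler_pM ?mulr_ge0 ?normc_ge0 ?exprn_ge0//.
  exact: ltW (bracket_gt0 _).
by have := h2 x; rewrite expr0 mulr1.
Qed.

(** The derivative of conj(phi) psi has integral 0. *)
Lemma inner_deriv_antisym (j : 'I_D) phi psi :
  cdiff phi -> cdiff psi -> cdiff (cpderiv j phi) -> cdiff (cpderiv j psi) ->
  rapid phi -> rapid psi -> rapid (cpderiv j phi) -> rapid (cpderiv j psi) ->
  inner (cpderiv j phi) psi + inner phi (cpderiv j psi) = 0.
Proof.
move=> dp dq ddp ddq rp rq rdp rdq.
have mp := cdiff_measurable dp; have mq := cdiff_measurable dq.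
have mdp := cdiff_measurable ddp; have mdq := cdiff_measurable ddq.
have [C0 b0] := rapid_wt_bounded mp mq rp rq.
have [C1 b1] := rapid_wt_bounded mdp mq rdp rq.
have [C2 b2] := rapid_wt_bounded mp mdq rp rdq.
rewrite /inner -(cintegral_add b1 b2).
set F := fun x => (phi x)^*%C * psi x.
set G := fun x => _.
have dF x : is_cpderiv j x F (G x).
  apply: is_cpderiv_mul; last exact: cdiff_is_cpderiv.
  by apply: is_cpderiv_conj; exact: cdiff_is_cpderiv.
have [mG bG] := wt_bounded_add b1 b2.
have cG : cdiff G.
  by apply: cdiff_add; apply: cdiff_mul => //; exact: cdiff_conj.
have [cG1 cG2] := cdiff_continuous cG.
have cl x : continuous (fun s : R => x + s *: (delta_mx j 0 : V)).
  move=> s; apply: (@continuousD _ _ _ (cst x) (fun s : R => s *: (delta_mx j 0 : V))).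
    exact: cst_continuous.
  exact: scalel_continuous.
have C00 x : normc (F x) <= (C0 + C1 + C2) * wt x.
  apply: le_trans (b0.2 x) _; rewrite ler_wpM2r ?(ltW (wt_gt0 _))//.
  rewrite -addrA lerDl; have := le_trans (normc_ge0 _) (bG 0).
  by rewrite pmulr_lge0// wt_gt0.
have C11 x : normc (G x) <= (C0 + C1 + C2) * wt x.
  apply: le_trans (bG x) _; rewrite ler_wpM2r ?(ltW (wt_gt0 _))//.
  rewrite -addrA lerDr; have := le_trans (normc_ge0 _) (b0.2 0).
  by rewrite pmulr_lge0// wt_gt0.
apply: complex_eq => /=.
- apply: (@integral_partial_derivative _ _ j (@complex.Re R \o F) (@complex.Re R \o G) (C0 + C1 + C2)) => //.
  + by move=> x; have [] := dF x.
  + by have [] := mG.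
  + by move=> x s; apply: continuous_comp; [exact: cl|exact: cG1].
  + by move=> x; apply: le_trans (C00 x); exact: norm_Re_le.
  + by move=> x; apply: le_trans (C11 x); exact: norm_Re_le.
- apply: (@integral_partial_derivative _ _ j (@complex.Im R \o F) (@complex.Im R \o G) (C0 + C1 + C2)) => //.
  + by move=> x; have [] := dF x.
  + by have [] := mG.
  + by move=> x s; apply: continuous_comp; [exact: cl|exact: cG2].
  + by move=> x; apply: le_trans (C00 x); exact: norm_Im_le.
  + by move=> x; apply: le_trans (C11 x); exact: norm_Im_le.
Qed.

Lemma coherent_bound phi K : cmeas phi -> rapid phi ->
  exists C, forall z, wt_bounded (C / bracket (usubmx z) ^+ K) (fun x => (phi x)^*%C * g z x).
Proof.
move=> mp rp; have [C1 h1] := gaussian_bracket heps Gamma_sym Gamma_pos K.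
have [C2 h2] := rp (K + 2 * D)%N; exists (C1 * C2) => z.
have mg := cdiff_measurable (cdiff_gaussian Gamma heps z).
apply: wt_bounded_bracket; first by apply: cmeas_mul => //; exact: cmeas_conj.
have bz := bracket_gt0 (usubmx z).
have C10 : 0 <= C1.
  have := le_trans (mulr_ge0 (normc_ge0 _) (exprn_ge0 K (ltW bz))) (h1 z 0).2.
  by rewrite pmulr_lge0// exprn_gt0// bracket_gt0.
move=> x; have bx := bracket_gt0 x; rewrite ler_pdivlMr ?exprn_gt0// normcM normcJ.
rewrite (_ : _ * _ * _ * _ = normc (phi x) * bracket x ^+ (2 * D) *
  (normc (g z x) * bracket (usubmx z) ^+ K)); last by ring.
apply: le_trans (_ : normc (phi x) * bracket x ^+ (2 * D) * (C1 * bracket x ^+ K) <= _).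
  by rewrite ler_wpM2l ?mulr_ge0 ?normc_ge0 ?exprn_ge0 ?(ltW bx)//; exact: (h1 z x).2.
rewrite (_ : _ * _ * _ = C1 * (normc (phi x) * bracket x ^+ (K + 2 * D))).
  by rewrite ler_wpM2l.
by rewrite exprD; ring.
Qed.

(** Since -i eps d_j g_z = (p_j + i (Gamma (x - q))_j) g_z, integration by parts trades a factor
    p_j of the overlap for a derivative of [phi] or for a factor linear in x or q. The function
    [phi] varies in the induction, but stays in the span. *)
Lemma coherent_moment (B : set (V -> R[i])) (j : 'I_D) :
  deriv_stable B -> (forall b, B b -> rapid b) ->
  forall k K phi, poly_span B phi -> exists C, forall z,
    `|dsubmx z j 0| ^+ k * bracket (usubmx z) ^+ K * normc (inner phi (g z)) <= C.
Proof.
move=> hB rB; elim => [|k IH] K phi sp.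
  have [dp _] := span_deriv hB sp.
  have [C hC] := coherent_bound K (cdiff_measurable dp) (span_rapid rB sp).
  exists (2 * (C * @wtmass R D)) => z; rewrite expr0 mul1r.
  have := normc_cintegral_le (hC z).
  rewrite [X in 2 * X]mulrAC [leRHS]mulrA ler_pdivlMr ?exprn_gt0 ?bracket_gt0//.
  by rewrite [X in X <= _]mulrC.
have [dp sdp] := span_deriv hB sp.
have [ddp _] := span_deriv hB (sdp j).
pose phi' x := ((Gamma *m x) j 0)%:C * phi x.
have sp' : poly_span B phi'.
  rewrite (_ : phi' = fun x => \sum_i (Gamma j i)%:C * ((x i 0)%:C * phi x)).
    by apply: (span_sum _ sp) => i; apply: span_scale; exact: span_entry.
  apply/funext => x; rewrite /phi' mxE rmorph_sum /= mulr_suml.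
  by apply: eq_bigr => i _; rewrite rmorphM mulrA.
have [dp' _] := span_deriv hB sp'.
have [C1 h1] := IH K _ (sdp j).
have [C2 h2] := IH K.+1 _ sp.
have [C3 h3] := IH K _ sp'.
pose G1 := \sum_k `|Gamma j k|.
exists (eps * C1 + G1 * C2 + C3) => z.
have GG : `|(Gamma *m usubmx z) j 0| <= G1 * bracket (usubmx z).
  rewrite mxE; apply: le_trans (ler_norm_sum _ _ _) _.
  rewrite mulr_suml; apply: ler_sum => i _; rewrite normrM ler_wpM2l//.
  exact: entry_le_bracket.
have [dg sg] := @gaussian_deriv_stable _ _ _ _ heps Gamma_sym z _ erefl.
have rg b : [set g z] b -> rapid b by move=> ->; exact: gaussian_rapid.
have key : `|dsubmx z j 0| * normc (inner phi (g z)) <=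
   eps * normc (inner (cpderiv j phi) (g z)) +
   `|(Gamma *m usubmx z) j 0| * normc (inner phi (g z)) + normc (inner phi' (g z)).
  have [E1 b1] := coherent_bound 0 (cdiff_measurable dp) (span_rapid rB sp).
  have [E2 b2] := coherent_bound 0 (cdiff_measurable dp') (span_rapid rB sp').
  have [E3 b3] := rapid_wt_bounded (cdiff_measurable dp) (cdiff_measurable dg)
     (span_rapid rB sp) (rg _ erefl).
  have hs := @gaussian_deriv_stable _ _ _ _ heps Gamma_sym z.
  have := inner_deriv_antisym dp dg ddp (span_deriv hs (sg j)).1 (span_rapid rB sp)
    (rg _ erefl) (span_rapid rB (sdp j)) (span_rapid rg (sg j)).
  rewrite [X in _ + X = _]/inner (eq_cintegral (g := fun x =>
     'i%C / eps%:C * (((dsubmx z j 0)%:C - 'i%C * ((Gamma *m usubmx z) j 0)%:C) *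
       ((phi x)^*%C * g z x) + 'i%C * ((phi' x)^*%C * g z x)))); last first.
    move=> x; rewrite cpderiv_gaussian//.
    have -> : gvel Gamma j z x = (dsubmx z j 0)%:C
        - 'i%C * ((Gamma *m usubmx z) j 0)%:C + 'i%C * ((Gamma *m x) j 0)%:C.
      rewrite /gvel mulmxBr [X in _ +i* X]mxE [X in _ +i* (_ + X)]mxE.
      move: ((Gamma *m x) j 0) ((Gamma *m usubmx z) j 0) (dsubmx z j 0) => a b c.
      by apply: complex_eq => /=; ring.
    have -> : (phi' x)^*%C = ((Gamma *m x) j 0)%:C * (phi x)^*%C.
      by rewrite /phi' rmorphM; congr (_ * _); exact: conjc_real.
    by ring.
  rewrite (cintegral_scale _ (wt_bounded_add (wt_bounded_scale _ (b1 z)) (wt_bounded_scale _ (b2 z)))).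
  rewrite (cintegral_add (wt_bounded_scale _ (b1 z)) (wt_bounded_scale _ (b2 z))).
  rewrite (cintegral_scale _ (b1 z)) (cintegral_scale _ (b2 z)).
  rewrite -/(inner phi (g z)) -/(inner phi' (g z)).
  move: (inner _ _) (inner phi (g z)) (inner phi' (g z)) => I1 I0 I2 E.
  have {}E : (dsubmx z j 0)%:C * I0 = 'i%C * eps%:C * I1 +
     ('i%C * (((Gamma *m usubmx z) j 0)%:C * I0) - 'i%C * I2).
    have e0 : eps%:C != 0 :> R[i] by rewrite -normc_gt0 normc_real normr_gt0 gt_eqF.
    have ii : 'i%C * 'i%C = -1 :> R[i] by apply: complex_eq => /=; ring.
    move: (congr1 ( *%R ('i%C * eps%:C)) E); rewrite mulr0.
    rewrite [X in X = 0](_ : _ = 'i%C * eps%:C * I1 + 'i%C * 'i%C * (((dsubmx z j 0)%:C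
      - 'i%C * ((Gamma *m usubmx z) j 0)%:C) * I0 + 'i%C * I2)); last by field.
    rewrite ii => /eqP; rewrite addr_eq0 => /eqP ->.
    by ring.
  have /(congr1 (@normc R)) := E; rewrite normcM normc_real => ->.
  apply: le_trans (normcD _ _) _; rewrite -addrA lerD//.
    by rewrite !normcM normc_real /= expr0n expr1n /= add0r sqrtr1 mul1r gtr0_norm.
  apply: le_trans (normcD _ _) _; rewrite normcN !normcM normc_real /=.
  by rewrite expr0n expr1n /= add0r sqrtr1 !mul1r.
have P0 : 0 <= `|dsubmx z j 0| ^+ k * bracket (usubmx z) ^+ K.
  by rewrite mulr_ge0// exprn_ge0// ltW// bracket_gt0.
have := ler_wpM2l P0 key; set P := _ * bracket _ ^+ _ in P0 * => h.
have -> : `|dsubmx z j 0| ^+ k.+1 * bracket (usubmx z) ^+ K * normc (inner phi (g z)) =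
   P * (`|dsubmx z j 0| * normc (inner phi (g z))) by rewrite /P exprS; ring.
apply: (le_trans h); rewrite !mulrDr !lerD//.
- by rewrite mulrCA ler_wpM2l ?(ltW heps)//; exact: h1.
- apply: le_trans (_ : P * (G1 * bracket (usubmx z) * normc (inner phi (g z))) <= _).
    by rewrite ler_wpM2l// ler_wpM2r ?normc_ge0.
  have G10 : 0 <= G1 by apply: sumr_ge0.
  apply: le_trans (_ : G1 * (P * bracket (usubmx z) * normc (inner phi (g z))) <= _).
    by rewrite [leRHS](_ : _ = P * (G1 * bracket (usubmx z) * normc (inner phi (g z))))//; ring.
  rewrite ler_wpM2l//; have := h2 z; congr (_ <= _).
  by rewrite /P exprSr; ring.
- exact: h3.
Qed.

Lemma bracket_phase z : bracket z <= bracket (usubmx z) * bracket (dsubmx z).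
Proof.
apply: le_trans (_ : bracket (usubmx z) + `|dsubmx z| <= _).
  rewrite /bracket -addrA lerD2l; apply: cV_norm_le => [|i]; first by rewrite addr_ge0.
  rewrite -[z]vsubmxK; case: (split_ordP i) => k ->.
  - by rewrite col_mxEu col_mxKu col_mxKd (le_trans (ler_entry_norm _ k))// lerDl.
  - by rewrite col_mxEd col_mxKu col_mxKd (le_trans (ler_entry_norm _ k))// lerDr.
rewrite [X in _ <= _ * X]/bracket mulrDr mulr1 lerD2l ler_peMl//.
exact: bracket_ge1.
Qed.

(** Decay in the position of z comes from the decay of [phi] and of the packets, decay in
    its momentum from [coherent_moment]. *)
Lemma coherent_rapid (B : set (V -> R[i])) phi :
  deriv_stable B -> (forall b, B b -> rapid b) -> poly_span B phi ->
  forall N, exists C, forall z, bracket z ^+ N * normc (inner phi (g z)) <= C.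
Proof.
move=> hB rB sp N.
have [dp _] := span_deriv hB sp.
have [C0 h0] := coherent_bound N (cdiff_measurable dp) (span_rapid rB sp).
have h0' z : bracket (usubmx z) ^+ N * normc (inner phi (g z)) <= 2 * (C0 * @wtmass R D).
  have := normc_cintegral_le (h0 z).
  rewrite [X in 2 * X]mulrAC [leRHS]mulrA ler_pdivlMr ?exprn_gt0 ?bracket_gt0//.
  by rewrite [X in X <= _]mulrC.
have /choice[C hC] : forall j, exists C, forall z,
    `|dsubmx z j 0| ^+ N * bracket (usubmx z) ^+ N * normc (inner phi (g z)) <= C.
  by move=> j; exact: (coherent_moment _ hB rB N N sp).
exists (2 ^+ N * (2 * (C0 * @wtmass R D) + \sum_j C j)) => z.
have n0 := normc_ge0 (inner phi (g z)).
have bz (k : nat) : 0 <= bracket z ^+ k by rewrite exprn_ge0// ltW// bracket_gt0.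
have bq : 0 <= bracket (usubmx z) ^+ N by rewrite exprn_ge0// ltW// bracket_gt0.
apply: le_trans (_ : bracket (usubmx z) ^+ N * (2 ^+ N * (1 + \sum_j `|dsubmx z j 0| ^+ N)) *
   normc (inner phi (g z)) <= _).
  rewrite ler_wpM2r//; apply: le_trans (_ : (bracket (usubmx z) * bracket (dsubmx z)) ^+ N <= _).
    rewrite lerXn2r ?nnegrE ?bracket_phase// ?mulr_ge0// ltW// bracket_gt0//.
  by rewrite exprMn ler_wpM2l// bracket_pow_le.
rewrite (_ : _ * _ * _ = 2 ^+ N * (bracket (usubmx z) ^+ N * normc (inner phi (g z)) +
   (\sum_j `|dsubmx z j 0| ^+ N) * (bracket (usubmx z) ^+ N * normc (inner phi (g z))))); last by ring.
rewrite ler_wpM2l ?exprn_ge0// lerD// mulr_suml; apply: ler_sum => j _.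
by rewrite mulrA.
Qed.

End CoherentDecay.

(** * Zeros of the overlaps with wave packets *)

Section ComplexLines.
Context {R : realType} {n : nat}.
Local Notation V := 'cV[R]_n.
Local Notation mu := (lebesgue_cV R n).
Local Notation leb := (@lebesgue_measure R).
Variables (alpha : V -> R) (chi : V -> R[i]).
Hypothesis malpha : measurable_fun setT alpha.
Hypothesis mchi : cmeas chi.
Hypothesis chi_exp : forall r : R, exists C, forall x,
  expR (r * `|alpha x|) * normc (chi x) <= C * wt x.

Lemma complex_zeros (T : R -> R[i]) :
  ((forall s, complex.Re (T s) = 0) \/ leb.-negligible [set s | complex.Re (T s) = 0]) ->
  ((forall s, complex.Im (T s) = 0) \/ leb.-negligible [set s | complex.Im (T s) = 0]) ->
  (forall s, T s = 0) \/ leb.-negligible [set s | T s = 0].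
Proof.
move=> [h1|h1]; last by move=> _; right; apply: negligibleS h1 => s /= ->.
move=> [h2|h2]; last by right; apply: negligibleS h2 => s /= ->.
by left => s; apply: complex_eq; [exact: h1|exact: h2].
Qed.

(** Moving a packet in position multiplies its conjugate by a real exponential exp(s alpha)
    and a factor that is constant in x; this is the real or imaginary part of the overlap. *)
Lemma real_exp_line_zeros (a : V -> R) : measurable_fun setT a ->
  (forall x, `|a x| <= normc (chi x)) ->
  let f s := \int[mu]_x (expR (s * alpha x) * a x) in
  (forall s, f s = 0) \/ leb.-negligible [set s | f s = 0].
Proof.
move=> ma ac.
have := @parametric_integral_zeros R n (fun m s x => alpha x ^+ m * expR (s * alpha x) * a x)
  alpha (fun x => normc (chi x)).
have E : (fun s => \int[mu]_x (expR (s * alpha x) * a x)) =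
  (fun s => \int[mu]_x (alpha x ^+ 0 * expR (s * alpha x) * a x)).
  by apply/funext => s; apply: eq_Rintegral => x _; rewrite expr0 mul1r.
rewrite E; apply => //.
- move=> m s x.
  have he := @drv_comp _ _ (fun s : R => s * alpha x) _ s 1 _ _ (is_derive_expR (s * alpha x))
    (drv_mul (drv_id s 1) (drv_const (alpha x) s (1 : R))).
  have := drv_scale (alpha x ^+ m * a x) he.
  move=> /(@drv_ext _ _ _ (fun s : R => alpha x ^+ m * expR (s * alpha x) * a x)) H.
  apply: (is_derive_eq (H _)); first by move=> t; ring.
  by rewrite exprSr; ring.
- move=> m s; apply: measurable_funM => //; apply: measurable_funM.
    exact: measurable_funX.
  apply: (@measurableT_comp _ _ _ _ _ _ (@expR R)); first exact: measurable_expR.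
  exact: measurable_funM.
- move=> m s x; rewrite !normrM normrX ler_pM ?mulr_ge0 ?exprn_ge0//.
  rewrite ler_wpM2l ?exprn_ge0// ger0_norm ?expR_ge0// ler_expR -normrM.
  exact: ler_norm.
Qed.

(** The counterpart for momentum, with an imaginary exponential. Each derivative rotates
    its phase by pi / 2. *)
Lemma imag_exp_line_zeros (a b : V -> R) : measurable_fun setT a -> measurable_fun setT b ->
  (forall x, `|a x| <= normc (chi x)) -> (forall x, `|b x| <= normc (chi x)) ->
  let f s := \int[mu]_x (cos (s * alpha x) * a x + sin (s * alpha x) * b x) in
  (forall s, f s = 0) \/ leb.-negligible [set s | f s = 0].
Proof.
move=> ma mb ac bc.
pose u (m : nat) (s : R) x := s * alpha x + m%:R * (pi / 2).
have := @parametric_integral_zeros R n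
  (fun m s x => alpha x ^+ m * (cos (u m s x) * a x + sin (u m s x) * b x))
  alpha (fun x => 2 * normc (chi x)).
have E : (fun s => \int[mu]_x (cos (s * alpha x) * a x + sin (s * alpha x) * b x)) =
  (fun s => \int[mu]_x (alpha x ^+ 0 * (cos (u 0%N s x) * a x + sin (u 0%N s x) * b x))).
  by apply/funext => s; apply: eq_Rintegral => x _; rewrite expr0 mul1r /u mul0r addr0.
have mu_ m s : measurable_fun setT (u m s).
  by apply: measurable_funD => //; exact: measurable_funM.
rewrite E; apply => //.
- move=> m s x.
  have du : is_derive s 1 (fun s : R => u m s x) (alpha x).
    have := drv_add (drv_mul (drv_id s 1) (drv_const (alpha x) s (1 : R)))
      (drv_const (m%:R * (pi / 2)) s (1 : R)).
    by rewrite mul1r mulr0 !addr0.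
  have hc := @drv_comp _ _ (fun s : R => u m s x) _ s 1 _ _ (is_derive_cos (u m s x)) du.
  have hs := @drv_comp _ _ (fun s : R => u m s x) _ s 1 _ _ (is_derive_sin (u m s x)) du.
  have := drv_scale (alpha x ^+ m) (drv_add (drv_mul hc (drv_const (a x) s (1 : R)))
    (drv_mul hs (drv_const (b x) s (1 : R)))).
  move=> /is_derive_eq; apply.
  have -> : u m.+1 s x = u m s x + pi / 2 by rewrite /u -natr1; ring.
  by rewrite cosDpihalf sinDpihalf exprSr; ring.
- move=> m s; apply: measurable_funM; first exact: measurable_funX.
  apply: measurable_funD; apply: measurable_funM => //.
    by apply: (@measurableT_comp _ _ _ _ _ _ (@cos R)) => //;
       exact: (continuous_measurable_fun (@continuous_cos R)).
  by apply: (@measurableT_comp _ _ _ _ _ _ (@sin R)) => //;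
     exact: (continuous_measurable_fun (@continuous_sin R)).
- move=> m s x; rewrite normrM normrX -mulrA ler_wpM2l ?exprn_ge0//.
  apply: le_trans (_ : 1 * (2 * normc (chi x)) <= _); last first.
    rewrite ler_wpM2r ?mulr_ge0 ?normc_ge0// -expR0 ler_expR mulr_ge0//.
  rewrite mul1r mulr2n mulrDl mul1r (le_trans (ler_normD _ _))// lerD// normrM.
    by rewrite -[leRHS]mul1r ler_pM// cos_max.
  by rewrite -[leRHS]mul1r ler_pM// sin_max.
- move=> r; have [C hC] := chi_exp r; exists (2 * C) => x.
  by rewrite mulrCA -mulrA ler_wpM2l.
Qed.

End ComplexLines.

Section CoherentZeros.
Context {R : realType} {D : nat}.
Variables (eps : R) (Gamma : 'M[R]_D).
Hypotheses (heps : 0 < eps) (Gamma_sym : Gamma^T = Gamma).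
Hypothesis Gamma_pos : forall x : 'cV[R]_D, x != 0 -> 0 < dot x (Gamma *m x).
Local Notation g := (gaussian eps Gamma).
Local Notation phase := 'cV[R]_(D + D).
Local Notation V := 'cV[R]_D.
Local Notation mu := (lebesgue_cV R D).
Local Notation Re := (@complex.Re R).
Local Notation Im := (@complex.Im R).
Local Notation leb := (@lebesgue_measure R).
Implicit Types (x : V) (z y : phase) (phi psi : V -> R[i]).

(** Completing the square. *)
Lemma gaussian_exp (r : R) : exists C, forall z x,
  expR (r * `|x - usubmx z|) * normc (g z x) <= C.
Proof.
have [c c0 hc] := quad_lower_bound Gamma_sym Gamma_pos.
have c1 : 0 < c / (2 * eps) by rewrite divr_gt0// mulr_gt0.
set d := c / (2 * eps) in c1.
exists (gauss_amp eps Gamma * expR (r ^+ 2 / (4 * d))) => z x.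
have amp0 := gauss_amp_gt0 heps Gamma_sym Gamma_pos.
rewrite (normc_gaussian heps Gamma_sym Gamma_pos) mulrCA ler_wpM2l ?(ltW amp0)//.
rewrite -expRD ler_expR; set s := `|_|.
apply: le_trans (_ : r * s - d * s ^+ 2 <= _).
  rewrite lerD2l lerN2 /d mulrAC ler_pM2r ?invr_gt0 ?mulr_gt0//.
  exact: hc.
rewrite -subr_ge0 (_ : _ - _ = d * (s - r / (2 * d)) ^+ 2); last by field; rewrite gt_eqF.
by rewrite mulr_ge0 ?sqr_ge0// ltW.
Qed.

Lemma inner_gaussian_conj z psi :
  inner (g z) psi = cintegral mu (fun x => (g z x)^*%C * psi x).
Proof. by []. Qed.

Lemma coherent_wt_bounded psi : cmeas psi -> rapid psi ->
  exists C, forall z, wt_bounded C (fun x => (g z x)^*%C * psi x).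
Proof.
move=> mp rp; have [C1 h1] := gaussian_bounded heps Gamma_sym Gamma_pos.
have [C2 h2] := rp (2 * D)%N; exists (C1 * C2) => z; apply: wt_bounded_bracket.
  apply: cmeas_mul => //; apply: cmeas_conj.
  exact: cdiff_measurable (cdiff_gaussian Gamma heps z).
move=> x; rewrite normcM normcJ -mulrA ler_pM ?normc_ge0 ?mulr_ge0 ?exprn_ge0 ?normc_ge0//.
exact: ltW (bracket_gt0 _).
Qed.

(** The overlap is continuous in z. *)
Lemma measurable_coherent_zeros psi : cmeas psi -> rapid psi ->
  measurable [set z | inner (g z) psi = 0].
Proof.
move=> mp rp; rewrite -[X in measurable X]setCK; apply: measurableC.
apply: open_measurable_cV; rewrite openE => z /= Fz.
have [C hC] := coherent_wt_bounded mp rp.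
have F0 : 0 < normc (inner (g z) psi) / 2.
  by rewrite divr_gt0// normc_gt0; exact/eqP.
have cg x : continuous (fun z => Re ((g z x)^*%C * psi x)) /\
            continuous (fun z => Im ((g z x)^*%C * psi x)).
  apply: cdiff_continuous; apply: cdiff_mul; last exact: cdiff_const.
  by apply: cdiff_conj; exact: cdiff_gaussian_center.
have [d d0 hd] : exists2 d, 0 < d & forall y, `|y - z| < d ->
    normc (inner (g y) psi - inner (g z) psi) <= normc (inner (g z) psi) / 2.
  exact: (cintegral_continuous cg (fun z => (hC z).1) (fun z x _ => (hC z).2 x) F0).
apply/nbhs_ballP; exists d; [exact: d0|move=> y].
rewrite mx_norm_ball /ball_ /= distrC => /hd h y0; move: h; rewrite y0 sub0r normcN.
by move: F0; move: (normc _) => N; lra.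
Qed.

(** With the centre at position 0 the overlaps are the Fourier transform of psi times a
    positive Gaussian. Comparing p with - p separates the cosine and the sine transforms of
    the real and imaginary parts. *)
Lemma coherent_injective psi (C : R) (N : nat) :
  continuous (Re \o psi) -> continuous (Im \o psi) ->
  (forall x, normc (psi x) <= C * bracket x ^+ N) ->
  (forall p, inner (g (col_mx 0 p)) psi = 0) -> forall x, psi x = 0.
Proof.
move=> cR cI psiC F0.
have amp0 := gauss_amp_gt0 heps Gamma_sym Gamma_pos.
pose w x := normc (g 0 x).
have wE x : w x = gauss_amp eps Gamma * expR (- (dot x (Gamma *m x) / (2 * eps))).
  by rewrite /w normc_gaussian// (_ : usubmx 0 = 0) ?subr0//; apply/matrixP => i j; rewrite !mxE.
have w_gt0 x : 0 < w x by rewrite wE mulr_gt0// expR_gt0.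
have cw : continuous w.
  rewrite (_ : w = fun x => gauss_amp eps Gamma *
      (expR \o (fun x => (- (2 * eps)^-1) * dot x (Gamma *m x))) x); last first.
    apply/funext => x; rewrite wE /=; congr (_ * expR _).
    by rewrite mulNr; congr (- _); exact: mulrC.
  move=> x; apply: differentiable_continuous; apply: dif_mul; first exact: dif_const.
  apply: differentiable_comp; last by apply/derivable1_diffP; exact: derivable_expR.
  apply: dif_mul; first exact: dif_const.
  by apply: dif_dot => [i|i]; [|apply: dif_mulmx => k]; exact: differentiable_coord.
have [B hB] : exists B, forall x, w x * normc (psi x) <= B * wt x.
  have [C1 h1] := gaussian_rapid heps Gamma_sym Gamma_pos 0 (N + 2 * D).
  exists (C1 * C) => x.
  have C0 : 0 <= C.
    have := le_trans (normc_ge0 _) (psiC 0).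
    by rewrite pmulr_lge0// exprn_gt0// bracket_gt0.
  apply: le_trans (_ : w x * (C * bracket x ^+ N) <= _).
    by rewrite ler_wpM2l ?(ltW (w_gt0 _)).
  apply: le_trans (_ : w x * (C * bracket x ^+ N) * (bracket x ^+ (2 * D) * wt x) <= _).
    rewrite ler_peMr ?bracket_wt// !mulr_ge0 ?(ltW (w_gt0 _)) ?exprn_ge0//.
    exact: ltW (bracket_gt0 _).
  have -> : w x * (C * bracket x ^+ N) * (bracket x ^+ (2 * D) * wt x) =
     C * wt x * (normc (g 0 x) * bracket x ^+ (N + 2 * D)) by rewrite /w exprD; ring.
  rewrite [leRHS](_ : _ = C * wt x * C1); last by ring.
  by apply: ler_wpM2l; [rewrite mulr_ge0// ltW// wt_gt0|exact: h1].
have gE p x : (g (col_mx 0 p) x)^*%C * psi x =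
   (w x * (cos (dot p x / eps) * Re (psi x) + sin (dot p x / eps) * Im (psi x))) +i*
   (w x * (cos (dot p x / eps) * Im (psi x) - sin (dot p x / eps) * Re (psi x))).
  rewrite gaussianE// wE /gauss_exponent col_mxKu col_mxKd subr0.
  by apply: complex_eq => /=; rewrite ?cReM ?cImM /=; case: (psi x) => a b /=; ring.
pose f1 x := w x * Re (psi x); pose f2 x := w x * Im (psi x).
have cf1 : continuous f1 by move=> x; exact: (continuousM (cw x) (cR x)).
have cf2 : continuous f2 by move=> x; exact: (continuousM (cw x) (cI x)).
have b1 x : `|f1 x| <= B * wt x.
  apply: le_trans (hB x); rewrite normrM ger0_norm ?(ltW (w_gt0 _))//.
  by rewrite ler_wpM2l ?(ltW (w_gt0 _))// norm_Re_le.
have b2 x : `|f2 x| <= B * wt x.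
  apply: le_trans (hB x); rewrite normrM ger0_norm ?(ltW (w_gt0 _))//.
  by rewrite ler_wpM2l ?(ltW (w_gt0 _))// norm_Im_le.
have mf1 : measurable_fun setT f1 by exact: continuous_measurable_cV.
have mf2 : measurable_fun setT f2 by exact: continuous_measurable_cV.
have trig_int (c f : V -> R) : measurable_fun setT c -> (forall x, `|c x| <= 1) ->
    measurable_fun setT f -> (forall x, `|f x| <= B * wt x) ->
    mu.-integrable setT (EFin \o (fun x => c x * f x)).
  move=> mc c1 mf bf; apply: (@integrable_le_wt R D B); first exact: measurable_funM.
  by move=> x; rewrite normrM (le_trans _ (bf x))// ler_piMl.
have mcos k : measurable_fun setT (fun x => cos (dot k x)).
  apply: (@measurableT_comp _ _ _ _ _ _ (@cos R)); last exact: measurable_dot.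
  exact: (continuous_measurable_fun (@continuous_cos R)).
have msin k : measurable_fun setT (fun x => sin (dot k x)).
  apply: (@measurableT_comp _ _ _ _ _ _ (@sin R)); last exact: measurable_dot.
  exact: (continuous_measurable_fun (@continuous_sin R)).
have ic1 k := trig_int _ _ (mcos k) (fun x => cos_max _) mf1 b1.
have ic2 k := trig_int _ _ (mcos k) (fun x => cos_max _) mf2 b2.
have is1 k := trig_int _ _ (msin k) (fun x => sin_max _) mf1 b1.
have is2 k := trig_int _ _ (msin k) (fun x => sin_max _) mf2 b2.
pose c1 k := \int[mu]_x (cos (dot k x) * f1 x).
pose c2 k := \int[mu]_x (cos (dot k x) * f2 x).
pose s1 k := \int[mu]_x (sin (dot k x) * f1 x).
pose s2 k := \int[mu]_x (sin (dot k x) * f2 x).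
(* The real and imaginary parts of the overlap at momentum eps k. *)
have key k : c1 k + s2 k = 0 /\ c2 k - s1 k = 0.
  have := F0 (eps *: k); rewrite /inner (eq_cintegral (gE _)) => E.
  have E1 := congr1 Re E; have E2 := congr1 Im E; rewrite /= in E1 E2.
  rewrite /c1 /s2 /c2 /s1 -(RintegralD measurableT (ic1 k) (is2 k)).
  rewrite -(RintegralB measurableT (ic2 k) (is1 k)).
  split.
  - rewrite -[RHS]E1; apply: eq_Rintegral => x _.
    by rewrite dotZl /f1 /f2 mulrAC mulfV ?gt_eqF// mul1r; ring.
  - rewrite -[RHS]E2; apply: eq_Rintegral => x _.
    by rewrite dotZl /f1 /f2 mulrAC mulfV ?gt_eqF// mul1r; ring.
have par k : [/\ c1 (- k) = c1 k, c2 (- k) = c2 k, s1 (- k) = - s1 k & s2 (- k) = - s2 k].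
  split; rewrite ?/c1 ?/c2 ?/s1 ?/s2.
  - by apply: eq_Rintegral => x _; rewrite dotNl cosN.
  - by apply: eq_Rintegral => x _; rewrite dotNl cosN.
  - rewrite -mulN1r -(RintegralZl (-1) measurableT (is1 k)).
    by apply: eq_Rintegral => x _; rewrite dotNl sinN; ring.
  - rewrite -mulN1r -(RintegralZl (-1) measurableT (is2 k)).
    by apply: eq_Rintegral => x _; rewrite dotNl sinN; ring.
have vanish k : [/\ c1 k = 0, s1 k = 0, c2 k = 0 & s2 k = 0].
  have [h1 h2] := key k; have [h3 h4] := key (- k); have [p1 p2 p3 p4] := par k.
  rewrite p1 p4 in h3; rewrite p2 p3 in h4.
  by split; lra.
have z1 := fourier_uniqueness cf1 b1 (fun k => let: And4 h1 h2 _ _ := vanish k in conj h1 h2).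
have z2 := fourier_uniqueness cf2 b2 (fun k => let: And4 _ _ h1 h2 := vanish k in conj h1 h2).
move=> x; apply: complex_eq => /=.
- by have := z1 x; rewrite /f1 => /eqP; rewrite mulf_eq0 gt_eqF//= => /eqP.
- by have := z2 x; rewrite /f2 => /eqP; rewrite mulf_eq0 gt_eqF//= => /eqP.
Qed.

Lemma conj_gaussian z x : (g z x)^*%C = (gauss_amp eps Gamma)%:C *
  cexp ((- (dot (x - usubmx z) (Gamma *m (x - usubmx z)) / (2 * eps)))
        +i* (- (dot (dsubmx z) (x - usubmx z) / eps))).
Proof.
rewrite gaussianE// /cexp /= cosN sinN.
by apply: complex_eq => /=; ring.
Qed.

Lemma quad_shift (v : V) (s : R) k :
  dot (v - s *: delta_mx k 0) (Gamma *m (v - s *: delta_mx k 0)) =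
  dot v (Gamma *m v) - 2 * s * (Gamma *m v) k 0 + s ^+ 2 * Gamma k k.
Proof.
rewrite mulmxBr -scalemxAr !(dotDl, dotDr, dotNl, dotNr, dotZl, dotZr).
rewrite (quad_sym Gamma_sym v (delta_mx k 0)) !dot_delta -colE [col k Gamma k 0]mxE.
by ring.
Qed.

Lemma cexp_real (r : R) : (expR r)%:C = cexp (r +i* 0).
Proof. by rewrite /cexp /= cos0 sin0 mulr1 mulr0. Qed.

(** On a line the overlap equals a nowhere vanishing factor times the integral of
    exp(s alpha) chi, with alpha real for the positions and imaginary for the momenta; hence
    it is entire up to that factor and [null_of_lines] applies. *)
Lemma null_coherent_zeros psi : cmeas psi -> rapid psi ->
  continuous (Re \o psi) -> continuous (Im \o psi) -> (exists x, psi x != 0) ->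
  lebesgue_cV R (D + D) [set z | inner (g z) psi = 0] = 0%E.
Proof.
move=> mp rp cR cI [x0 px0]; apply: null_of_lines.
- exact: measurable_coherent_zeros.
- apply: contrapT => H; move/eqP: px0; apply.
  have [C hC] := rp 0%N.
  apply: (@coherent_injective psi C 0%N cR cI).
    by move=> x; have := hC x; rewrite expr0 !mulr1.
  by move=> p; apply: contrapT => h; apply: H; exists (col_mx 0 p).
move=> z i; pose chi x := (g z x)^*%C * psi x; pose q := usubmx z.
have mg := cdiff_measurable (cdiff_gaussian Gamma heps z).
have mchi : cmeas chi by apply: cmeas_mul => //; exact: cmeas_conj.
have exp_bound (alpha : V -> R) (c0 : R) : (forall x, `|alpha x| <= c0 * `|x - q|) -> 0 <= c0 ->
    forall r : R, exists C, forall x, expR (r * `|alpha x|) * normc (chi x) <= C * wt x.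
  move=> ha c00 r; have [C1 h1] := gaussian_exp (`|r| * c0).
  have [C2 h2] := rp (2 * D)%N; exists (C1 * C2) => x.
  have pw : normc (psi x) <= C2 * wt x.
    by apply: (wt_bounded_bracket mp h2).2.
  rewrite /chi normcM normcJ mulrA -mulrA -[leRHS]mulrA mulrA.
  apply: ler_pM => //; rewrite ?mulr_ge0 ?expR_ge0 ?normc_ge0//.
  apply: le_trans (h1 z x); apply: ler_wpM2r; first exact: normc_ge0.
  rewrite ler_expR -mulrA; apply: le_trans (_ : `|r| * `|alpha x| <= _).
    by rewrite ler_wpM2r// ler_norm.
  by rewrite ler_wpM2l.
case: (split_ordP i) => k ->.
- pose alpha x : R := (Gamma *m (x - q)) k 0 / eps.
  pose u (s : R) := cexp ((- (s ^+ 2 * Gamma k k / (2 * eps))) +i* (dsubmx z k 0 * s / eps)).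
  have malpha : measurable_fun setT alpha.
    apply: continuous_measurable_cV => x; apply: differentiable_continuous.
    apply: dif_mul; last exact: dif_const.
    apply: dif_mulmx => l; under eq_fun do rewrite !mxE.
    by apply: dif_add; [exact: differentiable_coord|exact: dif_const].
  have ab x : `|alpha x| <= (\sum_l `|Gamma k l|) / eps * `|x - q|.
    rewrite normrM normfV (gtr0_norm heps) mulrAC ler_pM2r ?invr_gt0//.
    rewrite mxE; apply: le_trans (ler_norm_sum _ _ _) _.
    by rewrite mulr_suml; apply: ler_sum => l _; rewrite normrM ler_wpM2l// ler_entry_norm.
  have c0 : 0 <= (\sum_l `|Gamma k l|) / eps by apply: divr_ge0; [exact: sumr_ge0|exact: ltW].
  have eb := exp_bound _ _ ab c0.
  pose L (s : R) := cintegral mu (fun x => (expR (s * alpha x))%:C * chi x).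
  have FE s : inner (g (z + s *: delta_mx (lshift D k) 0)) psi = u s * L s.
    have [C hC] := eb `|s|.
    have bL : wt_bounded C (fun x => (expR (s * alpha x))%:C * chi x).
      split.
        apply: cmeas_mul => //; split; last exact: measurable_cst.
        apply: (@measurableT_comp _ _ _ _ _ _ (@expR R)); first exact: measurable_expR.
        exact: measurable_funM.
      move=> x; rewrite normcM normc_real ger0_norm ?expR_ge0//.
      apply: le_trans (hC x); rewrite ler_wpM2r ?normc_ge0// ler_expR -normrM.
      exact: ler_norm.
    rewrite /L -(cintegral_scale _ bL) inner_gaussian_conj; apply: eq_cintegral => x.
    rewrite /chi !mulrA; congr (_ * _).
    rewrite !conj_gaussian cexp_real [RHS]mulrCA -!cexpD; congr (_ * cexp _).
    have -> : usubmx (z + s *: delta_mx (lshift D k) 0) = q + s *: delta_mx k 0.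
      by apply/matrixP => a b; rewrite !mxE (inj_eq (@lshift_inj _ _)).
    have -> : dsubmx (z + s *: delta_mx (lshift D k) 0) = dsubmx z.
      by apply/matrixP => a b; rewrite !mxE eq_rlshift mulr0 addr0.
    rewrite opprD addrA -/q; set v := x - q.
    rewrite quad_shift dotDr dotNr dotZr [dot (dsubmx z) (delta_mx k 0)]dotC dot_delta.
    rewrite /alpha -/v.
    by apply: complex_eq => /=; field; exact: lt0r_neq0.
  have u0 s : u s != 0 by exact: cexp_neq0.
  have {}FE s : [set z | inner (g z) psi = 0] (z + s *: delta_mx (lshift D k) 0) <-> L s = 0.
    rewrite /= FE; split => [/eqP|->]; last by rewrite mulr0.
    by rewrite mulf_eq0 (negbTE (u0 s)) => /eqP.
  have : (forall s, L s = 0) \/ leb.-negligible [set s | L s = 0].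
    apply: complex_zeros.
    + have := real_exp_line_zeros malpha eb mchi.1 (fun x => norm_Re_le _).
      rewrite (_ : (fun s => _) = fun s => complex.Re (L s))//.
      apply/funext => s; apply: eq_Rintegral => x _.
      by rewrite cReM /= mul0r subr0.
    + have := real_exp_line_zeros malpha eb mchi.2 (fun x => norm_Im_le _).
      rewrite (_ : (fun s => _) = fun s => complex.Im (L s))//.
      apply/funext => s; apply: eq_Rintegral => x _.
      by rewrite cImM /= mul0r addr0.
  move=> [h|h]; first by left => s; exact/FE.
  by right; apply: negligibleS h => s /FE.
- pose alpha x : R := (x - q) k 0 / eps.
  have malpha : measurable_fun setT alpha.
    apply: continuous_measurable_cV => x; apply: differentiable_continuous.
    apply: dif_mul; last exact: dif_const.
    under eq_fun do rewrite !mxE.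
    by apply: dif_add; [exact: differentiable_coord|exact: dif_const].
  have ab x : `|alpha x| <= eps^-1 * `|x - q|.
    by rewrite normrM normfV (gtr0_norm heps) mulrC ler_wpM2l ?invr_ge0 ?(ltW heps)// ler_entry_norm.
  have c0 : 0 <= eps^-1 by rewrite invr_ge0 ltW.
  have eb := exp_bound _ _ ab c0.
  pose L (s : R) := cintegral mu (fun x => cexp (0 +i* (- (s * alpha x))) * chi x).
  have FE s : inner (g (z + s *: delta_mx (rshift D k) 0)) psi = L s.
    rewrite inner_gaussian_conj; apply: eq_cintegral => x.
    rewrite /chi !mulrA; congr (_ * _).
    rewrite !conj_gaussian [RHS]mulrCA -!cexpD; congr (_ * cexp _).
    have -> : dsubmx (z + s *: delta_mx (rshift D k) 0) = dsubmx z + s *: delta_mx k 0.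
      by apply/matrixP => a b; rewrite !mxE (inj_eq (@rshift_inj _ _)).
    have -> : usubmx (z + s *: delta_mx (rshift D k) 0) = q.
      by apply/matrixP => a b; rewrite !mxE eq_lrshift mulr0 addr0.
    rewrite (dotDl (dsubmx z)) dotZl dot_delta /alpha -/q.
    by apply: complex_eq => /=; ring.
  have : (forall s, L s = 0) \/ leb.-negligible [set s | L s = 0].
    apply: complex_zeros.
    + have := imag_exp_line_zeros malpha eb mchi.1 mchi.2 (fun x => norm_Re_le _)
        (fun x => norm_Im_le _).
      rewrite (_ : (fun s => _) = fun s => complex.Re (L s))//.
      apply/funext => s; apply: eq_Rintegral => x _.
      by rewrite cReM /= expR0 cosN sinN; ring.
    + have mN : measurable_fun setT (fun x => - Re (chi x)) by apply: measurable_funN; exact: mchi.1.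
      have nN x : `|- Re (chi x)| <= normc (chi x) by rewrite normrN norm_Re_le.
      have := imag_exp_line_zeros malpha eb mchi.2 mN (fun x => norm_Im_le _) nN.
      rewrite (_ : (fun s => _) = fun s => complex.Im (L s))//.
      apply/funext => s; apply: eq_Rintegral => x _.
      by rewrite cImM /= expR0 cosN sinN; ring.
  move=> [h|h]; first by left => s; rewrite /= FE.
  by right; apply: negligibleS h => s /=; rewrite FE.
Qed.

End CoherentZeros.

(** * Mixed derivatives and Gronwall's inequality *)

Section MixedPartials.
Context {R : realType} {n : nat}.
Local Notation V := 'cV[R]_n.
Implicit Types (f : V -> R) (x v : V).

Lemma pderiv_is_derive f x (i : 'I_n) : differentiable f x ->
  is_derive x (delta_mx i 0) f (pderiv i f x).
Proof. exact: differentiable_is_derive. Qed.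

Lemma sum_delta v : v = \sum_i v i 0 *: delta_mx i 0.
Proof.
apply/matrixP => i k; rewrite (ord1 k) summxE (bigD1 i)//= big1 => [|l li].
  by rewrite !mxE !eqxx mulr1 addr0.
by rewrite !mxE eq_sym (negbTE li) mulr0.
Qed.

Lemma derive_sum_partials f x v : differentiable f x ->
  is_derive x v f (\sum_i v i 0 * pderiv i f x).
Proof.
move=> df; have := differentiable_is_derive v df; congr is_derive.
rewrite deriveE// {1}(sum_delta v) linear_sum; apply: eq_bigr => i _.
by rewrite linearZ /= /pderiv deriveE.
Qed.

Lemma lipschitz_of_partials f (c : 'I_n -> R) : (forall x, differentiable f x) ->
  (forall i x, `|pderiv i f x| <= c i) ->
  forall x (y : V), `|f x - f y| <= \sum_i c i * `|x i 0 - y i 0|.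
Proof.
move=> df fc x y; pose v : V := x - y.
pose dF (s : R) : R := \sum_i v i 0 * pderiv i f (y + s *: v).
have dphi (s : R) : is_derive s 1 (fun s : R => f (y + s *: v)) (dF s).
  exact: (is_derive_line f y v (dF s) s).1 (derive_sum_partials v (df (y + s *: v))).
pose L : R := \sum_i c i * `|v i 0|.
have dFL (s : R) : `|dF s| <= L.
  apply: le_trans (ler_norm_sum _ _ _) _; apply: ler_sum => i _.
  by rewrite normrM mulrC ler_wpM2r.
have h := @derive_norm_le R _ dF L 0 1 dphi dFL.
move: h; rewrite scale1r scale0r addr0 [y + v]addrC subrK subr0 normr1 mulr1.
move=> /le_trans; apply; rewrite le_eqVlt; apply/orP; left; apply/eqP.
by apply: eq_bigr => i _; rewrite !mxE.
Qed.

(** Two applications of the mean value theorem. *)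
Lemma mixed_difference f fu fuv x (u v : V) (h : R) :
  (forall y, is_derive y u f (fu y)) -> (forall y, is_derive y v fu (fuv y)) -> 0 < h ->
  exists c d, [/\ 0 <= c <= h, 0 <= d <= h &
   f (x + h *: u + h *: v) - f (x + h *: u) - (f (x + h *: v) - f x) =
   fuv (x + c *: u + d *: v) * h * h].
Proof.
move=> du dv h0.
have d1 (y : V) s : is_derive s (1 : R) (fun s : R => f (y + s *: u)) (fu (y + s *: u)).
  exact: (is_derive_line f y u _ s).1 (du _).
have d2 (y : V) s : is_derive s (1 : R) (fun s : R => fu (y + s *: v)) (fuv (y + s *: v)).
  exact: (is_derive_line fu y v _ s).1 (dv _).
have [c cb E] := derive_mean_value (fun s => drv_sub (d1 (x + h *: v) s) (d1 x s)) (ltW h0).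
have [d db E'] := derive_mean_value (d2 (x + c *: u)) (ltW h0).
exists c, d; split => //.
move: E E'; rewrite /= !scale0r !addr0 !subr0 => E E'.
rewrite (addrAC x (h *: u)) -E'.
rewrite (addrAC x (c *: u)) -E; ring.
Qed.

(** Schwarz's theorem. The second difference is symmetric in [u] and [v], and both mixed
    derivatives, at points close to [x], are equal to its quotient by h^2. *)
Lemma mixed_derivatives f fu fv fuv fvu x (u v : V) :
  (forall y, is_derive y u f (fu y)) -> (forall y, is_derive y v f (fv y)) ->
  (forall y, is_derive y v fu (fuv y)) -> (forall y, is_derive y u fv (fvu y)) ->
  {for x, continuous fuv} -> {for x, continuous fvu} -> `|u| <= 1 -> `|v| <= 1 ->
  fuv x = fvu x.
Proof.
move=> du dv duv dvu cuv cvu u1 v1; apply/eqP/negPn/negP => ne.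
have [e [e0 he]] : exists e, 0 < e /\ e + e < `|fuv x - fvu x|.
  move: ne; rewrite -subr_eq0 -normr_gt0; move: (`|_|) => w w0.
  by exists (w / 3); split; lra.
have near_ (F : V -> R) : {for x, continuous F} -> exists2 r, 0 < r & forall y, `|y - x| < r ->
    `|F y - F x| <= e.
  move=> /cvgrPdist_le/(_ _ e0)/nbhs_ballP[r /= r0 H].
  exists r => // y yr; rewrite distrC; apply: H.
  by rewrite mx_norm_ball /ball_ /= distrC.
have [r1 r10 h1] := near_ _ cuv; have [r2 r20 h2] := near_ _ cvu.
have [m [m0 mr1 mr2]] : exists m, [/\ 0 < m, m <= r1 & m <= r2].
  by exists (Num.min r1 r2); rewrite lt_min r10 r20 !ge_min !lexx orbT.
have [h [h0 hm]] : exists h, 0 < h /\ h + h < m.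
  by exists (m / 3); split; move: m0; clear; move: m => m m0; lra.
have [c [d [/andP[c0 ch] /andP[d0 dh] E]]] := mixed_difference x du duv h0.
have [c' [d' [/andP[c0' ch'] /andP[d0' dh'] E']]] := mixed_difference x dv dvu h0.
have small (a b : R) (u' v' : V) : `|u'| <= 1 -> `|v'| <= 1 -> 0 <= a -> a <= h ->
   0 <= b -> b <= h -> `|x + a *: u' + b *: v' - x| < m.
  move=> u1' v1' a0 ah b0 bh; rewrite -[x + _ + _]addrA addrAC subrr add0r.
  apply: le_lt_trans (_ : h + h < _); last exact: hm.
  apply: le_trans (ler_normD _ _) _; apply: lerD; rewrite normrZ ger0_norm//.
    by rewrite -[leRHS]mulr1 ler_pM.
  by rewrite -[leRHS]mulr1 ler_pM.
have s1 := small _ _ u v u1 v1 c0 ch d0 dh; have s2 := small _ _ v u v1 u1 c0' ch' d0' dh'.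
have {}h1 := h1 _ (lt_le_trans s1 mr1); have {}h2 := h2 _ (lt_le_trans s2 mr2).
have key (a b : R) : a * h * h = b * h * h -> a = b.
  by move=> /mulIf-/(_ (lt0r_neq0 h0))/mulIf-/(_ (lt0r_neq0 h0)).
have alt (a b a1 b1 : R) : a - b - (a1 - b1) = a - a1 - (b - b1) by ring.
have EE : fuv (x + c *: u + d *: v) = fvu (x + c' *: v + d' *: u).
  by apply: key; rewrite -E -E' [x + h *: u + _]addrAC; exact: alt.
rewrite EE in h1; move: (fvu (_ + _ + _)) h1 h2 => a h1 h2.
have : `|fuv x - fvu x| <= e + e.
  rewrite -(subrKA a) (le_trans (ler_normD _ _))// lerD//.
  by rewrite distrC.
by rewrite leNgt he.
Qed.

Lemma norm_delta (k : 'I_n) : `|delta_mx k 0 : V| <= 1.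
Proof.
by apply: cV_norm_le => // l; rewrite !mxE; case: (_ && _); rewrite ?normr1 ?normr0.
Qed.

Lemma mixed_partials f x (i j : 'I_n) : (forall y, differentiable f y) ->
  (forall k y, differentiable (pderiv k f) y) ->
  (forall k l y, differentiable (pderiv k (pderiv l f)) y) ->
  pderiv i (pderiv j f) x = pderiv j (pderiv i f) x.
Proof.
move=> df d1 d2.
exact: (mixed_derivatives (fun y => pderiv_is_derive j (df y))
  (fun y => pderiv_is_derive i (df y)) (fun y => pderiv_is_derive i (d1 j y))
  (fun y => pderiv_is_derive j (d1 i y))
  (differentiable_continuous (d2 i j x)) (differentiable_continuous (d2 j i x))
  (norm_delta j) (norm_delta i)).
Qed.

End MixedPartials.

Section Gronwall.
Context {R : realType}.

(** exp(- K s) N(s) is non-increasing and exp(K s) N(s) is non-decreasing, which covers both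
    directions of time. *)
Lemma gronwall (N dN : R -> R) (K : R) : (forall s : R, is_derive s 1 N (dN s)) ->
  (forall s, `|dN s| <= K * N s) -> forall a b, N b <= expR (K * `|b - a|) * N a.
Proof.
move=> hN hK a b.
have dE (k s : R) : is_derive s 1 (fun s : R => expR (k * s) * N s)
    (expR (k * s) * (dN s + k * N s)).
  have he := @drv_comp _ _ (fun s : R => k * s) _ s 1 _ _ (is_derive_expR (k * s))
    (drv_scale k (drv_id s 1)).
  by apply: (is_derive_eq (drv_mul he (hN s))) => /=; ring.
have [ab|/ltW ba] := leP a b.
  have := derive_ge0_homo (fun s => drv_opp (dE (- K) s)) ab.
  have h s : a <= s <= b -> 0 <= - (expR (- K * s) * (dN s + - K * N s)).
    move=> _; rewrite -mulrN mulr_ge0 ?expR_ge0//.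
    by have := hK s; rewrite ler_norml => /andP[_]; lra.
  move=> /(_ h); rewrite lerN2 ger0_norm ?subr_ge0//.
  rewrite -(ler_pM2l (expR_gt0 (K * b))) !mulrA -!expRD mulNr addrN expR0 mul1r.
  by rewrite mulNr mulrBr.
have := derive_ge0_homo (dE K) ba.
have h s : b <= s <= a -> 0 <= expR (K * s) * (dN s + K * N s).
  move=> _; rewrite mulr_ge0 ?expR_ge0//.
  by have := hK s; rewrite ler_norml => /andP[+ _]; lra.
move=> /(_ h); rewrite ler0_norm ?subr_le0// opprB.
rewrite -(ler_pM2l (expR_gt0 (- (K * b)))) !mulrA -!expRD addNr expR0 mul1r.
by rewrite [- _ + _]addrC -mulrBr.
Qed.

Lemma is_derive_entry_mx (W : normedModType R) m n (F : W -> 'M[R]_(m, n)) t v (dF : 'M[R]_(m, n)) i j :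
  is_derive t v F dF -> is_derive t v (fun s => F s i j) (dF i j).
Proof.
move=> [h1 h2]; have h := (derivable_mxP F t v).1 h1; split; first exact: h.
by rewrite -h2 derive_mx// mxE.
Qed.

End Gronwall.

(** * The Hamiltonian vector field *)

Section HamiltonianFlow.
Context {R : realType} {D : nat}.
Local Notation phase := 'cV[R]_(D + D).
Local Notation config := 'cV[R]_D.
Variable V : config -> R.
Hypotheses (V_smooth : smooth V) (V_subquad : subquadratic V).
Implicit Types (z y w : phase) (x : config).

Lemma V_diff x : differentiable V x.
Proof. exact: (V_smooth [::] x). Qed.

Lemma pderivV_diff k x : differentiable (pderiv k V) x.
Proof. exact: (V_smooth [:: k] x). Qed.

Lemma pderiv2V_diff k l x : differentiable (pderiv k (pderiv l V)) x.
Proof. exact: (V_smooth [:: k; l] x). Qed.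

Lemma usubmx_shift z (s : R) (i : 'I_D) :
  (usubmx (z + s *: delta_mx (lshift D i) 0) = usubmx z + s *: delta_mx i 0) /\
  (dsubmx (z + s *: delta_mx (lshift D i) 0) = dsubmx z).
Proof.
split; apply/matrixP => a b; rewrite !mxE.
  by rewrite (inj_eq (@lshift_inj _ _)).
by rewrite eq_rlshift mulr0 addr0.
Qed.

Lemma dsubmx_shift z (s : R) (i : 'I_D) :
  (usubmx (z + s *: delta_mx (rshift D i) 0) = usubmx z) /\
  (dsubmx (z + s *: delta_mx (rshift D i) 0) = dsubmx z + s *: delta_mx i 0).
Proof.
split; apply/matrixP => a b; rewrite !mxE.
  by rewrite eq_lrshift mulr0 addr0.
by rewrite (inj_eq (@rshift_inj _ _)).
Qed.

Lemma is_derive_q (f : config -> R) z (i : 'I_D) : differentiable f (usubmx z) ->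
  is_derive z (delta_mx (lshift D i) 0) (fun y => f (usubmx y)) (pderiv i f (usubmx z)).
Proof.
move=> df; apply/is_derive_at0.
have /is_derive_at0 := pderiv_is_derive i df; apply: drv_ext => t.
by rewrite (usubmx_shift z t i).1.
Qed.

Lemma is_derive_q0 (f : config -> R) z (i : 'I_D) :
  is_derive z (delta_mx (rshift D i) 0) (fun y => f (usubmx y)) 0.
Proof.
apply/is_derive_at0; have := drv_const (f (usubmx z)) (0 : R) 1; apply: drv_ext => t.
by rewrite (dsubmx_shift z t i).1.
Qed.

Lemma is_derive_p (k i : 'I_D) z :
  is_derive z (delta_mx (rshift D i) 0) (fun y : phase => dsubmx y k 0) (k == i)%:R.
Proof.
apply/is_derive_at0.
have := drv_add (drv_const (dsubmx z k 0) (0 : R) 1) (drv_scale (k == i)%:R (drv_id 0 1)).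
rewrite add0r mulr1; apply: drv_ext => t.
by rewrite (dsubmx_shift z t i).2 !mxE eqxx andbT mulrC.
Qed.

Lemma is_derive_p0 (k i : 'I_D) z :
  is_derive z (delta_mx (lshift D i) 0) (fun y : phase => dsubmx y k 0) 0.
Proof.
apply/is_derive_at0; have := drv_const (dsubmx z k 0) (0 : R) 1; apply: drv_ext => t.
by rewrite (usubmx_shift z t i).2.
Qed.

Lemma pderiv_val n (f : 'cV[R]_n -> R) (x : 'cV[R]_n) (i : 'I_n) d :
  is_derive x (delta_mx i 0) f d -> pderiv i f x = d.
Proof. by move=> [_ <-]. Qed.

Lemma is_derive_kinetic (u : phase) z (d : 'I_D -> R) :
  (forall k, is_derive z u (fun y : phase => dsubmx y k 0) (d k)) ->
  is_derive z u (fun y => 1 / 2 * dot (dsubmx y) (dsubmx y)) (\sum_k d k * dsubmx z k 0).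
Proof.
move=> h; have := @drv_sum _ _ _ (index_enum 'I_D) xpredT
  (fun k (y : phase) => dsubmx y k 0 * dsubmx y k 0) z u _ (fun k => drv_mul (h k) (h k)).
move=> /(drv_scale (1 / 2)).
move=> /(@drv_ext _ _ _ (fun y => 1 / 2 * dot (dsubmx y) (dsubmx y))) H.
apply: (is_derive_eq (H _)); first by move=> y; rewrite dotE.
by rewrite mulr_sumr; apply: eq_bigr => k _; field.
Qed.

Lemma grad_energy z : grad (energy V) z = col_mx (grad V (usubmx z)) (dsubmx z).
Proof.
apply/matrixP => i k; rewrite (ord1 k) mxE; case: (split_ordP i) => j ->.
- rewrite col_mxEu mxE; apply: pderiv_val.
  have := drv_add (is_derive_kinetic (fun k => is_derive_p0 k j z)) (is_derive_q j (V_diff _)).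
  by rewrite big1 ?add0r// => l _; rewrite mul0r.
- rewrite col_mxEd; apply: pderiv_val.
  apply: (is_derive_eq (drv_add (is_derive_kinetic (fun k => is_derive_p k j z))
    (is_derive_q0 V z j))).
  rewrite addr0 (bigD1 j)//= eqxx mul1r big1 ?addr0// => l /negbTE ->.
  by rewrite mul0r.
Qed.

Lemma pderiv_energy_l (k : 'I_D) : pderiv (lshift D k) (energy V) = fun z => pderiv k V (usubmx z).
Proof.
apply/funext => z; have /matrixP/(_ (lshift D k) 0) := grad_energy z.
by rewrite [LHS]mxE col_mxEu mxE.
Qed.

Lemma pderiv_energy_r (k : 'I_D) : pderiv (rshift D k) (energy V) = fun z => dsubmx z k 0.
Proof.
apply/funext => z; have /matrixP/(_ (rshift D k) 0) := grad_energy z.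
by rewrite [LHS]mxE col_mxEd.
Qed.

Lemma hess_energy z : hess (energy V) z = block_mx (hess V (usubmx z)) 0 0 1%:M.
Proof.
apply/matrixP => i j; rewrite mxE.
case: (split_ordP i) => k ->; case: (split_ordP j) => l ->.
- rewrite block_mxEul pderiv_energy_l mxE; apply: pderiv_val.
  exact: is_derive_q (pderivV_diff _ _).
- by rewrite block_mxEur pderiv_energy_r mxE; apply: pderiv_val; exact: is_derive_p0.
- by rewrite block_mxEdl pderiv_energy_l mxE; apply: pderiv_val; exact: is_derive_q0.
- rewrite block_mxEdr pderiv_energy_r mxE eq_sym; apply: pderiv_val; exact: is_derive_p.
Qed.

Lemma hess_energy_sym z : (hess (energy V) z)^T = hess (energy V) z.
Proof.
rewrite hess_energy tr_block_mx !trmx0 trmx1; congr block_mx.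
apply/matrixP => i j; rewrite !mxE; apply: mixed_partials.
- exact: V_diff.
- exact: pderivV_diff.
- exact: pderiv2V_diff.
Qed.

Definition vector_field z : phase := symplectic_mx D *m grad (energy V) z.

Lemma vector_fieldE z : vector_field z = col_mx (dsubmx z) (- grad V (usubmx z)).
Proof.
rewrite /vector_field /symplectic_mx grad_energy mul_block_col.
by rewrite !mul0mx mul1mx mulNmx mul1mx add0r addr0.
Qed.

(** The Euclidean norm: unlike the sup norm it can be differentiated along solutions. *)
Definition norm2sq n (u : 'cV[R]_n) : R := dot u u.

Lemma norm2sqE n (u : 'cV[R]_n) : norm2sq u = \sum_i u i 0 ^+ 2.
Proof. by rewrite /norm2sq dotE; apply: eq_bigr => i _; rewrite expr2. Qed.

Lemma norm2sq_ge n (u : 'cV[R]_n) : `|u| ^+ 2 <= norm2sq u.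
Proof.
have h i : `|u i 0| <= Num.sqrt (norm2sq u).
  rewrite -sqrtr_sqr ler_wsqrtr// norm2sqE (bigD1 i)//= lerDl.
  by apply: sumr_ge0 => k _; exact: sqr_ge0.
rewrite -[leRHS]sqr_sqrtr ?dot_ge0// lerXn2r ?nnegrE ?sqrtr_ge0//.
by apply: cV_norm_le => //; exact: sqrtr_ge0.
Qed.

Lemma norm2sq_le n (u : 'cV[R]_n) : norm2sq u <= n%:R * `|u| ^+ 2.
Proof.
rewrite norm2sqE mulr_natl -[X in _ *+ X]card_ord -sumr_const.
apply: ler_sum => i _; rewrite -[leLHS]real_normK ?num_real//.
by rewrite lerXn2r ?nnegrE// ler_entry_norm.
Qed.

(** The Hessian of a sub-quadratic potential is bounded. *)
Lemma vector_field_lipschitz : exists2 B, 0 <= B &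
  forall z w i, `|vector_field z i 0 - vector_field w i 0| <= B * \sum_k `|(z - w) k 0|.
Proof.
have /choice[c hc] : forall kl : 'I_D * 'I_D, exists c : R, forall x,
    `|pderiv kl.1 (pderiv kl.2 V) x| <= c.
  by move=> [k l]; have [c hc] := V_subquad (s := [:: k; l]) isT; exists c.
have c0 kl : 0 <= c kl by exact: le_trans (normr_ge0 _) (hc kl 0).
pose B := 1 + \sum_kl c kl.
have B0 : 0 <= B by rewrite addr_ge0// sumr_ge0.
exists B => // z w i; rewrite !vector_fieldE; case: (split_ordP i) => k ->.
  rewrite !col_mxEu.
  apply: le_trans (_ : \sum_k `|(z - w) k 0| <= _).
    rewrite (bigD1 (rshift D k))//= !mxE lerDl; exact: sumr_ge0.
  by rewrite ler_peMl ?sumr_ge0// lerDl sumr_ge0.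
rewrite !col_mxEd.
have -> : (- grad V (usubmx z)) k 0 - (- grad V (usubmx w)) k 0 =
    - (pderiv k V (usubmx z) - pderiv k V (usubmx w)).
  by rewrite ![in LHS]mxE opprD.
rewrite normrN.
apply: le_trans (lipschitz_of_partials (pderivV_diff k) (fun l x => hc (l, k) x) _ _) _.
apply: le_trans (_ : \sum_l B * `|usubmx z l 0 - usubmx w l 0| <= _).
  apply: ler_sum => l _; rewrite ler_wpM2r// /B (bigD1 (l, k))//=.
  by rewrite addrCA lerDl addr_ge0// sumr_ge0.
rewrite -mulr_sumr ler_wpM2l// big_split_ord /=.
rewrite (eq_bigr (fun i0 => `|(z - w) (lshift D i0) 0|)); last by move=> l _; rewrite !mxE.
by rewrite lerDl sumr_ge0.
Qed.

Definition solution (gam : R -> phase) :=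
  forall t : R, is_derive t 1 gam (vector_field (gam t)).

Lemma solutions_gronwall : exists K, forall gam1 gam2, solution gam1 -> solution gam2 ->
  forall a b, norm2sq (gam1 b - gam2 b) <= expR (K * `|b - a|) * norm2sq (gam1 a - gam2 a).
Proof.
have [B B0 hB] := vector_field_lipschitz.
exists (2 * (B * (D + D)%:R)) => g1 g2 s1 s2 a b.
pose u s := g1 s - g2 s; pose du s := vector_field (g1 s) - vector_field (g2 s).
have hu (s : R) : is_derive s 1 (fun s : R => norm2sq (u s)) (\sum_i 2 * (u s i 0 * du s i 0)).
  have hi i : is_derive s 1 (fun s : R => u s i 0) (du s i 0).
    have := drv_sub (is_derive_entry_mx i 0 (s1 s)) (is_derive_entry_mx i 0 (s2 s)).
    by rewrite /du !mxE; apply: drv_ext => t; rewrite !mxE.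
  have := @drv_sum _ _ _ (index_enum 'I_(D + D)) xpredT (fun i s => u s i 0 * u s i 0)
    s 1 _ (fun i => drv_mul (hi i) (hi i)).
  move=> /(@drv_ext _ _ _ (fun s => norm2sq (u s))) H.
  apply: (is_derive_eq (H _)); first by move=> t; rewrite /norm2sq dotE.
  by apply: eq_bigr => i _; ring.
apply: (gronwall hu) => s.
apply: le_trans (_ : \sum_i \sum_k 2 * (`|u s i 0| * (B * `|u s k 0|)) <= _).
  apply: le_trans (ler_norm_sum _ _ _) _; apply: ler_sum => i _.
  rewrite !normrM ger0_norm// -mulr_sumr ler_wpM2l// -mulr_sumr ler_wpM2l//.
  rewrite -mulr_sumr (_ : du s i 0 = vector_field (g1 s) i 0 - vector_field (g2 s) i 0).
    exact: hB.
  by rewrite /du mxE [X in _ + X]mxE.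
apply: le_trans (_ : \sum_i \sum_k B * (u s i 0 ^+ 2 + u s k 0 ^+ 2) <= _).
  apply: ler_sum => i _; apply: ler_sum => k _.
  rewrite (_ : 2 * _ = B * (2 * (`|u s i 0| * `|u s k 0|))); last by ring.
  rewrite ler_wpM2l// -[u s i 0 ^+ 2]real_normK ?num_real//.
  rewrite -[u s k 0 ^+ 2]real_normK ?num_real// -subr_ge0.
  by rewrite (_ : _ - _ = (`|u s i 0| - `|u s k 0|) ^+ 2) ?sqr_ge0//; ring.
rewrite norm2sqE; move: (u s) => v.
under eq_bigr do rewrite -mulr_sumr big_split /= sumr_const card_ord -mulr_natr.
rewrite -mulr_sumr big_split /= sumr_const card_ord -mulr_suml -mulr_natr.
by move: (\sum_i _) => w; rewrite le_eqVlt; apply/orP; left; apply/eqP; ring.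
Qed.

End HamiltonianFlow.

(** * The flow and its stability matrix *)

Section FlowConsequences.
Context {R : realType} {D : nat}.
Local Notation phase := 'cV[R]_(D + D).
Local Notation config := 'cV[R]_D.
Variable V : config -> R.
Hypotheses (V_smooth : smooth V) (V_subquad : subquadratic V).
Variables (zt : R -> phase -> phase) (hzt : hamiltonian_flow V zt).
Implicit Types (z y : phase).

Lemma solution_shift (gam : R -> phase) (c : R) :
  solution V gam -> solution V (fun s => gam (s + c)).
Proof.
move=> h t; have [h1 h2] := h (t + c).
have E : (fun s : R => s^-1 *: (gam (s *: (1 : R) + (t + c)) - gam (t + c))) =
   (fun s : R => s^-1 *: (gam (s *: (1 : R) + t + c) - gam (t + c))).
  by apply/funext => s; rewrite addrA.
by split; [rewrite /derivable -E|rewrite -h2 /derive -E].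
Qed.

Lemma solution_unique (g1 g2 : R -> phase) a : solution V g1 -> solution V g2 ->
  g1 a = g2 a -> forall b, g1 b = g2 b.
Proof.
move=> s1 s2 E b; have [K hK] := solutions_gronwall V_smooth V_subquad.
have := hK _ _ s1 s2 a b.
rewrite E subrr [X in _ <= _ * X -> _](_ : _ = 0); last by rewrite /norm2sq dot0l.
rewrite mulr0 => h; apply/eqP; rewrite -subr_eq0 -normr_eq0 -sqrf_eq0 eq_le sqr_ge0 andbT.
exact: le_trans (norm2sq_ge _) h.
Qed.

Lemma flow_solution z : solution V (fun s => zt s z).
Proof. by move=> t; exact: (hzt z).2. Qed.

(** The equation is autonomous, so both sides lie on the same solution. *)
Lemma flowNK t z : zt t (zt (- t) z) = z.
Proof.
have h1 := @flow_solution (zt (- t) z).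
have h2 := @solution_shift (fun s => zt s z) (- t) (@flow_solution z).
have e0 : zt 0 (zt (- t) z) = zt (0 - t) z by rewrite (hzt _).1 sub0r.
by rewrite (solution_unique h1 h2 e0 t) subrr (hzt _).1.
Qed.

(** Gronwall's inequality from time 0 to t and back. *)
Lemma flow_bilipschitz t : exists2 L, 1 <= L & forall y z,
  `|zt t y - zt t z| <= L * `|y - z| /\ `|y - z| <= L * `|zt t y - zt t z|.
Proof.
have [K hK] := solutions_gronwall V_smooth V_subquad.
pose E := expR (K * `|t|) * (D + D)%:R.
have E0 : 0 <= E by rewrite mulr_ge0// expR_ge0.
exists (1 + E); first by rewrite lerDl.
have key (u v : phase) : norm2sq u <= expR (K * `|t|) * norm2sq v -> `|u| <= (1 + E) * `|v|.
  move=> h; rewrite -(@ler_pXn2r _ 2) ?nnegrE ?mulr_ge0 ?addr_ge0//.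
  apply: le_trans (norm2sq_ge _) _; apply: le_trans h _.
  apply: le_trans (ler_wpM2l (expR_ge0 _) (norm2sq_le v)) _.
  rewrite mulrA exprMn ler_wpM2r ?sqr_ge0// -/E expr2 mulrDl mul1r.
  have := mulr_ge0 E0 E0; move: E0; move: E => E' E0 EE; nra.
move=> y z; have h a b := hK _ _ (@flow_solution y) (@flow_solution z) a b.
split; apply: key.
  by have := h 0 t; rewrite !(hzt _).1 subr0.
by have := h t 0; rewrite !(hzt _).1 sub0r normrN.
Qed.

Lemma flow_bracket t : exists2 C, 1 <= C & forall z, bracket (zt t z) <= C * bracket z.
Proof.
have [L L1 hL] := flow_bilipschitz t.
exists (L + `|zt t 0|); first by rewrite (le_trans L1)// lerDl.
move=> z; have [h _] := hL z 0; rewrite subr0 in h.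
have h' : `|zt t z| <= L * `|z| + `|zt t 0|.
  by rewrite -(subrK (zt t 0) (zt t z)) (le_trans (ler_normD _ _))// lerD2r.
rewrite /bracket; have := normr_ge0 z; have := normr_ge0 (zt t 0).
move: h' L1; move: (`|zt t z|) (`|zt t 0|) (`|z|) => a b c; nra.
Qed.

Lemma is_derive_le n (f : 'cV[R]_n -> R) x v (d L : R) : is_derive x v f d ->
  (forall h, `|f (h *: v + x) - f x| <= L * `|h|) -> `|d| <= L.
Proof.
move=> [h1 <-] hL; apply/ler_addgt0Pr => e e0.
have /cvgrPdist_lt/(_ _ e0)/nbhs_ballP[r /= r0 H] := h1.
(* One difference quotient with |h| < r is enough. *)
have r20 : 0 < r / 2 by rewrite divr_gt0.
have := H (r / 2); rewrite /ball /= sub0r normrN gtr0_norm//.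
rewrite ltr_pdivrMr// ltr_pMr// ltr1n gt_eqF// => /(_ isT isT) h.
have b : `|(r / 2)^-1 *: (f ((r / 2) *: v + x) - f x)| <= L.
  rewrite normrZ gtr0_norm ?invr_gt0// ler_pdivrMl//.
  by have := hL (r / 2); rewrite [`|r / 2|]gtr0_norm// [L * _]mulrC.
have tri (a q : R) : `|a - q| < e -> `|q| <= L -> `|a| <= L + e.
  move=> h3 h4; rewrite -(subrK q a).
  by apply: le_trans (ler_normD _ _) _; rewrite addrC lerD// ltW.
exact: tri h b.
Qed.

Variables (M : R -> phase -> 'M[R]_(D + D)) (hM : stability_matrix V zt M).

(** The entries are partial derivatives of a Lipschitz map. *)
Lemma stability_bounded t : exists2 L, 1 <= L & forall z i j, `|M t z i j| <= L.
Proof.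
have [L L1 hL] := flow_bilipschitz t; exists L => // z i j.
have [_ _ dM] := hM z.
apply: (is_derive_le (dM t i j)) => h.
have [b _] := hL (h *: delta_mx j 0 + z) z; rewrite addrK normrZ in b.
have e : `|zt t (h *: delta_mx j 0 + z) i 0 - zt t z i 0| <=
    `|zt t (h *: delta_mx j 0 + z) - zt t z|.
  by have := ler_entry_norm (zt t (h *: delta_mx j 0 + z) - zt t z) i; rewrite !mxE.
apply: le_trans e _; apply: le_trans b _; rewrite ler_wpM2l// ?(le_trans _ L1)//.
by rewrite -[leRHS]mulr1 ler_wpM2l// norm_delta.
Qed.

Local Notation J := (@symplectic_mx R D).

Lemma tr_symplectic : J^T = - J.
Proof.
rewrite /symplectic_mx tr_block_mx !trmx0 trmx1 linearN /= trmx1.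
by rewrite opp_block_mx !oppr0 opprK.
Qed.

Lemma symplectic_sqr : J *m J = - 1%:M.
Proof.
rewrite /symplectic_mx mulmx_block !mul0mx !mulmx0 !add0r !addr0 !mul1mx mulmx1.
by rewrite [1%:M in RHS](@scalar_mx_block _ D D) opp_block_mx !oppr0.
Qed.

(** With H the Hessian of the energy, (M^T J M)' = M^T (H J^T J + J J H) M, and this vanishes
    since J^T J = 1 and J J = -1. *)
Lemma stability_symplectic t z : (M t z)^T *m J *m M t z = J.
Proof.
pose H s := hess (energy V) (zt s z).
pose dM s := J *m H s *m M s z.
have dMs (s : R) : is_derive s 1 (fun s => M s z) (dM s) by have [_ + _] := hM z; exact.
apply/matrixP => i j.
pose F (s : R) := \sum_k (\sum_l M s z l i * J l k) * M s z k j.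
have FE s : F s = ((M s z)^T *m J *m M s z) i j.
  rewrite mxE; apply: eq_bigr => k _; rewrite mxE; congr (_ * _).
  by apply: eq_bigr => l _; rewrite [X in _ = X * _]mxE.
have dF (s : R) : is_derive s 1 F 0.
  have h1 k := @drv_sum _ _ _ (index_enum 'I_(D + D)) xpredT (fun l s => M s z l i * J l k)
    s 1 _ (fun l => drv_mul (is_derive_entry_mx l i (dMs s)) (drv_const (J l k) s 1)).
  have h2 := @drv_sum _ _ _ (index_enum 'I_(D + D)) xpredT
    (fun k s => (\sum_l M s z l i * J l k) * M s z k j)
    s 1 _ (fun k => drv_mul (h1 k) (is_derive_entry_mx k j (dMs s))).
  apply: (is_derive_eq h2).
  transitivity (((dM s)^T *m J *m M s z + (M s z)^T *m J *m dM s) i j); last first.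
    rewrite /dM !trmx_mul tr_symplectic (hess_energy_sym V_smooth) -/(H s).
    rewrite -!mulmxA [(- J) *m _]mulmxA mulNmx [in X in X + _]symplectic_sqr opprK mul1mx.
    rewrite [J *m (J *m _)]mulmxA symplectic_sqr mulNmx mul1mx mulmxN subrr.
    by rewrite mxE.
  rewrite [RHS]mxE ![X in _ = X + _]mxE ![X in _ = _ + X]mxE -big_split.
  apply: eq_bigr => k _ /=; rewrite ![X in _ = X * _ + _]mxE ![X in _ = _ + X * _]mxE.
  congr (_ * _ + _ * _); apply: eq_bigr => l _.
    by rewrite mulr0 addr0 [X in _ = X * _]mxE.
  by rewrite [X in _ = X * _]mxE.
have c s1 s2 : s1 <= s2 -> F s1 = F s2.
  move=> s12; have [c _] := derive_mean_value dF s12.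
  by rewrite mul0r => /eqP; rewrite subr_eq0 => /eqP.
have [M0 _ _] := hM z.
have F0 : F 0 = J i j by rewrite FE M0 trmx1 mul1mx mulmx1.
by rewrite -FE -F0; have [/c ->|/ltW/c ->] := leP 0 t.
Qed.

End FlowConsequences.

(** * The Herman-Kluk prefactor *)

Section Prefactor.
Context {R : realType} {D : nat}.
Local Notation config := 'cV[R]_D.
Local Notation toC := (map_mx (real_complex R)).
Local Notation J := (@symplectic_mx R D).
Variable G : 'M[R]_D.
Hypotheses (G_sym : G^T = G) (G_pos : forall x : 'cV[R]_D, x != 0 -> 0 < dot x (G *m x)).

Lemma dot_col_mx m n (a c : 'cV[R]_m) (b d : 'cV[R]_n) :
  dot (col_mx a b) (col_mx c d) = dot a c + dot b d.
Proof. by rewrite /dot tr_col_mx mul_row_col mxE. Qed.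

Lemma dot_symplectic (x1 y1 x2 y2 : config) :
  dot (col_mx x1 y1) (J *m col_mx x2 y2) = dot x1 y2 - dot y1 x2.
Proof.
rewrite /symplectic_mx mul_block_col !mul0mx mul1mx mulNmx mul1mx add0r addr0.
by rewrite dot_col_mx dotNr.
Qed.

Lemma quad_inv_ge0 (y : config) : 0 <= dot y (invmx G *m y).
Proof.
rewrite -{1}(mulKVmx (posdef_unitmx G_sym G_pos) y) dotC.
exact: quad_ge0.
Qed.

Definition hk_re (M : 'M[R]_(D + D)) := ulsubmx M + invmx G *m drsubmx M *m G.
Definition hk_im (M : 'M[R]_(D + D)) := invmx G *m dlsubmx M - ursubmx M *m G.

Lemma hk_matrixE M : hk_matrix G M = toC (hk_re M) + ('i%C : R[i]) *: toC (hk_im M).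
Proof.
rewrite /hk_matrix /hk_im map_mxB scalerBr -!addrA; congr (_ + _).
by rewrite addrC.
Qed.

(** For v = a + i b put u = (a, Gamma b) and w = (b, - Gamma a), the real and imaginary parts of
    (v, - i Gamma v). The image of v under the Herman-Kluk matrix is read off M u and M w. When its
    two squares are expanded, there remain non-negative terms and - 2 <M u, J M w>, which is
    - 2 <u, J w> = 2 (a^T Gamma a + b^T Gamma b) because M is symplectic. *)
Lemma hk_coercive M (a b : config) : M^T *m J *m M = J ->
  2 * (dot a (G *m a) + dot b (G *m b)) <=
  (let r := hk_re M *m a - hk_im M *m b in dot r (G *m r)) +
  (let s := hk_re M *m b + hk_im M *m a in dot s (G *m s)).
Proof.
move=> hM.
pose x1 := ulsubmx M *m a + ursubmx M *m (G *m b).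
pose y1 := dlsubmx M *m a + drsubmx M *m (G *m b).
pose x2 := ulsubmx M *m b + ursubmx M *m - (G *m a).
pose y2 := dlsubmx M *m b + drsubmx M *m - (G *m a).
have E1 : M *m col_mx a (G *m b) = col_mx x1 y1 by rewrite -[M in LHS]submxK mul_block_col.
have E2 : M *m col_mx b (- (G *m a)) = col_mx x2 y2 by rewrite -[M in LHS]submxK mul_block_col.
have EJ : dot x1 y2 - dot y1 x2 = - (dot a (G *m a) + dot b (G *m b)).
  rewrite -dot_symplectic -E1 -E2.
  have tr x y : dot (M *m x) y = dot x (M^T *m y) by rewrite dot_mulmx trmxK.
  by rewrite tr !mulmxA hM dot_symplectic dotNr [dot (G *m b) _]dotC opprD.
have rE : hk_re M *m a - hk_im M *m b = x1 - invmx G *m y2.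
  rewrite /x1 /y2 /hk_re /hk_im !mulmxDl !mulmxDr !mulNmx !mulmxN !mulmxA.
  by rewrite !opprB addrACA.
have sE : hk_re M *m b + hk_im M *m a = x2 + invmx G *m y1.
  rewrite /x2 /y1 /hk_re /hk_im !mulmxDl !mulmxDr !mulNmx !mulmxN !mulmxA.
  by rewrite [_ - _ *m a]addrC addrACA [X in _ + X]addrC.
have uG := posdef_unitmx G_sym G_pos.
(* For e = 1 and e = -1: the cross term of the square is 2 e <x, y>. *)
have sq (x y : config) (e : R) : dot (x + e *: (invmx G *m y)) (G *m (x + e *: (invmx G *m y))) =
    dot x (G *m x) + 2 * e * dot x y + e ^+ 2 * dot y (invmx G *m y).
  rewrite mulmxDr -scalemxAr (mulKVmx uG) dotDl !dotDr !dotZl !dotZr.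
  rewrite [dot (invmx G *m y) (G *m x)](quad_sym G_sym) (mulKVmx uG) [dot (invmx G *m y) y]dotC.
  ring.
have := sq x1 y2 (-1); have := sq x2 y1 1; rewrite scaleN1r scale1r /= rE sE => -> ->.
have := quad_inv_ge0 y1; have := quad_inv_ge0 y2.
have := quad_ge0 G_pos x1; have := quad_ge0 G_pos x2.
move: EJ; rewrite (dotC y1); move: (dot x1 y2) (dot x2 y1) => e1 e2.
move: (dot x1 _) (dot x2 _) (dot y1 _) (dot y2 _) (dot a _) (dot b _) => ? ? ? ? ? ?.
lra.
Qed.

Lemma normc_det_le n (A : 'M[R[i]]_n) (C : R) : (forall i j, normc (A i j) <= C) ->
  normc (\det A) <= n`!%:R * C ^+ n.
Proof.
move=> hA; rewrite /determinant.
apply: le_trans (_ : \sum_(s : 'S_n) C ^+ n <= _); last first.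
  by rewrite sumr_const card_Sn mulr_natl.
apply: (big_ind2 (fun (z : R[i]) (c : R) => normc z <= c)) => [|z c w d zc wd|s _].
- by rewrite normc0.
- exact: le_trans (normcD _ _) (lerD zc wd).
rewrite normcM (_ : normc ((-1) ^+ s) = 1) ?mul1r; last first.
  by rewrite normcX normcN normc1 expr1n.
rewrite -[n in C ^+ n]card_ord -prodr_const.
apply: (big_ind2 (fun (z : R[i]) (c : R) => normc z <= c)) => [|z c w d zc wd|i _].
- by rewrite normc1.
- by rewrite normcM ler_pM ?normc_ge0.
- exact: hA.
Qed.

Lemma complex_cV (v : 'cV[R[i]]_D) :
  v = toC (map_mx (@complex.Re R) v) + ('i%C : R[i]) *: toC (map_mx (@complex.Im R) v).
Proof.
apply/matrixP => i j; rewrite !mxE /=; case: (v i j) => a b /=.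
by apply: complex_eq; rewrite ?cReD ?cImD ?cReM ?cImM /=; ring.
Qed.

Lemma hk_mulmx M (a b : config) :
  hk_matrix G M *m (toC a + ('i%C : R[i]) *: toC b) =
  toC (hk_re M *m a - hk_im M *m b) + ('i%C : R[i]) *: toC (hk_re M *m b + hk_im M *m a).
Proof.
rewrite hk_matrixE mulmxDl !mulmxDr -!scalemxAl -!scalemxAr scalerA -!map_mxM.
rewrite map_mxB map_mxD scalerDr.
have -> : 'i%C * 'i%C = -1 :> R[i] by apply: complex_eq => /=; ring.
by rewrite scaleN1r [X in _ + _ + X]addrC addrACA.
Qed.

Lemma hk_solution_bound M (v : 'cV[R[i]]_D) (r : config) :
  M^T *m J *m M = J -> hk_matrix G M *m v = toC r ->
  2 * (dot (map_mx (@complex.Re R) v) (G *m map_mx (@complex.Re R) v) +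
    dot (map_mx (@complex.Im R) v) (G *m map_mx (@complex.Im R) v)) <= dot r (G *m r).
Proof.
move=> hM; rewrite {1}[v]complex_cV hk_mulmx.
set a := map_mx _ v; set b := map_mx _ v => E.
have [rE sE] : hk_re M *m a - hk_im M *m b = r /\ hk_re M *m b + hk_im M *m a = 0.
  move: E; move: (hk_re M *m a - _) (hk_re M *m b + _) => x y E.
  split; apply/matrixP => l m; have /matrixP/(_ l m) := E.
    rewrite mxE [X in X + _]mxE [X in _ + X]mxE [X in _ * X]mxE [RHS]mxE.
    by move=> /(congr1 (@complex.Re R)); rewrite cReD cReM /= mul0r mulr0 subr0 addr0.
  rewrite mxE [X in X + _]mxE [X in _ + X]mxE [X in _ * X]mxE [RHS]mxE.
  move=> /(congr1 (@complex.Im R)); rewrite cImD cImM /= mul0r mul1r !add0r.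
  by move=> ->; rewrite mxE.
by have := hk_coercive a b hM; rewrite /= rE sE mulmx0 dot0r addr0.
Qed.

(** Coercivity bounds the columns of the inverse. *)
Lemma hk_inverse_bound : exists2 B, 0 <= B & forall M (v : 'cV[R[i]]_D) k,
  M^T *m J *m M = J -> hk_matrix G M *m v = toC (delta_mx k 0) ->
  forall i, normc (v i 0) <= B.
Proof.
have [c c0 hc] := quad_lower_bound G_sym G_pos.
pose B0 : R := 1 + \sum_k `|G k k| / c.
have B00 : 1 <= B0 by rewrite lerDl sumr_ge0// => k _; rewrite divr_ge0// ltW.
exists (B0 + B0); first by rewrite addr_ge0// (le_trans _ B00).
move=> M v k hM E i; have := hk_solution_bound hM E.
set a := map_mx _ v; set b := map_mx _ v.
rewrite dot_delta -colE mxE => h.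
have small (x : config) : dot x (G *m x) <= G k k -> `|x| <= B0.
  move=> hx; rewrite -(@ler_pXn2r _ 2) ?nnegrE ?(le_trans _ B00)//.
  have h2 : `|x| ^+ 2 <= `|G k k| / c.
    rewrite ler_pdivlMr// mulrC; apply: le_trans (hc x) _.
    exact: le_trans hx (ler_norm _).
  apply: le_trans h2 _; apply: le_trans (_ : B0 <= _).
    by rewrite /B0 (bigD1 k)//= addrCA lerDl addr_ge0// sumr_ge0// => l _; rewrite divr_ge0// ltW.
  by rewrite expr2 ler_peMl// (le_trans _ B00).
have qa := quad_ge0 G_pos a; have qb := quad_ge0 G_pos b.
have ha : `|a| <= B0 by apply: small; move: h qa qb; move: (dot a _) (dot b _) => ? ?; lra.
have hb : `|b| <= B0 by apply: small; move: h qa qb; move: (dot a _) (dot b _) => ? ?; lra.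
apply: le_trans (normc_le_add _) _; apply: lerD.
  by apply: le_trans ha; have := ler_entry_norm a i; rewrite mxE.
by apply: le_trans hb; have := ler_entry_norm b i; rewrite mxE.
Qed.

Lemma hk_unitmx M : M^T *m J *m M = J -> hk_matrix G M \in unitmx.
Proof.
move=> hM; rewrite unitmxE unitfE -det_tr; apply/negP => /det0P[u u0 uK].
have E : hk_matrix G M *m u^T = toC (0 : config).
  by rewrite -[hk_matrix _ _]trmxK -trmx_mul uK trmx0 map_mx0.
have := hk_solution_bound hM E; rewrite mulmx0 dot0r.
set a := map_mx _ _; set b := map_mx _ _ => h.
have [a0|/G_pos] := eqVneq a 0; last first.
  by have := quad_ge0 G_pos b; move: h; move: (dot a _) (dot b _) => ? ?; lra.
have [b0|/G_pos] := eqVneq b 0; last first.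
  by have := quad_ge0 G_pos a; move: h; move: (dot a _) (dot b _) => ? ?; lra.
move/eqP: u0; apply; rewrite -[u]trmxK [u^T]complex_cV -/a -/b a0 b0.
by rewrite !map_mx0 scaler0 addr0 trmx0.
Qed.

(** The inverse has bounded entries, hence a bounded determinant. *)
Lemma hk_det_lower : exists2 c, 0 < c & forall M, M^T *m J *m M = J ->
  c <= normc (\det (hk_matrix G M)).
Proof.
have [B B0 hB] := hk_inverse_bound.
have P0 : 0 < D`!%:R * (B + 1) ^+ D.
  by rewrite mulr_gt0 ?ltr0n ?fact_gt0// exprn_gt0// ltr_wpDl.
exists (D`!%:R * (B + 1) ^+ D)^-1; first by rewrite invr_gt0.
move=> M hM; set K := hk_matrix G M.
have uK : K \in unitmx by exact: hk_unitmx.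
have hI i k : normc (invmx K i k) <= B + 1.
  have E : K *m col k (invmx K) = toC (delta_mx k 0).
    rewrite colE mulmxA mulmxV// mul1mx.
    by apply/matrixP => l m; rewrite !mxE (ord1 m) eqxx andbT; case: eqP.
  by have := hB M _ k hM E i; rewrite mxE => h; apply: le_trans h _; rewrite lerDl.
have d0 : 0 < normc (\det K) by rewrite normc_gt0 -unitfE -unitmxE.
have := normc_det_le hI.
have -> : normc (\det (invmx K)) = (normc (\det K))^-1.
  apply: (mulfI (lt0r_neq0 d0)); rewrite divff ?gt_eqF// -normcM -det_mulmx mulmxV// det1.
  exact: normc1.
by move=> h; rewrite invf_ple ?posrE.
Qed.

Lemma norm_mulmx_entry m n p (A : 'M[R]_(m, n)) (B : 'M[R]_(n, p)) a b :
  0 <= a -> (forall i j, `|A i j| <= a) -> (forall i j, `|B i j| <= b) ->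
  forall i j, `|(A *m B) i j| <= n%:R * (a * b).
Proof.
move=> a0 hA hB i j; rewrite mxE; apply: le_trans (ler_norm_sum _ _ _) _.
rewrite mulr_natl -[X in _ *+ X]card_ord -sumr_const; apply: ler_sum => k _.
by rewrite normrM ler_pM.
Qed.

Lemma entries_bounded m n (A : 'M[R]_(m, n)) : exists2 a, 0 <= a & forall i j, `|A i j| <= a.
Proof.
exists (\sum_i \sum_j `|A i j|); first by apply: sumr_ge0 => i _; exact: sumr_ge0.
move=> i j; rewrite (bigD1 i)//= (bigD1 j)//= -addrA lerDl addr_ge0 ?sumr_ge0// => k _.
exact: sumr_ge0.
Qed.

Lemma hk_det_upper L : 0 <= L -> exists C, forall M : 'M[R]_(D + D), (forall i j, `|M i j| <= L) ->
  normc (\det (hk_matrix G M)) <= C.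
Proof.
move=> L0; have [a a0 hG] := entries_bounded G; have [b b0 hI] := entries_bounded (invmx G).
pose c : R := D%:R * (b * L).
have c0 : 0 <= c by rewrite !mulr_ge0.
pose C := L + D%:R * (c * a) + (c + D%:R * (L * a)).
exists (D`!%:R * C ^+ D) => M hM; apply: normc_det_le => i j.
have h1 : forall i j, `|(invmx G *m drsubmx M) i j| <= c.
  by apply: norm_mulmx_entry => // k l; rewrite !mxE.
have h2 : forall i j, `|(invmx G *m dlsubmx M) i j| <= c.
  by apply: norm_mulmx_entry => // k l; rewrite !mxE.
have h3 := norm_mulmx_entry c0 h1 hG.
have h4 : forall i j, `|(ursubmx M *m G) i j| <= D%:R * (L * a).
  by apply: norm_mulmx_entry => // k l; rewrite !mxE.
rewrite hk_matrixE mxE [X in _ + X]mxE [X in X + _]mxE [X in _ * X]mxE.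
apply: le_trans (normcD _ _) _; rewrite normcM normc_real normc_real.
rewrite (_ : normc 'i%C = 1) ?mul1r; last by rewrite /= expr0n expr1n add0r sqrtr1.
have -> : hk_re M i j = ulsubmx M i j + (invmx G *m drsubmx M *m G) i j by rewrite [LHS]mxE.
have -> : hk_im M i j = (invmx G *m dlsubmx M) i j - (ursubmx M *m G) i j.
  by rewrite [LHS]mxE [X in _ + X]mxE.
apply: lerD; last by apply: le_trans (ler_normB _ _) _; exact: lerD.
by apply: le_trans (ler_normD _ _) _; apply: lerD => //; rewrite !mxE.
Qed.

End Prefactor.

Section PrefactorBounds.
Context {R : realType} {D : nat}.
Local Notation phase := 'cV[R]_(D + D).
Variable G : 'M[R]_D.
Hypotheses (G_sym : G^T = G) (G_pos : forall x : 'cV[R]_D, x != 0 -> 0 < dot x (G *m x)).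
Variable V : 'cV[R]_D -> R.
Hypotheses (V_smooth : smooth V) (V_subquad : subquadratic V).
Variables (zt : R -> phase -> phase) (hzt : hamiltonian_flow V zt).
Variables (M : R -> phase -> 'M[R]_(D + D)) (hM : stability_matrix V zt M).
Variables (Rt : R -> phase -> R[i]) (hRt : hk_prefactor G M Rt).

Lemma prefactor_bounds t : exists c C, 0 < c /\ forall z, c <= normc (Rt t z) <= C.
Proof.
have [L L1 hL] := stability_bounded V_smooth V_subquad hzt hM t.
have [c1 c10 h1] := hk_det_lower G_sym G_pos.
have [C1 h2] := @hk_det_upper _ _ G L (le_trans ler01 L1).
pose a : R := 2 `^ (- (D%:R / 2)).
have a0 : 0 < a by rewrite powR_gt0.
exists (a * Num.sqrt c1), (a * Num.sqrt C1); split; first by rewrite mulr_gt0// sqrtr_gt0.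
move=> z; have [_ _ _ /(_ t)[s s2 ->]] := hRt z.
rewrite normcM normc_real -/a (gtr0_norm a0) !ler_pM2l//.
have E : normc s = Num.sqrt (normc (\det (hk_matrix G (M t z)))).
  by rewrite -s2 normcX sqrtr_sqr ger0_norm ?normc_ge0.
rewrite E !ler_wsqrtr ?h2//.
  by apply: h1; exact: (stability_symplectic V_smooth hM t z).
Qed.

End PrefactorBounds.

(** * Symbols with a leading part *)

Section SymbolClasses.
Context {R : realType} {D : nat}.
Local Notation phase := 'cV[R]_(D + D).
Local Notation config := 'cV[R]_D.
Variable e : phase.
Implicit Types (x : config) (z : phase) (u v : config -> phase -> R -> R[i]).
Implicit Types (f h : config -> phase -> R[i]) (F H : config -> R[i]).

(** Order t^k as t grows, up to polynomial factors in x and z. *)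
Definition growth k u := exists C N, 0 <= C /\ forall x z t, 1 <= t ->
  normc (u x z t) <= C * t ^+ k * (bracket x * bracket z) ^+ N.

Lemma weight_ge1 x z : 1 <= bracket x * bracket z.
Proof. by rewrite -[1]mulr1 ler_pM ?bracket_ge1. Qed.

Lemma weight_pow_ge0 x z N : 0 <= (bracket x * bracket z) ^+ N.
Proof. by rewrite exprn_ge0// (le_trans ler01 (weight_ge1 x z)). Qed.

Lemma growth_add k u v : growth k u -> growth k v -> growth k (fun x z t => u x z t + v x z t).
Proof.
move=> [C [N [C0 hu]]] [C' [N' [C'0 hv]]]; exists (C + C'), (N + N')%N; split.
  exact: addr_ge0.
move=> x z t t1; have t0 : 0 <= t ^+ k by rewrite exprn_ge0// (le_trans ler01).
apply: le_trans (normcD _ _) _; rewrite [(C + _) * _]mulrDl [leRHS]mulrDl; apply: lerD.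
  apply: le_trans (hu x z t t1) _; apply: ler_wpM2l; first exact: mulr_ge0.
  by apply: ler_weXn2l; rewrite ?weight_ge1// leq_addr.
apply: le_trans (hv x z t t1) _; apply: ler_wpM2l; first exact: mulr_ge0.
by apply: ler_weXn2l; rewrite ?weight_ge1// leq_addl.
Qed.

Lemma growth_mul k l u v : growth k u -> growth l v ->
  growth (k + l) (fun x z t => u x z t * v x z t).
Proof.
move=> [C [N [C0 hu]]] [C' [N' [C'0 hv]]]; exists (C * C'), (N + N')%N; split.
  exact: mulr_ge0.
move=> x z t t1; rewrite normcM.
apply: le_trans (ler_pM (normc_ge0 _) (normc_ge0 _) (hu x z t t1) (hv x z t t1)) _.
by rewrite mulrACA [X in X * _ <= _]mulrACA -!exprD.
Qed.

Lemma growth_mono k l u : (k <= l)%N -> growth k u -> growth l u.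
Proof.
move=> kl [C [N [C0 hu]]]; exists C, N; split => // x z t t1.
apply: le_trans (hu x z t t1) _; rewrite ler_wpM2r ?weight_pow_ge0//.
by apply: ler_wpM2l => //; exact: ler_weXn2l.
Qed.

Lemma growth_pow k : growth k (fun _ _ t => (t ^+ k)%:C).
Proof.
exists 1, 0%N; split=> // x z t t1; rewrite normc_real expr0 mulr1 mul1r.
by rewrite ger0_norm// exprn_ge0// (le_trans ler01).
Qed.

Lemma growth_cancel k u : growth k (fun x z t => t%:C * u x z t) -> growth k u.
Proof.
move=> [C [N [C0 hu]]]; exists C, N; split => // x z t t1.
apply: le_trans (hu x z t t1); rewrite normcM normc_real.
by rewrite ler_peMl ?normc_ge0// (le_trans t1)// ler_norm.
Qed.

(** f x (z + t e) = t^m F x + O(t^(m - 1)) as t grows. The remainder is multiplied by t to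
    avoid a negative power when m = 0. *)
Definition asymp m f F := growth 0 (fun x _ _ => F x) /\
  growth m (fun x z t => t%:C * (f x (z + t *: e) - (t ^+ m)%:C * F x)).

Lemma asymp_growth m f F : asymp m f F -> growth m (fun x z t => f x (z + t *: e)).
Proof.
move=> [hF hf]; have hm := growth_mul (growth_pow m) hF; rewrite addn0 in hm.
have := growth_add (growth_cancel hf) hm; congr growth.
by apply/funext => x; apply/funext => z; apply/funext => t; rewrite subrK.
Qed.

Lemma growth_eq k u v : (forall x z t, u x z t = v x z t) -> growth k u -> growth k v.
Proof.
by move=> uv; congr growth; apply/funext => x; apply/funext => z; apply/funext => t.
Qed.

Lemma asymp_add m f h F H : asymp m f F -> asymp m h H ->
  asymp m (fun x z => f x z + h x z) (fun x => F x + H x).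
Proof.
move=> [hF hf] [hH hh]; split; first exact: growth_add.
by apply: growth_eq (growth_add hf hh) => x z t; ring.
Qed.

Lemma asymp_mul m k f h F H : asymp m f F -> asymp k h H ->
  asymp (m + k) (fun x z => f x z * h x z) (fun x => F x * H x).
Proof.
move=> af ah; have [hF hf] := af; have [hH hh] := ah.
split; first exact: growth_mul hF hH.
have g1 := growth_mul hf (asymp_growth ah).
have g2 := growth_mul (growth_mul (growth_pow m) hF) hh; rewrite addn0 in g2.
by apply: growth_eq (growth_add g1 g2) => x z t; rewrite exprD rmorphM /=; ring.
Qed.

Lemma growth_const (c : R[i]) : growth 0 (fun _ _ _ => c).
Proof.
exists (normc c), 0%N; split; first exact: normc_ge0.
by move=> x z t _; rewrite !expr0 !mulr1.
Qed.

(** Seen as a symbol of higher order, it has leading part 0. *)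
Lemma asymp_raise m f F : asymp m f F -> asymp m.+1 f (fun=> 0).
Proof.
move=> af; split; first exact: growth_const.
have := growth_mul (growth_pow 1) (asymp_growth af); rewrite add1n.
by apply: growth_eq => x z t; rewrite mulr0 subr0.
Qed.

Lemma asymp_fixed F : growth 0 (fun x _ _ => F x) -> asymp 0 (fun x _ => F x) F.
Proof.
move=> hF; split => //; apply: growth_eq (growth_const 0) => x z t.
by rewrite expr0 mul1r subrr mulr0.
Qed.

Lemma asymp_const (c : R[i]) : asymp 0 (fun _ _ => c) (fun=> c).
Proof. exact/asymp_fixed/growth_const. Qed.

Lemma asymp_ext m f h F H : (forall x z, f x z = h x z) -> (forall x, F x = H x) ->
  asymp m f F -> asymp m h H.
Proof.
move=> fh FH; suff [-> ->] : f = h /\ F = H by [].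
by split; apply/funext => x //; apply/funext => z.
Qed.

Lemma asymp_sum m (I : Type) (r : seq I) (f : I -> config -> phase -> R[i])
    (F : I -> config -> R[i]) : (forall i, asymp m (f i) (F i)) ->
  asymp m (fun x z => \sum_(i <- r) f i x z) (fun x => \sum_(i <- r) F i x).
Proof.
move=> h; elim: r => [|i r IH].
  apply: (@asymp_ext _ (fun _ _ => 0) _ (fun=> 0)) => [x z|x|]; rewrite ?big_nil//.
  split; first exact: growth_const.
  by apply: growth_eq (growth_mono (leq0n m) (growth_const 0)) => x z t; ring.
by apply: asymp_ext (asymp_add (h i) IH) => [x z|x]; rewrite big_cons.
Qed.

(** The case t = 1, applied at z - e. *)
Lemma asymp_bound m f F : `|e| <= 1 -> asymp m f F ->
  exists C N, 0 <= C /\ forall x z, normc (f x z) <= C * (bracket x * bracket z) ^+ N.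
Proof.
move=> e1 /asymp_growth[C [N [C0 h]]]; exists (C * 2 ^+ N), N; split.
  by rewrite mulr_ge0// exprn_ge0.
move=> x z; have := h x (z - e) 1 (lexx _); rewrite scale1r subrK expr1n mulr1.
move=> /le_trans; apply; rewrite -mulrA ler_wpM2l// -exprMn.
apply: lerXn2r; rewrite ?nnegrE ?mulr_ge0// ?(ltW (bracket_gt0 _))//.
rewrite mulrCA ler_wpM2l ?(ltW (bracket_gt0 _))//.
apply: le_trans (bracketD _ _) _; rewrite bracketN mulrC.
by rewrite ler_wpM2r ?(ltW (bracket_gt0 _))// /bracket -[2]/(1 + 1) lerD2l.
Qed.

End SymbolClasses.

(** * Symbols of the operators *)

Section OperatorSymbols.
Context {R : realType} {D : nat}.
Variables (eps : R) (Gamma : 'M[R]_D).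
Hypotheses (heps : 0 < eps) (Gamma_sym : Gamma^T = Gamma).
Hypothesis Gamma_pos : forall x : 'cV[R]_D, x != 0 -> 0 < dot x (Gamma *m x).
Variable V : 'cV[R]_D -> R.
Hypotheses (V_smooth : smooth V) (V_subquad : subquadratic V).
Variable j : 'I_D.
Local Notation g := (gaussian eps Gamma).
Local Notation phase := 'cV[R]_(D + D).
Local Notation config := 'cV[R]_D.
Implicit Types (x : config) (z : phase) (A : operator R D).
Implicit Types (f : config -> phase -> R[i]) (F : config -> R[i]).

(** The unit translation of the j-th momentum. *)
Definition boost : phase := col_mx 0 (delta_mx j 0).
Local Notation e := boost.

Lemma norm_boost : `|boost| <= 1.
Proof.
apply: cV_norm_le => // i; rewrite /boost; case: (split_ordP i) => k ->.
  by rewrite col_mxEu mxE normr0.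
by rewrite col_mxEd (le_trans (ler_entry_norm _ _))// norm_delta.
Qed.

Lemma usubmx_boost z (t : R) : usubmx (z + t *: e) = usubmx z.
Proof. by rewrite linearD linearZ /= /boost col_mxKu scaler0 addr0. Qed.

Lemma dsubmx_boost z (t : R) : dsubmx (z + t *: e) = dsubmx z + t *: delta_mx j 0.
Proof. by rewrite linearD linearZ /= /boost col_mxKd. Qed.

Lemma norm_usubmx z : `|usubmx z| <= `|z|.
Proof. by apply: cV_norm_le => // i; rewrite mxE ler_entry_norm. Qed.

Lemma norm_mulmx_le n (G : 'M[R]_n) : exists2 C, 0 <= C & forall v : 'cV[R]_n, `|G *m v| <= C * `|v|.
Proof.
exists (\sum_i \sum_k `|G i k|) => [|v].
  by apply: sumr_ge0 => i _; exact: sumr_ge0.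
have C0 : 0 <= \sum_i \sum_k `|G i k| by apply: sumr_ge0 => i _; exact: sumr_ge0.
apply: cV_norm_le => [|i]; first exact: mulr_ge0.
rewrite mxE; apply: le_trans (ler_norm_sum _ _ _) _.
apply: le_trans (_ : (\sum_k `|G i k|) * `|v| <= _).
  by rewrite mulr_suml; apply: ler_sum => k _; rewrite normrM ler_wpM2l// ler_entry_norm.
rewrite ler_wpM2r// [leRHS](bigD1 i)//= lerDl; apply: sumr_ge0 => k _; exact: sumr_ge0.
Qed.

Lemma gvel_growth k : growth 0 (fun x z _ => gvel Gamma k z x).
Proof.
have [C C0 hC] := norm_mulmx_le Gamma.
exists (1 + C), 1%N; split; first exact: addr_ge0.
move=> x z t _; rewrite expr0 mulr1 expr1.
apply: le_trans (normc_le_add _) _; rewrite /gvel /= mulrDl mul1r; apply: lerD.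
  rewrite mxE; apply: le_trans (entry_le_bracket _ _) _.
  by rewrite ler_peMl ?bracket_ge1// ltW// bracket_gt0.
apply: le_trans (ler_entry_norm _ _) _; apply: le_trans (hC _) _; rewrite ler_wpM2l//.
apply: le_trans (ler_normB _ _) _; have := norm_usubmx z.
have := mulr_ge0 (normr_ge0 x) (normr_ge0 z).
rewrite /bracket; move: (`|x|) (`|z|) (`|_|) (normr_ge0 x) => a b c; lra.
Qed.

Lemma gvel_boost k z (t : R) x :
  gvel Gamma k (z + t *: e) x = gvel Gamma k z x + t%:C * (k == j)%:R.
Proof.
have -> : (k == j)%:R = (k == j)%:R%:C :> R[i] by rewrite rmorph_nat.
rewrite /gvel usubmx_boost dsubmx_boost; apply: complex_eq.
  by rewrite cReD cReM /= !mxE mul0r subr0 eqxx andbT.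
by rewrite cImD cImM /= mulr0 mul0r !addr0.
Qed.

Lemma asymp_gvel k : asymp e 1 (fun x z => gvel Gamma k z x) (fun=> (k == j)%:R).
Proof.
split; first exact: growth_const.
have := growth_mul (growth_pow 1) (gvel_growth k); rewrite addn0.
by apply: growth_eq => x z t; rewrite gvel_boost expr1 addrK.
Qed.

Lemma cdiff_gvel k z : cdiff (gvel Gamma k z).
Proof.
move=> x; split; first exact: (@dif_const _ _ (dsubmx z k 0) x).
apply: dif_mulmx => i.
rewrite (_ : (fun y => _) = fun y : config => y i 0 + - usubmx z i 0); last first.
  by apply/funext => y; rewrite !mxE.
apply: dif_add; last exact: dif_const.
exact: (cdiff_entry i x).1.
Qed.

(** The symbol of [A] on Gaussians. Its leading part [F] is taken along translations of the
    j-th momentum, the direction in which matrix elements will be shown not to decay. *)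
Definition has_symbol A m f F := [/\ forall z x, A (g z) x = f x z * g z x,
  asymp e m f F, forall z, cdiff (fun x => f x z) & cdiff F].

Lemma symbol_id : has_symbol idfun 0 (fun _ _ => 1) (fun=> 1).
Proof.
split; [by move=> z x; rewrite mul1r|exact: asymp_const|..].
  by move=> z; exact: cdiff_const.
exact: cdiff_const.
Qed.

Lemma cdiff_exp (phi : config -> R[i]) k : cdiff phi -> cdiff (fun x => phi x ^+ k).
Proof.
move=> h; elim: k => [|k IH]; first exact: cdiff_const.
by under eq_fun do rewrite exprS; exact: cdiff_mul.
Qed.

Lemma growth_entry : growth 0 (fun x (_ : phase) _ => (x j 0)%:C).
Proof.
exists 1, 1%N; split => // x z t _; rewrite expr0 expr1 !mul1r normc_real.
by rewrite (le_trans (entry_le_bracket _ _))// ler_peMr ?bracket_ge1// ltW// bracket_gt0.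
Qed.

Lemma symbol_position n : has_symbol (iter n (@position_op R D j)) 0
  (fun x _ => (x j 0)%:C ^+ n) (fun x => (x j 0)%:C ^+ n).
Proof.
have cd : cdiff (fun x : config => (x j 0)%:C ^+ n) by apply: cdiff_exp; exact: cdiff_entry.
split => //.
  elim: n {cd} => [|n IH] z x; first by rewrite expr0 mul1r.
  by rewrite iterS /position_op IH exprS mulrA.
apply: asymp_fixed; elim: n {cd} => [|n IH]; first exact: growth_const.
by have := growth_mul growth_entry IH; apply: growth_eq => x z t; rewrite exprS.
Qed.

(** Hermite polynomials up to scaling. The operator -i eps d_j sends h(u) g_z, with u = [gvel],
    to (u h(u) + b h'(u)) g_z for b = eps Gamma_jj; the derivative of the m-th polynomial is m times
    the preceding one, whence the recursion. *)
Fixpoint herm (b u : R[i]) m : R[i] :=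
  if m is k.+1 then u * herm b u k + b * k%:R * (if k is l.+1 then herm b u l else 0) else 1.

Lemma hermS b u m : herm b u m.+1 = u * herm b u m + b * m%:R * herm b u m.-1.
Proof. by case: m => [|m] //=; rewrite !mulr0 mul0r. Qed.

(** Two consecutive degrees are carried through the induction, as the recursion has two
    terms. *)
Lemma is_cpderiv_herm b (u : config -> R[i]) x du m : is_cpderiv j x u du ->
  is_cpderiv j x (fun y => herm b (u y) m) (m%:R * herm b (u x) m.-1 * du).
Proof.
move=> hu.
suff [] : is_cpderiv j x (fun y => herm b (u y) m) (m%:R * herm b (u x) m.-1 * du) /\
  is_cpderiv j x (fun y => herm b (u y) m.+1) (m.+1%:R * herm b (u x) m * du) by [].
elim: m => [|m [IH1 IH2]]; split => //.
- by rewrite !mul0r; exact: is_cpderiv_const.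
- rewrite mul1r /=; under eq_fun do rewrite !mulr1 mulr0 addr0.
  by rewrite mul1r.
under eq_fun do rewrite hermS.
have := is_cpderiv_add (is_cpderiv_mul hu IH2)
  (is_cpderiv_mul (is_cpderiv_const j x (b * m.+1%:R)) IH1).
congr is_cpderiv; rewrite (hermS b (u x) m) -(natr1 m.+1) -(natr1 m) mul0r add0r.
ring.
Qed.

Lemma cdiff_herm b (u : config -> R[i]) m : cdiff u -> cdiff (fun x => herm b (u x) m).
Proof.
move=> hu; suff [] : cdiff (fun x => herm b (u x) m) /\ cdiff (fun x => herm b (u x) m.+1) by [].
elim: m => [|m [IH1 IH2]]; split => //; first exact: cdiff_const.
  by rewrite /=; under eq_fun do rewrite !mulr1 mulr0 addr0.
under eq_fun do rewrite hermS.
by apply: cdiff_add; apply: cdiff_mul => //; exact: cdiff_const.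
Qed.

Lemma asymp_herm b f m : asymp e 1 f (fun=> 1) ->
  asymp e m (fun x z => herm b (f x z) m) (fun=> 1).
Proof.
move=> hf; suff [] : asymp e m (fun x z => herm b (f x z) m) (fun=> 1) /\
  asymp e m.+1 (fun x z => herm b (f x z) m.+1) (fun=> 1) by [].
elim: m => [|m [IH1 IH2]]; split => //; first exact: asymp_const.
  by apply: asymp_ext hf => // x z; rewrite hermS /= !mulr1 mulr0 addr0.
have h1 := asymp_mul hf IH2.
have h2 := asymp_raise (asymp_raise (asymp_mul (asymp_const e (b * m.+1%:R)) IH1)).
apply: asymp_ext (asymp_add h1 h2) => [x z|x]; first by rewrite [RHS]hermS.
by rewrite mulr1 addr0.
Qed.

Lemma symbol_momentum n : has_symbol (iter n (@momentum_op R D eps j)) n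
  (fun x z => herm (eps * Gamma j j)%:C (gvel Gamma j z x) n) (fun=> 1).
Proof.
split.
- move=> z; elim: n => [|n IH] x; first by rewrite mul1r.
  rewrite iterS {1}/momentum_op (_ : iter n _ _ = fun x =>
    herm (eps * Gamma j j)%:C (gvel Gamma j z x) n * g z x); last exact/funext.
  have h1 := is_cpderiv_herm (eps * Gamma j j)%:C n (is_cpderiv_gvel Gamma j z x).
  have h2 := is_cpderiv_gaussian heps Gamma_sym j z x.
  rewrite (is_cpderivP (is_cpderiv_mul h1 h2)) hermS.
  have -> : (eps * Gamma j j)%:C = - 'i%C * eps%:C * ('i%C * (Gamma j j)%:C) :> R[i].
    by apply: complex_eq; rewrite ?cReM ?cImM ?cReD ?cImD /=; ring.
  have ii : - 'i%C * eps%:C * ('i%C / eps%:C) = 1 :> R[i].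
    rewrite i_over_epsE; apply: complex_eq; rewrite ?cReM ?cImM /=; last by ring.
    by field; exact: lt0r_neq0.
  have alg (a b c u k y w l : R[i]) : k * w = 1 ->
      k * (l * b * y * c + a * (w * u * c)) = (u * a + k * y * l * b) * c.
    move=> kw; rewrite (_ : k * _ = (k * w) * (u * a * c) + k * y * l * b * c); last by ring.
    by rewrite kw; ring.
  exact: alg.
- apply: asymp_herm; apply: asymp_ext (asymp_gvel j) => [//|x].
  by rewrite eqxx.
- by move=> z; apply: cdiff_herm; exact: cdiff_gvel.
- exact: cdiff_const.
Qed.

Definition kinetic_symbol x z : R[i] :=
  \sum_k 2^-1 * (gvel Gamma k z x * gvel Gamma k z x + (eps * Gamma k k)%:C).

Lemma symbol_kinetic : has_symbol (@kinetic_op R D eps) 2 kinetic_symbol (fun=> 2^-1).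
Proof.
split.
- move=> z x; rewrite /kinetic_op /kinetic_symbol mulr_sumr mulr_suml.
  apply: eq_bigr => k _.
  rewrite (_ : cpderiv k (g z) = fun x => 'i%C / eps%:C * gvel Gamma k z x * g z x); last first.
    by apply/funext => y; exact: cpderiv_gaussian.
  have h1 := is_cpderiv_mul (is_cpderiv_const k x ('i%C / eps%:C)) (is_cpderiv_gvel Gamma k z x).
  have h2 := is_cpderiv_gaussian heps Gamma_sym k z x.
  rewrite (is_cpderivP (is_cpderiv_mul h1 h2)) mul0r add0r.
  have a1 : - (eps ^+ 2 / 2)%:C * ('i%C / eps%:C * ('i%C * (Gamma k k)%:C)) =
     2^-1 * (eps * Gamma k k)%:C :> R[i].
    rewrite i_over_epsE (_ : 2^-1 = (2^-1)%:C :> R[i]); last by rewrite fmorphV rmorph_nat.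
    by apply: complex_eq; rewrite ?cReM ?cImM ?cReD ?cImD /=; field; exact: lt0r_neq0.
  have a2 : - (eps ^+ 2 / 2)%:C * ('i%C / eps%:C * ('i%C / eps%:C)) = 2^-1 :> R[i].
    rewrite i_over_epsE (_ : 2^-1 = (2^-1)%:C :> R[i]); last by rewrite fmorphV rmorph_nat.
    by apply: complex_eq; rewrite ?cReM ?cImM ?cReD ?cImD /=; field; exact: lt0r_neq0.
  move: (gvel _ _ _ _) (g z x) => u c.
  rewrite mulrDr (mulrA _ _ c) a1 [X in _ + X](_ : _ =
    (- (eps ^+ 2 / 2)%:C * ('i%C / eps%:C * ('i%C / eps%:C))) * (u * u * c)); last by ring.
  by rewrite a2; ring.
- apply: (@asymp_ext _ _ _ _ kinetic_symbol _ (fun=> \sum_k 2^-1 * ((k == j)%:R * (k == j)%:R + 0))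
    _ (fun _ _ => erefl)) => [x|].
    rewrite (bigD1 j)//= eqxx mul1r addr0 mulr1 big1 ?addr0// => k /negbTE ->.
    by rewrite mul0r addr0 mulr0.
  apply: asymp_sum => k.
  have h1 := asymp_mul (asymp_gvel k) (asymp_gvel k).
  have h2 := asymp_raise (asymp_raise (asymp_const e (eps * Gamma k k)%:C)).
  exact: (asymp_mul (asymp_const e 2^-1) (asymp_add h1 h2)).
- move=> z; rewrite /kinetic_symbol; elim: (index_enum _) => [|k r IH].
    by under eq_fun do rewrite big_nil; exact: cdiff_const.
  under eq_fun do rewrite big_cons; apply: cdiff_add => //; apply: cdiff_mul.
    exact: cdiff_const.
  apply: cdiff_add; last exact: cdiff_const.
  by apply: cdiff_mul; exact: cdiff_gvel.
- exact: cdiff_const.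
Qed.

(** Bounded second derivatives make the gradient Lipschitz, so V grows at most
    quadratically. *)
Lemma potential_growth : growth 0 (fun x (_ : phase) _ => (V x)%:C).
Proof.
have /choice[c hc] : forall kl : 'I_D * 'I_D, exists c : R, forall x,
    `|pderiv kl.1 (pderiv kl.2 V) x| <= c.
  by move=> [k l]; have [c hc] := V_subquad (s := [:: k; l]) isT; exists c.
have c0 kl : 0 <= c kl by exact: le_trans (normr_ge0 _) (hc kl 0).
pose B k := `|pderiv k V 0| + \sum_l c (l, k).
have B0 k : 0 <= B k by rewrite addr_ge0// sumr_ge0.
(* The Lipschitz bound for the k-th partial derivative, from the origin. *)
have gradb k x : `|pderiv k V x| <= B k * bracket x.
  have := lipschitz_of_partials (pderivV_diff V_smooth k) (fun l x => hc (l, k) x) x 0.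
  move=> h; rewrite -(subrK (pderiv k V 0) (pderiv k V x)).
  apply: le_trans (ler_normD _ _) _; rewrite /B mulrDl addrC; apply: lerD.
    by rewrite ler_peMr ?bracket_ge1.
  apply: le_trans h _; rewrite mulr_suml; apply: ler_sum => l _; rewrite ler_wpM2l//.
  by rewrite mxE subr0 entry_le_bracket.
exists (`|V 0| + \sum_k B k), 2%N; split; first by rewrite addr_ge0// sumr_ge0.
move=> x z t _; rewrite expr0 mulr1 normc_real.
have dl (s : R) : is_derive s 1 (fun s : R => V (0 + s *: x)) (\sum_i x i 0 * pderiv i V (0 + s *: x)).
  exact: (is_derive_line V 0 x _ s).1 (derive_sum_partials x (V_diff V_smooth _)).
have [s /andP[s0 s1] E] := derive_mean_value dl (@ler01 R).
rewrite scale1r scale0r !add0r subr0 mulr1 in E.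
have E' : V x = \sum_i x i 0 * pderiv i V (s *: x) + V 0 by rewrite -E subrK.
apply: le_trans (_ : (`|V 0| + \sum_k B k) * bracket x ^+ 2 <= _); last first.
  rewrite ler_wpM2l ?addr_ge0 ?sumr_ge0// exprMn ler_peMr ?exprn_ge0 ?(ltW (bracket_gt0 _))//.
  by rewrite exprn_ege1// bracket_ge1.
rewrite E' addrC; apply: le_trans (ler_normD _ _) _; rewrite mulrDl; apply: lerD.
  by rewrite ler_peMr// exprn_ege1// bracket_ge1.
apply: le_trans (ler_norm_sum _ _ _) _; rewrite mulr_suml; apply: ler_sum => k _.
rewrite normrM expr2 mulrA [B k * _]mulrC -mulrA ler_pM ?entry_le_bracket//.
apply: le_trans (gradb k _) _; rewrite ler_wpM2l// /bracket lerD2l normrZ ger0_norm//.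
by rewrite ler_piMl.
Qed.

Lemma symbol_potential : has_symbol (potential_op V) 0 (fun x _ => (V x)%:C) (fun x => (V x)%:C).
Proof.
split; [by []|exact/asymp_fixed/potential_growth|move=> _|];
  by apply: cdiff_real => x; exact: V_diff.
Qed.

Lemma symbol_hamiltonian : has_symbol (hamiltonian_op eps V) 2
  (fun x z => kinetic_symbol x z + (V x)%:C) (fun=> 2^-1).
Proof.
have [k1 k2 k3 k4] := symbol_kinetic; have [p1 p2 p3 p4] := symbol_potential.
split.
- by move=> z x; rewrite /hamiltonian_op k1 p1 mulrDl.
- by apply: asymp_ext (asymp_add k2 (asymp_raise (asymp_raise p2))) => // x; rewrite addr0.
- by move=> z; apply: cdiff_add; [exact: k3|exact: p3].
- exact: cdiff_const.
Qed.

End OperatorSymbols.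

(** * Matrix elements between wave packets *)

Section MatrixElements.
Context {R : realType} {D : nat}.
Variables (eps : R) (Gamma : 'M[R]_D).
Hypotheses (heps : 0 < eps) (Gamma_sym : Gamma^T = Gamma).
Hypothesis Gamma_pos : forall x : 'cV[R]_D, x != 0 -> 0 < dot x (Gamma *m x).
Variable j : 'I_D.
Local Notation g := (gaussian eps Gamma).
Local Notation phase := 'cV[R]_(D + D).
Local Notation config := 'cV[R]_D.
Local Notation mu := (lebesgue_cV R D).
Local Notation e := (boost (R := R) j).
Local Notation Re := (@complex.Re R).
Local Notation Im := (@complex.Im R).
Implicit Types (x : config) (y z : phase).

Lemma cdiff_cmeas (phi : config -> R[i]) : cdiff phi -> cmeas phi.
Proof. exact: cdiff_measurable. Qed.

(** Polynomial growth of the middle factor in x is paid for by the decay of the packet at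
    z, at the price of a power of z. *)
Lemma gaussian_pair_bounded (N : nat) : exists C, forall (K : R) (a : config -> R[i]) y z,
  cdiff a -> (forall x, normc (a x) <= K * bracket x ^+ N) -> 0 <= K ->
  wt_bounded (C * K * bracket z ^+ (N + 2 * D)) (fun x => (g y x)^*%C * (a x * g z x)).
Proof.
have [C1 h1] := gaussian_bounded heps Gamma_sym Gamma_pos.
have [C2 h2] := gaussian_bracket heps Gamma_sym Gamma_pos (N + 2 * D).
have C10 : 0 <= C1 by exact: le_trans (normc_ge0 _) (h1 0 0).
have C20 : 0 <= C2.
  have := (h2 0 0).1; rewrite linear0 /bracket normr0 addr0 !expr1n !mulr1.
  exact: le_trans (normc_ge0 _).
exists (C1 * C2) => K a y z da ha K0.
apply: wt_bounded_bracket.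
  apply: cmeas_mul.
    by apply: cmeas_conj; apply: cdiff_cmeas; exact: cdiff_gaussian.
  by apply: cmeas_mul; apply: cdiff_cmeas => //; exact: cdiff_gaussian.
move=> x; rewrite normcM normcJ [normc (a x * _)]normcM.
apply: le_trans (_ : C1 * (K * bracket x ^+ N * normc (g z x)) * bracket x ^+ (2 * D) <= _).
  rewrite ler_wpM2r ?exprn_ge0 ?(ltW (bracket_gt0 _))//.
  apply: (ler_pM (normc_ge0 _) _ (h1 y x)); first by rewrite mulr_ge0 ?normc_ge0.
  exact: ler_wpM2r (normc_ge0 _) _ _ (ha x).
rewrite (_ : _ * _ * _ = C1 * K * (normc (g z x) * bracket x ^+ (N + 2 * D))); last first.
  by rewrite exprD; ring.
rewrite (_ : _ * _ * _ * _ = C1 * K * (C2 * bracket z ^+ (N + 2 * D))); last by ring.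
rewrite ler_wpM2l ?mulr_ge0//; apply: le_trans (h2 z x).1 _; rewrite ler_wpM2l//.
apply: lerXn2r; rewrite ?nnegrE ?(ltW (bracket_gt0 _))//.
by rewrite /bracket lerD2l norm_usubmx.
Qed.

Variables (A : operator R D) (m : nat) (f : config -> phase -> R[i]) (F : config -> R[i]).
Hypothesis hA : has_symbol eps Gamma j A m f F.

Local Notation O y z := (inner (g y) (A (g z))).

Lemma matrix_elementE y z : O y z = cintegral mu (fun x => (g y x)^*%C * (f x z * g z x)).
Proof. by have [h _ _ _] := hA; apply: eq_cintegral => x; rewrite h. Qed.

Lemma matrix_element_bound : exists C N, 0 <= C /\ forall y z, normc (O y z) <= C * bracket z ^+ N.
Proof.
have [_ af df _] := hA.
have [C [N [C0 hf]]] := asymp_bound (norm_boost j) af.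
have [C1 h1] := gaussian_pair_bounded N.
have b y z : wt_bounded (C1 * (C * bracket z ^+ N) * bracket z ^+ (N + 2 * D))
    (fun x => (g y x)^*%C * (f x z * g z x)).
  apply: h1 => // [x|]; last by rewrite mulr_ge0// exprn_ge0// ltW// bracket_gt0.
  by apply: le_trans (hf x z) _; rewrite exprMn mulrA mulrAC.
exists (`|2 * (C1 * C * @wtmass R D)|), (N + (N + 2 * D))%N; split => // y z.
rewrite matrix_elementE; apply: le_trans (normc_cintegral_le (b y z)) _.
rewrite [X in _ <= _ * X]exprD (_ : 2 * _ = 2 * (C1 * C * @wtmass R D) * (bracket z ^+ N * bracket z ^+ (N + 2 * D))).
  by rewrite ler_wpM2r ?ler_norm// mulr_ge0// exprn_ge0// ltW// bracket_gt0.
ring.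
Qed.

Lemma gaussian_boost z (t : R) x :
  g (z + t *: e) x = cexp (0 +i* (t * (x - usubmx z) j 0 / eps)) * g z x.
Proof.
rewrite !gaussianE// mulrCA -cexpD /gauss_exponent usubmx_boost dsubmx_boost.
congr (_ * cexp _); apply: complex_eq; rewrite ?cReD ?cImD /= ?add0r//.
by rewrite dotDl dotZl dot_delta mulrDl addrC.
Qed.

Lemma conj_cexp_imag (r : R) : (cexp (0 +i* r))^*%C = cexp (0 +i* - r).
Proof. by rewrite /cexp /= cosN sinN mulrN. Qed.

(** Translating the momenta of both packets by the same amount multiplies conj(g_y) g_z by a
    phase that is constant in x, so that only the symbol changes. *)
Lemma matrix_element_boost y z t : exists2 w, normc w = 1 &
  O (y + t *: e) (z + t *: e) =
  w * cintegral mu (fun x => (g y x)^*%C * (f x (z + t *: e) * g z x)).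
Proof.
have [_ af df _] := hA.
have [C [N [C0 hf]]] := asymp_bound (norm_boost j) af.
have [C1 h1] := gaussian_pair_bounded N.
have b : wt_bounded (C1 * (C * bracket (z + t *: e) ^+ N) * bracket z ^+ (N + 2 * D))
    (fun x => (g y x)^*%C * (f x (z + t *: e) * g z x)).
  apply: h1 => // [x|]; last by rewrite mulr_ge0// exprn_ge0// ltW// bracket_gt0.
  by apply: le_trans (hf x _) _; rewrite exprMn mulrA mulrAC.
exists (cexp (0 +i* (t * (usubmx y - usubmx z) j 0 / eps))).
  by rewrite normc_cexp expR0.
rewrite matrix_elementE -(cintegral_scale _ b); apply: eq_cintegral => x.
have conjM (a b' : R[i]) : (a * b')^*%C = a^*%C * b'^*%C by exact: rmorphM.
rewrite !gaussian_boost conjM conj_cexp_imag.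
rewrite (_ : _ * (_ * _) = (cexp (0 +i* - (t * (x - usubmx y) j 0 / eps)) *
   cexp (0 +i* (t * (x - usubmx z) j 0 / eps))) * ((g y x)^*%C * (f x (z + t *: e) * g z x)));
  last by ring.
rewrite -cexpD; congr (cexp _ * _); apply: complex_eq; rewrite ?cReD ?cImD /= ?addr0//.
by rewrite !mxE; ring.
Qed.

(** Otherwise [coherent_injective] gives F g_0 = 0. *)
Lemma leading_term_nonzero : (exists x, F x != 0) ->
  exists y, cintegral mu (fun x => (g y x)^*%C * (F x * g 0 x)) != 0.
Proof.
have [_ [[C [N [C0 hF]]] _] _ dF] := hA; move=> [x0 Fx0].
have d : cdiff (fun x => F x * g 0 x) by apply: cdiff_mul => //; exact: cdiff_gaussian.
have [cR cI] := cdiff_continuous d.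
have [C1 h1] := gaussian_bounded heps Gamma_sym Gamma_pos.
apply: contrapT => H.
have z0 : forall x, F x * g 0 x = 0.
  apply: (@coherent_injective _ _ eps Gamma heps Gamma_sym Gamma_pos _ (C * C1) N cR cI).
    move=> x; rewrite normcM; have := hF x 0 1 (lexx _).
    rewrite expr1n mulr1 /bracket normr0 addr0 mulr1 => h.
    by rewrite mulrAC ler_pM ?normc_ge0.
  move=> p; apply: contrapT => /eqP h; apply: H.
  by exists (col_mx 0 p).
by have /eqP := z0 x0; rewrite mulf_eq0 (negbTE Fx0) (negbTE (gaussian_neq0 heps Gamma_sym Gamma_pos _ _)).
Qed.

Lemma leading_term_lower : (exists x, F x != 0) ->
  exists y0 r c, [/\ 0 < r, 0 < c & forall y z, `|y - y0| < r -> `|z| < r ->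
    c <= normc (cintegral mu (fun x => (g y x)^*%C * (F x * g z x)))].
Proof.
move=> /leading_term_nonzero[y0 nz].
have [_ [[C [N [C0 hF]]] _] _ dF] := hA.
have hF' x : normc (F x) <= C * bracket x ^+ N.
  have := hF x 0 1 (lexx _).
  by rewrite expr1n mulr1 {2}/bracket normr0 addr0 mulr1.
have [C1 h1] := gaussian_pair_bounded N.
pose K (w : phase * phase) x := (g w.1 x)^*%C * (F x * g w.2 x).
have b (w : phase * phase) := h1 C F w.1 w.2 dF hF' C0.
have cfst (h : phase -> R) : continuous h -> continuous (fun w : phase * phase => h w.1).
  by move=> ch w; apply: (cvg_comp fst h cvg_fst); exact: ch.
have csnd (h : phase -> R) : continuous h -> continuous (fun w : phase * phase => h w.2).
  by move=> ch w; apply: (cvg_comp snd h cvg_snd); exact: ch.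
have cmulr (a : R) (h : phase * phase -> R) : continuous h -> continuous (fun w => a * h w).
  by move=> ch w; apply: cvgZl_tmp; exact: ch.
have cmul (h k : phase * phase -> R) : continuous h -> continuous k ->
    continuous (fun w => h w * k w).
  by move=> ch ck w; apply: cvgM; [exact: ch|exact: ck].
have cadd (h k : phase * phase -> R) : continuous h -> continuous k ->
    continuous (fun w => h w + k w).
  by move=> ch ck w; apply: cvgD; [exact: ch|exact: ck].
have cK x : continuous (fun w => Re (K w x)) /\ continuous (fun w => Im (K w x)).
  have [gR gI] := cdiff_continuous (cdiff_gaussian_center Gamma heps x).
  have gR1 := cfst _ gR; have gR2 := csnd _ gR; have gI1 := cfst _ gI; have gI2 := csnd _ gI.
  split.
    rewrite (_ : (fun w => _) = fun w : phase * phase => Re (F x) * (Re (g w.1 x) * Re (g w.2 x)) +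
      Re (F x) * (Im (g w.1 x) * Im (g w.2 x)) + (- Im (F x) * (Re (g w.1 x) * Im (g w.2 x)) +
      Im (F x) * (Im (g w.1 x) * Re (g w.2 x)))); last first.
      by apply/funext => w; rewrite /K; case: (F x) (g w.1 x) (g w.2 x) => [f1 f2] [a1 a2] [b1 b2] /=; ring.
    exact: (cadd _ _ (cadd _ _ (cmulr _ _ (cmul _ _ gR1 gR2)) (cmulr _ _ (cmul _ _ gI1 gI2)))
      (cadd _ _ (cmulr _ _ (cmul _ _ gR1 gI2)) (cmulr _ _ (cmul _ _ gI1 gR2)))).
  rewrite (_ : (fun w => _) = fun w : phase * phase => Im (F x) * (Re (g w.1 x) * Re (g w.2 x)) +
    Im (F x) * (Im (g w.1 x) * Im (g w.2 x)) + (Re (F x) * (Re (g w.1 x) * Im (g w.2 x)) +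
    - Re (F x) * (Im (g w.1 x) * Re (g w.2 x)))); last first.
    by apply/funext => w; rewrite /K; case: (F x) (g w.1 x) (g w.2 x) => [f1 f2] [a1 a2] [b1 b2] /=; ring.
  exact: (cadd _ _ (cadd _ _ (cmulr _ _ (cmul _ _ gR1 gR2)) (cmulr _ _ (cmul _ _ gI1 gI2)))
      (cadd _ _ (cmulr _ _ (cmul _ _ gR1 gI2)) (cmulr _ _ (cmul _ _ gI1 gR2)))).
have M (w : phase * phase) x : `|w - (y0, 0)| < 1 ->
    normc (K w x) <= (`|C1 * C| * 2 ^+ (N + 2 * D)) * wt x.
  rewrite prod_normE /= gt_max subr0 => /andP[_ w2].
  apply: le_trans ((b w).2 x) _; rewrite ler_wpM2r ?(ltW (wt_gt0 x))//.
  apply: le_trans (_ : `|C1 * C| * bracket w.2 ^+ (N + 2 * D) <= _).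
    by rewrite ler_wpM2r ?ler_norm// exprn_ge0// ltW// bracket_gt0.
  rewrite ler_wpM2l//; apply: lerXn2r; rewrite ?nnegrE ?(ltW (bracket_gt0 _))//.
  by rewrite /bracket -[2]/(1 + 1) lerD2l ltW.
have n0 : 0 < normc (cintegral mu (K (y0, 0))) by rewrite normc_gt0.
have [c [c0 cE]] : exists c, 0 < c /\ normc (cintegral mu (K (y0, 0))) = c + c.
  by exists (normc (cintegral mu (K (y0, 0))) / 2); rewrite -splitr divr_gt0.
have triC (a b' : R[i]) : normc a <= normc (b' - a) + normc b'.
  by have := normcD (a - b') b'; rewrite subrK -(normcN (a - b')) opprB.
have tri (u v w : R) : u <= v + w -> v <= c -> u = c + c -> c <= w by lra.
have [r r0 hr] := cintegral_continuous cK (fun w => (b w).1) M c0.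
exists y0, r, c; split; [exact: r0|exact: c0|move=> y z yr zr].
have := hr (y, z); rewrite prod_normE /= gt_max subr0 yr zr => /(_ isT) h.
exact: (tri _ _ _ (triC (cintegral mu (K (y0, 0))) (cintegral mu (K (y, z)))) h cE).
Qed.

(** Translating both packets by a large momentum isolates the leading part of the symbol;
    the other terms are smaller by a factor 1 / t. *)
Lemma matrix_element_lower : (exists x, F x != 0) ->
  exists y0 r c T, [/\ 0 < r, 0 < c & forall t y z, T <= t -> `|y - y0| < r -> `|z| < r ->
    c <= normc (O (y + t *: e) (z + t *: e))].
Proof.
move=> /leading_term_lower[y0 [r' [c [r'0 c0 hc]]]].
have [_ [[C0 [N0 [C00 hF]]] [C [N [C0' hE]]]] df dF] := hA.
have [r [r0 rr' r1]] : exists r, [/\ 0 < r, r <= r' & r <= 1].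
  by exists (Num.min r' 1); rewrite lt_min r'0 ltr01 !ge_min !lexx orbT.
have [C1 h1] := gaussian_pair_bounded N; have [C2 h2] := gaussian_pair_bounded N0.
have [B BE] : exists B, B = `|2 * (C1 * C * 2 ^+ N * 2 ^+ (N + 2 * D) * @wtmass R D)|.
  by eexists.
have B0 : 0 <= B by rewrite BE.
exists y0, r, (c / 2), (1 + 2 * B / c).
have Bc : 0 <= 2 * B / c by rewrite divr_ge0 ?(ltW c0)// mulr_ge0.
split; [exact: r0|by rewrite divr_gt0|move=> t y z tT yr zr].
have t1 : 1 <= t by rewrite (le_trans _ tT)// lerDl.
have t0 : 0 < t by exact: lt_le_trans ltr01 t1.
have bz : bracket z <= 2.
  by rewrite /bracket -[2]/(1 + 1) lerD2l (le_trans (ltW zr)).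
have {}hc : c <= normc (cintegral mu (fun x => (g y x)^*%C * (F x * g z x))).
  by apply: hc; [exact: lt_le_trans yr rr'|exact: lt_le_trans zr rr'].
have [w w1 ->] := matrix_element_boost y z t; rewrite normcM w1 mul1r.
(* The remainder of the symbol times t, which [hE] bounds by t^m. *)
pose Er x := t%:C * (f x (z + t *: e) - (t ^+ m)%:C * F x).
have dEr : cdiff Er.
  apply: cdiff_mul; first exact: cdiff_const.
  have -> : (fun x => f x (z + t *: e) - (t ^+ m)%:C * F x) =
     (fun x => f x (z + t *: e) + (- (t ^+ m)%:C) * F x).
    by apply/funext => x; rewrite mulNr.
  by apply: cdiff_add; [exact: df|apply: cdiff_mul => //; exact: cdiff_const].
have bE : wt_bounded (C1 * (C * t ^+ m * 2 ^+ N) * bracket z ^+ (N + 2 * D))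
    (fun x => (g y x)^*%C * (Er x * g z x)).
  apply: h1 => // [x|]; last by rewrite !mulr_ge0// ?exprn_ge0// ltW.
  apply: le_trans (hE x z t t1) _; rewrite exprMn -mulrA.
  rewrite (_ : C * t ^+ m * 2 ^+ N * bracket x ^+ N =
    C * (t ^+ m * (bracket x ^+ N * 2 ^+ N))); last by ring.
  rewrite ler_wpM2l// ler_wpM2l ?exprn_ge0// ?(ltW t0)//.
  rewrite ler_wpM2l ?exprn_ge0 ?(ltW (bracket_gt0 _))//.
  by apply: lerXn2r; rewrite ?nnegrE ?(ltW (bracket_gt0 _)).
have bF : wt_bounded (C2 * C0 * bracket z ^+ (N0 + 2 * D)) (fun x => (g y x)^*%C * (F x * g z x)).
  apply: h2 => // x; have := hF x 0 1 (lexx _).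
  by rewrite expr1n mulr1 {2}/bracket normr0 addr0 mulr1.
have tC : t%:C != 0 :> R[i] by rewrite -normc_gt0 normc_real normr_gt0 gt_eqF.
have split_ : cintegral mu (fun x => (g y x)^*%C * (f x (z + t *: e) * g z x)) =
   t%:C^-1 * cintegral mu (fun x => (g y x)^*%C * (Er x * g z x)) +
   (t ^+ m)%:C * cintegral mu (fun x => (g y x)^*%C * (F x * g z x)).
  rewrite -(cintegral_scale _ bE) -(cintegral_scale _ bF).
  rewrite -(cintegral_add (wt_bounded_scale _ bE) (wt_bounded_scale _ bF)).
  apply: eq_cintegral => x; rewrite /Er.
  rewrite [X in _ = X + _](_ : _ = (t%:C^-1 * t%:C) *
    ((g y x)^*%C * ((f x (z + t *: e) - (t ^+ m)%:C * F x) * g z x))); last by ring.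
  by rewrite mulVf//; ring.
rewrite split_; set IE := cintegral mu (fun x => _ * (Er x * _)).
move: hc; set IF := cintegral mu (fun x => _ * (F x * _)) => hc.
have nE : normc IE <= t ^+ m * B.
  apply: le_trans (normc_cintegral_le bE) _.
  rewrite (_ : 2 * _ = t ^+ m * (2 * (C1 * C * 2 ^+ N * bracket z ^+ (N + 2 * D) * @wtmass R D)));
    last by ring.
  rewrite ler_wpM2l ?exprn_ge0 ?(ltW t0)//.
  apply: le_trans (ler_norm _) _; rewrite BE !normrM.
  rewrite ler_wpM2l// ler_wpM2r// ler_wpM2l ?mulr_ge0//.
  rewrite !ger0_norm ?exprn_ge0 ?(ltW (bracket_gt0 _))//.
  by apply: lerXn2r; rewrite ?nnegrE ?(ltW (bracket_gt0 _)).
have nt : normc (t%:C^-1 * IE) <= t ^+ m * (B / t).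
  have -> : t%:C^-1 * IE = (t^-1)%:C * IE by rewrite fmorphV.
  rewrite normcM normc_real normfV gtr0_norm// mulrC mulrA ler_pM2r ?invr_gt0//.
have := normcD (t%:C^-1 * IE + (t ^+ m)%:C * IF) (- (t%:C^-1 * IE)).
rewrite addrAC subrr add0r normcN normcM normc_real (ger0_norm (exprn_ge0 _ (ltW t0))) => h3.
have Bt : B / t <= c / 2.
  rewrite ler_pdivrMr//; have : 2 * B / c <= t by rewrite (le_trans _ tT)// lerDr.
  by rewrite ler_pdivrMr// => h4; rewrite mulrAC ler_pdivlMr// mulrC [c * _]mulrC.
have tm : 1 <= t ^+ m by rewrite exprn_ege1.
have k1 : t ^+ m * c <= t ^+ m * normc IF by rewrite ler_wpM2l// (le_trans _ tm).
have k2 : t ^+ m * (B / t) <= t ^+ m * (c / 2) by rewrite ler_wpM2l// (le_trans _ tm).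
have k3 : c / 2 <= t ^+ m * (c / 2) by rewrite ler_peMl// divr_ge0// ltW.
have k4 : t ^+ m * c = t ^+ m * (c / 2) + t ^+ m * (c / 2) by rewrite -mulrDr -splitr.
move: h3 k1 k2 k3 k4 nt; clear; move: (normc _) (normc _) => u v.
move: (t ^+ m * c) (t ^+ m * (c / 2)) (t ^+ m * (B / t)) (c / 2) (t ^+ m * _) => *; lra.
Qed.

End MatrixElements.

(** * Integrals of non-negative functions *)

Section NonnegativeIntegrals.
Local Open Scope ereal_scope.
Context d (T : measurableType d) (R : realType).
Variable mu : {measure set T -> \bar R}.
Implicit Types (f g : T -> \bar R) (B : (set T)^nat).

(** The integral of a non-negative function is the supremum over the simple functions below
    it, which compares arbitrary functions. The variance integrands are of this kind: the flow
    and the prefactor are given pointwise, with no joint measurability. *)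
Lemma ge0_integral_mono f g : (forall x, 0 <= f x) -> (forall x, f x <= g x) ->
  \int[mu]_x f x <= \int[mu]_x g x.
Proof.
move=> f0 fg; have g0 x : 0 <= g x by exact: le_trans (f0 x) (fg x).
rewrite !ge0_integralTE// ge_ereal_sup// => _ [h/= hf <-].
by apply: ereal_sup_ubound; exists h => // x; exact: le_trans (hf x) (fg x).
Qed.

Let ge0_integral_scale_le f (c : R) : (0 < c)%R -> (forall x, 0 <= f x) ->
  c%:E * \int[mu]_x f x <= \int[mu]_x (c%:E * f x).
Proof.
move=> c0 f0; rewrite muleC -lee_pdivlMr//.
rewrite [leLHS]ge0_integralTE// ge_ereal_sup// => _ [h/= hf <-].
rewrite lee_pdivlMr// muleC -sintegralrM ge0_integralTE; last first.
  by move=> x; rewrite mule_ge0// lee_fin ltW.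
apply: ereal_sup_ubound; exists (scale_nnsfun h (ltW c0)) => // x /=.
by rewrite EFinM lee_pmul2l.
Qed.

Lemma ge0_integral_scale f (c : R) : (0 <= c)%R -> (forall x, 0 <= f x) ->
  \int[mu]_x (c%:E * f x) = c%:E * \int[mu]_x f x.
Proof.
rewrite le_eqVlt => /predU1P[<- f0|c0 f0].
  by rewrite mul0e integral0_eq// => x _; rewrite mul0e.
apply/eqP; rewrite eq_le ge0_integral_scale_le// andbT.
have cV : (0 < c^-1)%R by rewrite invr_gt0.
have := @ge0_integral_scale_le (fun x => c%:E * f x) _ cV.
have cf x : 0 <= c%:E * f x by rewrite mule_ge0// lee_fin ltW.
move=> /(_ cf); under [X in _ <= X -> _]eq_integral do
  rewrite muleA -EFinM mulVf ?gt_eqF// mul1e.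
by rewrite -(@lee_pmul2l _ c%:E)// muleA -EFinM mulfV ?gt_eqF// mul1e.
Qed.

(** The disjoint sets together have infinite mass. *)
Lemma integral_pinfty f B (b c : R) : (forall x, 0 <= f x) ->
  (forall k, measurable (B k)) -> trivIset setT B -> (0 < b)%R ->
  (forall k, b%:E <= mu (B k)) -> (0 < c)%R -> (forall k x, B k x -> c%:E <= f x) ->
  \int[mu]_x f x = +oo.
Proof.
move=> f0 mB tB b0 hb c0 hc; pose U := \bigcup_k B k.
have mU : measurable U by exact: bigcup_measurable.
have h : c%:E * mu U <= \int[mu]_x f x.
  rewrite -[U]setIT -(integral_indic mu measurableT mU) -ge0_integral_scale ?(ltW c0)//.
  apply: ge0_integral_mono => x; first by rewrite mule_ge0 ?lee_fin ?(ltW c0).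
  rewrite indicE; case: (boolP (x \in U)) => [|_]; last by rewrite mule0.
  by rewrite inE => -[k _ /hc]; rewrite mule1.
have Uoo : mu U = +oo.
  apply/eqyP => A A0.
  have [n hn] : exists n : nat, (A <= n%:R * b)%R.
    exists (Num.bound (A / b)); rewrite -ler_pdivrMr//; apply/ltW/archi_boundP.
    by rewrite divr_ge0// ltW.
  apply: le_trans (_ : mu (\big[setU/set0]_(i < n) B i) <= _); last first.
    apply: le_measure; rewrite ?inE//; first exact: bigsetU_measurable.
    by move=> x; rewrite -bigcup_mkord => -[k _ Bk]; exists k.
  rewrite measure_bigsetU//.
  apply: le_trans (_ : \sum_(i < n) b%:E <= _); last by apply: lee_sum => i _; exact: hb.
  by rewrite sumEFin sumr_const card_ord lee_fin -mulr_natl.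
by move: h; rewrite Uoo gt0_muley ?lte_fin// leye_eq => /eqP.
Qed.

End NonnegativeIntegrals.

Section ProductWeight.
Context {R : realType} (n : nat).
Local Notation mu := (lebesgue_cV R n).

Lemma integral_wt_prod (C : R) : 0 <= C ->
  (\int[(mu \x mu)%E]_w (C * (wt w.1 * wt w.2))%:E < +oo)%E.
Proof.
move=> C0; pose F (w : 'cV[R]_n * 'cV[R]_n) := (C * (wt w.1 * wt w.2))%:E.
have mF : measurable_fun setT F.
  apply/measurable_EFinP; apply: measurable_funM => //; apply: measurable_funM.
    by apply: measurableT_comp; [exact: measurable_wt|exact: measurable_fst].
  by apply: measurableT_comp; [exact: measurable_wt|exact: measurable_snd].
have F0 w : (0 <= F w)%E by rewrite lee_fin !mulr_ge0// ltW// wt_gt0.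
rewrite fubini_tonelli1// /fubini_F /F /=.
have Iw := integral_wt (R := R) n.
have W0 : (0 <= \int[mu]_x (wt x)%:E)%E by apply: integral_ge0 => x _; rewrite lee_fin ltW// wt_gt0.
have Wfin : (\int[mu]_x (wt x)%:E)%E \is a fin_num by rewrite ge0_fin_numE.
have E x : (\int[mu]_y (C * (wt x * wt y))%:E = (C * fine (\int[mu]_y (wt y)%:E) * wt x)%:E)%E.
  rewrite (_ : (fun y => _) = fun y => ((C * wt x)%:E * (wt y)%:E)%E); last first.
    by apply/funext => y; rewrite -EFinM mulrA.
  rewrite ge0_integral_scale ?mulr_ge0 ?(ltW (wt_gt0 _))//; last first.
    by move=> y; rewrite lee_fin ltW// wt_gt0.
  by rewrite -[in LHS](fineK Wfin) -EFinM mulrAC.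
rewrite (eq_integral (fun x => ((C * fine (\int[mu]_y (wt y)%:E))%:E * (wt x)%:E)%E)); last first.
  by move=> x _; rewrite E EFinM.
rewrite ge0_integral_scale ?mulr_ge0 ?fine_ge0//; last by move=> x; rewrite lee_fin ltW// wt_gt0.
by rewrite -(fineK Wfin) -EFinM ltry.
Qed.

End ProductWeight.

(** * The two variance integrals *)

Lemma cintegral_conj (R : realType) n C (h : 'cV[R]_n -> R[i]) : wt_bounded C h ->
  cintegral (lebesgue_cV R n) (fun x => (h x)^*%C) = (cintegral (lebesgue_cV R n) h)^*%C.
Proof.
move=> /wt_bounded_integrable[_ i2]; apply: complex_eq => /=.
  by apply: eq_Rintegral => x _; case: (h x).
rewrite -mulN1r -(RintegralZl (-1) measurableT i2).
by apply: eq_Rintegral => x _ /=; case: (h x) => u v /=; rewrite mulN1r.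
Qed.

Lemma conj_pairing (R : realType) (u v : R[i]) : v^*%C * u = (u^*%C * v)^*%C.
Proof. by case: u v => [a b] [c d]; apply: complex_eq => /=; ring. Qed.

Section VarianceEstimates.
Context {R : realType} {D : nat}.
Variables (eps : R) (Gamma : 'M[R]_D).
Hypotheses (heps : 0 < eps) (Gamma_sym : Gamma^T = Gamma).
Hypothesis Gamma_pos : forall x : 'cV[R]_D, x != 0 -> 0 < dot x (Gamma *m x).
Variable V : 'cV[R]_D -> R.
Hypotheses (V_smooth : smooth V) (V_subquad : subquadratic V).
Local Notation phase := 'cV[R]_(D + D).
Local Notation config := 'cV[R]_D.
Variables (zt : R -> phase -> phase) (hzt : hamiltonian_flow V zt).
Variable S : R -> phase -> R.
Variables (M : R -> phase -> 'M[R]_(D + D)) (hM : stability_matrix V zt M).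
Variables (Rt : R -> phase -> R[i]) (hRt : hk_prefactor Gamma M Rt).
Variables (psi0 : config -> R[i]) (psi0_schwartz : schwartz psi0).
Hypothesis psi0_norm : l2norm psi0 = 1%E.
Variables (j : 'I_D) (A : operator R D) (t : R).
Local Notation g := (gaussian eps Gamma).
Local Notation mu := (lebesgue_cV R (D + D)).
Local Notation dbl_mu := (lebesgue_dbl R D).
Local Notation Phi := (hk_phase eps S Rt t).
Local Notation O := (matrix_element eps Gamma zt A t).
Local Notation f := (f0 eps Gamma psi0).
Local Notation kappa := (kappa_sqrt_husimi eps Gamma psi0).
Definition overlap (z : phase) : R := normc (inner psi0 (g z)).
Implicit Types (x : config) (z y : phase) (w : phase * phase).

Lemma psi0_cmeas : cmeas psi0.
Proof. exact: cdiff_cmeas (schwartz_cdiff [::] psi0_schwartz). Qed.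

Lemma psi0_rapid : rapid psi0.
Proof. exact: (schwartz_rapid [::] psi0_schwartz). Qed.

Lemma psi0_neq0 : exists x, psi0 x != 0.
Proof.
apply: contrapT => H; have z0 x : psi0 x = 0.
  by apply: contrapT => /eqP h; apply: H; exists x.
move: psi0_norm; rewrite /l2norm (_ : (fun x => _) = cst 0%E).
  rewrite Lnorm0 => [|//]; by move/eqP; rewrite eqe eq_sym oner_eq0.
by apply/funext => x; rewrite z0 normc0.
Qed.

Lemma overlap_sym z : normc (inner (g z) psi0) = overlap z.
Proof.
have [C hC] := coherent_wt_bounded heps Gamma_sym Gamma_pos psi0_cmeas psi0_rapid.
rewrite /overlap; suff -> : inner psi0 (g z) = (inner (g z) psi0)^*%C by rewrite normcJ.
rewrite /inner -(cintegral_conj (hC z)); apply: eq_cintegral => x.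
exact: conj_pairing.
Qed.

Lemma overlap_rapid N : exists C, forall z, bracket z ^+ N * overlap z <= C.
Proof.
pose B : set (config -> R[i]) := [set b | exists s, b = iter_cpderiv s psi0].
apply: (@coherent_rapid _ _ eps Gamma heps Gamma_sym Gamma_pos B psi0).
- move=> _ [s ->]; split; first exact: schwartz_cdiff.
  by move=> k; apply: span_base; exists (k :: s).
- by move=> _ [s ->]; exact: schwartz_rapid.
- by apply: span_base; exists [::].
Qed.

Local Notation c := ((2 * pi * eps) ^- D).

Lemma c_gt0 : 0 < c.
Proof. by rewrite invr_gt0 exprn_gt0// !mulr_gt0// pi_gt0. Qed.

Lemma csqr : (2 * pi * eps) ^- (2 * D) = c ^+ 2.
Proof. by rewrite mulnC exprM exprVn. Qed.

Lemma normc_f0 w : normc (f w) = c ^+ 2 * (overlap w.1 * overlap w.2).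
Proof.
rewrite /f0 csqr normcM [X in X * _]normcM normc_real overlap_sym.
by rewrite ger0_norm ?exprn_ge0 ?(ltW c_gt0)// mulrA.
Qed.

Lemma normc_hk_phase w : normc (Phi w) = normc (Rt t w.1) * normc (Rt t w.2).
Proof.
rewrite /hk_phase normcM [X in X * _]normcM normcJ normc_cexp.
have -> : complex.Re ('i%C * (S t w.2 - S t w.1)%:C / eps%:C) = 0.
  by rewrite mulrAC i_over_eps.
by rewrite expR0 mulr1.
Qed.

Lemma husimiE z : husimi eps Gamma psi0 z = c * overlap z ^+ 2.
Proof. by rewrite /husimi overlap_sym. Qed.

Lemma normc_integrand w : normc (f w * Phi w * O w) =
  c ^+ 2 * (overlap w.1 * overlap w.2) * normc (Phi w * O w).
Proof. by rewrite -(mulrA (f w) (Phi w) (O w)) normcM normc_f0. Qed.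

(** Where both overlaps are non-zero, the density cancels f0 up to the factor (2 pi eps)^(- 2 D). *)
Lemma husimi_integrand w : overlap w.1 != 0 -> overlap w.2 != 0 ->
  (dbl (husimi eps Gamma psi0) w)^-1 * normc (f w * Phi w * O w) ^+ 2 =
  c ^+ 2 * normc (Phi w * O w) ^+ 2.
Proof.
move=> h1 h2; have alg (x y k p : R) : x != 0 -> y != 0 -> k != 0 ->
    (k * x ^+ 2 * (k * y ^+ 2))^-1 * (k ^+ 2 * (x * y) * p) ^+ 2 = k ^+ 2 * p ^+ 2.
  by move=> x0 y0 k0; field; rewrite x0 y0 k0.
rewrite /dbl (husimiE w.1) (husimiE w.2) normc_integrand.
exact: alg h1 h2 (lt0r_neq0 c_gt0).
Qed.

Lemma sqrt_husimi_integrand w :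
  (dbl (sqrt_husimi eps Gamma psi0) w)^-1 * normc (f w * Phi w * O w) ^+ 2 =
  kappa ^+ 2 * (normc (f w) * normc (Phi w) ^+ 2 * normc (O w) ^+ 2).
Proof.
have alg (x y k l p o : R) : k != 0 ->
    (k / l * x * (k / l * y))^-1 * (k ^+ 2 * (x * y) * (p * o)) ^+ 2 =
    l ^+ 2 * (k ^+ 2 * (x * y) * p ^+ 2 * o ^+ 2).
  (* If an overlap vanishes then so does f0; for kappa = 0 both sides are 0. *)
  move=> k0.
  have [->|x0] := eqVneq x 0; first by rewrite !(mul0r, mulr0, expr0n).
  have [->|y0] := eqVneq y 0; first by rewrite !(mul0r, mulr0, expr0n).
  have [->|l0] := eqVneq l 0; first by rewrite !(invr0, mul0r, mulr0, expr0n).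
  by field; rewrite x0 y0 k0 l0.
rewrite normc_integrand (normcM (Phi w)) normc_f0.
exact: alg (lt0r_neq0 c_gt0).
Qed.

Lemma zero_matrix_element : zero_operator A -> forall w, O w = 0.
Proof.
move=> zA w; rewrite /matrix_element /inner.
rewrite (@eq_cintegral _ _ _ (fun=> 0)); last first.
  by move=> x; rewrite zA ?mulr0//; exact: schwartz_gaussian.
by apply: complex_eq => /=; rewrite /Rintegral integral0_eq.
Qed.

Variables (m : nat) (a : config -> phase -> R[i]) (F : config -> R[i]).
Hypothesis hA : has_symbol eps Gamma j A m a F.

(** Boxes around the points that the flow takes to y0 + (T + 2 k r) e. Their images lie in balls
    of radius r whose centres are at least 2 r apart. *)
Lemma momentum_boxes (r T : R) y0 : 0 < r -> exists2 rho, 0 < rho & exists p : nat -> phase,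
  (forall k y, box (p k) rho y -> `|zt t y - (T + k%:R * (r + r)) *: boost j - y0| < r) /\
  trivIset setT (fun k => box (p k) rho).
Proof.
move=> r0; pose s (k : nat) := T + k%:R * (r + r).
 have [L L1 hL] := flow_bilipschitz V_smooth V_subquad hzt t.
have L0 : 0 < L by exact: lt_le_trans L1.
pose p k := zt (- t) (y0 + s k *: boost j).
have rho0 : 0 < r / L by rewrite divr_gt0.
have near_p k y : box (p k) (r / L) y -> `|zt t y - s k *: boost j - y0| < r.
  rewrite boxE// => /= h; have [+ _] := hL y (p k).
  rewrite /p (flowNK V_smooth V_subquad hzt) => h2.
  rewrite -addrA -opprD [s k *: _ + _]addrC; apply: le_lt_trans h2 _.
  by rewrite mulrC -ltr_pdivlMr.
exists (r / L); first exact: rho0.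
exists p; split; first exact: near_p.
have e1 : 1 <= `|boost j : phase|.
  have := ler_entry_norm (boost j : phase) (rshift D j).
  by rewrite /boost col_mxEd mxE !eqxx normr1.
apply/trivIsetP => k l _ _ kl; apply/seteqP; split => // y [/near_p hk /near_p hl].
have h : `|(s k - s l) *: (boost j : phase)| < r + r.
  rewrite (_ : _ *: _ = (zt t y - s l *: boost j - y0) - (zt t y - s k *: boost j - y0)).
    by apply: le_lt_trans (ler_normB _ _) _; exact: ltrD.
  by rewrite scalerBl !opprB !addrA; apply/matrixP => i i'; rewrite !mxE; ring.
have : r + r <= `|s k - s l|.
  have -> : s k - s l = (k%:R - l%:R) * (r + r) by rewrite /s; ring.
  rewrite normrM [`|r + r|]ger0_norm ?addr_ge0 ?(ltW r0)// ler_peMl ?addr_ge0 ?(ltW r0)//.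
  move: kl; rewrite neq_ltn => /orP[] kl.
    by rewrite distrC ger0_norm ?subr_ge0 ?ler_nat 1?ltnW// lerBrDr nat1r ler_nat.
  by rewrite ger0_norm ?subr_ge0 ?ler_nat 1?ltnW// lerBrDr nat1r ler_nat.
move: h; rewrite normrZ => h h'; have := le_lt_trans (ler_wpM2l (normr_ge0 (s k - s l)) e1) h.
by rewrite mulr1 => /(le_lt_trans h'); rewrite ltxx.
Qed.

Lemma overlap_zeros_null : measurable [set z | inner (g z) psi0 = 0] /\
  mu [set z | inner (g z) psi0 = 0] = 0%E.
Proof.
have [cR cI] := cdiff_continuous (schwartz_cdiff [::] psi0_schwartz).
split.
  exact: (measurable_coherent_zeros heps Gamma_sym Gamma_pos psi0_cmeas psi0_rapid).
exact: (null_coherent_zeros heps Gamma_sym Gamma_pos psi0_cmeas psi0_rapid cR cI psi0_neq0).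
Qed.

(** The boxes for y and for z use the same sequence of momenta. Removing the null set of
    vanishing overlaps changes no measure. *)
Lemma husimi_boxes : (exists x, F x != 0) ->
  exists (B : nat -> set (phase * phase)) (b e : R), [/\ 0 < b, 0 < e,
    (forall k, measurable (B k)) /\ trivIset setT B,
    forall k, (b%:E <= dbl_mu (B k))%E &
    forall k w, B k w -> [/\ overlap w.1 != 0, overlap w.2 != 0 & e <= normc (Phi w * O w) ^+ 2]].
Proof.
move=> nzF.
have [y0 [r [c0 [T [r0 c00 hO]]]]] := matrix_element_lower heps Gamma_sym Gamma_pos hA nzF.
have [d [C' [d0 hR]]] := prefactor_bounds Gamma_sym Gamma_pos V_smooth V_subquad hzt hM hRt t.
have [mN N0] := overlap_zeros_null; set N := [set z | _] in mN N0.
have [rho1 rho10 [p [hp tp]]] := momentum_boxes T y0 r0.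
have [rho2 rho20 [q [hq _]]] := momentum_boxes T 0 r0.
pose B k := (box (p k) rho1 `\` N) `*` (box (q k) rho2 `\` N).
have mB1 (x : phase) (rho : R) : measurable (box x rho `\` N).
  by apply: measurableD => //; exact: measurable_box.
have lower (x : phase) (rho : R) : 0 < rho ->
    (((rho *+ 2) ^+ (D + D))%:E <= mu (box x rho `\` N))%E.
  move=> rho0; rewrite -(lebesgue_box x rho0).
  apply: le_trans (_ : mu ((box x rho `\` N) `|` N) <= _)%E.
    apply: le_measure; rewrite ?inE; [exact: measurable_box| |].
      by apply: measurableU.
    by move=> y h; have [Ny|Ny] := pselect (N y); [right|left].
  apply: le_trans (measureU2 _ (mB1 x rho) mN) _.
  by rewrite [X in (_ + X <= _)%E](_ : _ = 0%E) ?adde0//; exact: N0.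
exists B, ((rho1 *+ 2) ^+ (D + D) * (rho2 *+ 2) ^+ (D + D)), ((d * d * c0) ^+ 2); split.
- by rewrite mulr_gt0// exprn_gt0// mulrn_wgt0.
- by rewrite exprn_gt0// !mulr_gt0.
- split; first by move=> k; apply: measurableX.
  apply/trivIsetP => k l kT lT kl; apply/seteqP; split => // -[y z] [[/= [hk _] _] [[hl _] _]].
  have /trivIsetP/(_ k l kT lT kl) := tp.
  by move=> /seteqP[/(_ y) + _] => /(_ (conj hk hl)).
- move=> k.
  have -> : dbl_mu (B k) = (mu (box (p k) rho1 `\` N) * mu (box (q k) rho2 `\` N))%E.
    exact: (product_measure1E mu mu (mB1 _ _) (mB1 _ _)).
  rewrite EFinM; apply: lee_pmul; rewrite ?lee_fin ?exprn_ge0 ?mulrn_wge0 ?(ltW rho10) ?(ltW rho20)//.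
    exact: lower.
  exact: lower.
move=> k w [/= [hy Ny] [hz Nz]].
have nz z : ~ N z -> overlap z != 0.
  move=> Nz'; rewrite -overlap_sym; apply/eqP => h; apply: Nz'.
  by apply: eq0_normc.
split; [exact: nz|exact: nz|].
apply: lerXn2r; rewrite ?nnegrE ?normc_ge0 ?mulr_ge0 ?(ltW d0) ?(ltW c00)//.
rewrite normcM normc_hk_phase.
have [/andP[d1 _] /andP[d2 _]] := (hR w.1, hR w.2).
apply: ler_pM; rewrite ?mulr_ge0 ?(ltW d0) ?(ltW c00)//.
  by apply: ler_pM => //; exact: ltW.
pose s : R := T + k%:R * (r + r).
have Ts : T <= s by rewrite lerDl mulr_ge0// addr_ge0// ltW.
have := hO s (zt t w.1 - s *: boost j) (zt t w.2 - s *: boost j) Ts.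
have hz' := hq k w.2 hz; rewrite subr0 in hz'.
by move=> /(_ (hp k w.1 hy) hz'); rewrite !subrK.
Qed.

Lemma husimi_integrals_infinite : (exists x, F x != 0) ->
  (\int[dbl_mu]_w ((dbl (husimi eps Gamma psi0) w)^-1 *
     normc (f w * Phi w * O w) ^+ 2)%:E = +oo)%E /\
  (\int[dbl_mu]_w (normc (Phi w * O w) ^+ 2)%:E = +oo)%E.
Proof.
move=> /husimi_boxes[B [b [e [b0 e0 [mB tB] hb he]]]]; split.
  apply: (@integral_pinfty _ _ _ _ _ B b (c ^+ 2 * e)) => //.
  - move=> w; rewrite lee_fin mulr_ge0 ?sqr_ge0// invr_ge0.
    by apply: mulr_ge0; rewrite husimiE mulr_ge0 ?sqr_ge0// ltW// c_gt0.
  - by rewrite mulr_gt0// exprn_gt0// c_gt0.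
  - move=> k w /he[h1 h2 h3]; rewrite (husimi_integrand h1 h2) lee_fin ler_wpM2l//.
    by rewrite sqr_ge0.
apply: (@integral_pinfty _ _ _ _ _ B b e) => //.
- by move=> w; rewrite lee_fin sqr_ge0.
- by move=> k w /he[_ _ h3]; rewrite lee_fin.
Qed.

Lemma overlap_wt K : exists2 C, 0 <= C & forall z, bracket z ^+ K * overlap z <= C * wt z.
Proof.
have [C hC] := overlap_rapid (K + 2 * (D + D)).
exists C => [|z].
  by apply: le_trans (hC 0); rewrite mulr_ge0 ?normc_ge0// exprn_ge0// ltW// bracket_gt0.
apply: le_trans (_ : bracket z ^+ K * overlap z * (bracket z ^+ (2 * (D + D)) * wt z) <= _).
  by rewrite ler_peMr ?bracket_wt// mulr_ge0 ?normc_ge0// exprn_ge0// ltW// bracket_gt0.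
rewrite (_ : _ * _ * _ = bracket z ^+ (K + 2 * (D + D)) * overlap z * wt z); last first.
  by rewrite exprD; ring.
by rewrite ler_wpM2r// ltW// wt_gt0.
Qed.

(** The overlaps decay faster than any power. The prefactor is bounded, and the matrix
    element is bounded by a power of the point that the flow reaches, hence by a power of z. *)
Lemma sqrt_husimi_bound : exists2 C, 0 <= C & forall w,
  normc (f w) * normc (Phi w) ^+ 2 * normc (O w) ^+ 2 <= C * (wt w.1 * wt w.2).
Proof.
have [d [C' [d0 hR]]] := prefactor_bounds Gamma_sym Gamma_pos V_smooth V_subquad hzt hM hRt t.
have [C1 [N [C10 hO]]] := matrix_element_bound heps Gamma_sym Gamma_pos hA.
have [L L1 hL] := flow_bracket V_smooth V_subquad hzt t.
have [C2 C20 h2] := overlap_wt 0; have [C3 C30 h3] := overlap_wt (N * 2).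
have C'0 : 0 <= C' by have /andP[h h'] := hR 0; exact: le_trans (ltW d0) (le_trans h h').
pose K := c ^+ 2 * (C' * C') ^+ 2 * (C1 * L ^+ N) ^+ 2.
have L0 : 0 <= L by exact: le_trans ler01 L1.
have K0 : 0 <= K by rewrite !mulr_ge0 ?sqr_ge0// ?exprn_ge0 ?(ltW c_gt0).
exists (K * (C2 * C3)); first by apply: mulr_ge0 => //; exact: mulr_ge0.
move=> w; rewrite normc_f0.
have hP : normc (Phi w) ^+ 2 <= (C' * C') ^+ 2.
  rewrite normc_hk_phase; apply: lerXn2r; rewrite ?nnegrE ?mulr_ge0 ?normc_ge0//.
  by have [/andP[_ k1] /andP[_ k2]] := (hR w.1, hR w.2); apply: ler_pM; rewrite ?normc_ge0.
have hOw : normc (O w) ^+ 2 <= (C1 * L ^+ N) ^+ 2 * bracket w.2 ^+ (N * 2).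
  rewrite exprM -exprMn; apply: lerXn2r; rewrite ?nnegrE ?normc_ge0//.
    by rewrite !mulr_ge0 ?exprn_ge0 ?(ltW (bracket_gt0 _)).
  apply: le_trans (hO _ _) _; rewrite -mulrA ler_wpM2l// -exprMn.
  by apply: lerXn2r; rewrite ?nnegrE ?mulr_ge0 ?(ltW (bracket_gt0 _))// hL.
have {}h2 := h2 w.1; have {}h3 := h3 w.2; rewrite expr0 mul1r in h2.
have o1 := normc_ge0 (inner psi0 (g w.1)); have o2 := normc_ge0 (inner psi0 (g w.2)).
have cc : 0 <= c ^+ 2 by rewrite exprn_ge0// ltW// c_gt0.
have step (u p o P Q : R) : 0 <= u -> 0 <= p -> 0 <= o -> p <= P -> o <= Q ->
    u * p * o <= u * P * Q.
  by move=> u0 p0 o0 pP oQ; apply: ler_pM => //; [exact: mulr_ge0|exact: ler_wpM2l].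
have regroup (k p o x y b v1 v2 : R) : 0 <= k -> 0 <= p -> 0 <= o -> 0 <= x -> 0 <= b * y ->
    x <= C2 * v1 -> b * y <= C3 * v2 ->
    k * (x * y) * p * (o * b) <= k * p * o * (C2 * C3) * (v1 * v2).
  move=> k0 p0 o0' x0 by0 h h'.
  rewrite (_ : _ * _ * _ * _ = k * p * o * (x * (b * y))); last by ring.
  rewrite (_ : k * p * o * (C2 * C3) * _ = k * p * o * (C2 * v1 * (C3 * v2))); last by ring.
  apply: ler_wpM2l; first by rewrite !mulr_ge0.
  exact: ler_pM.
have U0 : 0 <= c ^+ 2 * (overlap w.1 * overlap w.2).
  by apply: mulr_ge0 cc _; exact: mulr_ge0 o1 o2.
apply: le_trans (step _ _ _ _ _ U0 (sqr_ge0 _) (sqr_ge0 _) hP hOw) _.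
have b0 : 0 <= bracket w.2 ^+ (N * 2) * overlap w.2.
  by apply: mulr_ge0 _ o2; rewrite exprn_ge0// ltW// bracket_gt0.
exact: (regroup _ _ _ _ _ _ _ _ cc (sqr_ge0 _) (sqr_ge0 _) o1 b0 h2 h3).
Qed.

Lemma sqrt_husimi_integral_finite :
  (\int[dbl_mu]_w (normc (f w) * normc (Phi w) ^+ 2 * normc (O w) ^+ 2)%:E)%E \is a fin_num.
Proof.
have h0 w : 0 <= normc (f w) * normc (Phi w) ^+ 2 * normc (O w) ^+ 2.
  by rewrite !mulr_ge0 ?sqr_ge0 ?normc_ge0.
rewrite ge0_fin_numE; last by apply: integral_ge0 => w _; rewrite lee_fin.
have [C C0 hC] := sqrt_husimi_bound.
apply: le_lt_trans (integral_wt_prod (R := R) (D + D) C0).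
by apply: ge0_integral_mono => w; rewrite lee_fin.
Qed.

Lemma sqrt_husimi_scaling :
  (\int[dbl_mu]_w ((dbl (sqrt_husimi eps Gamma psi0) w)^-1 *
     normc (f w * Phi w * O w) ^+ 2)%:E =
   (kappa ^+ 2)%:E * \int[dbl_mu]_w (normc (f w) * normc (Phi w) ^+ 2 * normc (O w) ^+ 2)%:E)%E.
Proof.
rewrite -ge0_integral_scale ?sqr_ge0//; last first.
  by move=> w; rewrite lee_fin !mulr_ge0 ?sqr_ge0 ?normc_ge0.
by apply: eq_integral => w _; rewrite sqrt_husimi_integrand EFinM.
Qed.

End VarianceEstimates.

(** * Finiteness of the variances *)

(** The leading part vanishes only for multiplication by V = 0. *)
Lemma operator_symbol (R : realType) (D : nat) (eps : R) (Gamma : 'M[R]_D)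
  (heps : 0 < eps) (Gamma_sym : Gamma^T = Gamma)
  (Gamma_pos : forall x : 'cV[R]_D, x != 0 -> 0 < dot x (Gamma *m x))
  (V : 'cV[R]_D -> R) (V_smooth : smooth V) (V_subquad : subquadratic V)
  (n : nat) (j : 'I_D) (A : operator R D) :
  A = idfun \/ A = iter n (@position_op R D j) \/
  A = iter n (@momentum_op R D eps j) \/ A = @kinetic_op R D eps \/
  A = potential_op V \/ A = hamiltonian_op eps V ->
  exists m a F, has_symbol eps Gamma j A m a F /\ ((exists x, F x != 0) \/ zero_operator A).
Proof.
have half : (2^-1 : R[i]) != 0 by rewrite invr_neq0// pnatr_eq0.
move=> [->|[->|[->|[->|[->|->]]]]].
- do 3 eexists; split; first exact: symbol_id.
  by left; exists 0; exact: oner_neq0.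
- do 3 eexists; split; first exact: symbol_position.
  left; exists (delta_mx j 0); rewrite mxE !eqxx.
  by rewrite expf_neq0// oner_neq0.
- do 3 eexists; split; first exact: symbol_momentum.
  by left; exists 0; exact: oner_neq0.
- by do 3 eexists; split; [exact: symbol_kinetic|left; exists 0].
- do 3 eexists; split; first exact: (symbol_potential _ _ V_smooth V_subquad).
  have [[x Vx]|H] := pselect (exists x, V x != 0).
    by left; exists x; rewrite -normc_gt0 normc_real normr_gt0.
  right=> psi _ x; rewrite /potential_op (_ : V x = 0) ?mul0r//.
  by apply: contrapT => /eqP Vx; apply: H; exists x.
- by do 3 eexists; split; [exact: symbol_hamiltonian|left; exists 0].
Qed.

Theorem proposition4 (R : realType) (D : nat) (hD : (0 < D)%N)
  (eps : R) (heps : 0 < eps)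
  (Gamma : 'M[R]_D) (Gamma_sym : Gamma^T = Gamma)
  (Gamma_pos : forall x : 'cV[R]_D, x != 0 -> 0 < dot x (Gamma *m x))
  (V : 'cV[R]_D -> R) (V_smooth : smooth V) (V_subquad : subquadratic V)
  (zt : R -> 'cV[R]_(D + D) -> 'cV[R]_(D + D)) (hzt : hamiltonian_flow V zt)
  (S : R -> 'cV[R]_(D + D) -> R) (hS : classical_action V zt S)
  (M : R -> 'cV[R]_(D + D) -> 'M[R]_(D + D)) (hM : stability_matrix V zt M)
  (Rt : R -> 'cV[R]_(D + D) -> R[i]) (hRt : hk_prefactor Gamma M Rt)
  (psi0 : 'cV[R]_D -> R[i]) (psi0_schwartz : schwartz psi0)
  (psi0_norm : l2norm psi0 = 1%E)
  (tau : R) (htau : 0 < tau) (n : nat) (j : 'I_D)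
  (A : operator R D)
  (hA : A = idfun \/ A = iter n (@position_op R D j) \/
        A = iter n (@momentum_op R D eps j) \/ A = @kinetic_op R D eps \/
        A = potential_op V \/ A = hamiltonian_op eps V)
  (t : R) (ht : 0 <= t <= tau) :
  let Phi := hk_phase eps S Rt t in
  let O := matrix_element eps Gamma zt A t in
  let f := f0 eps Gamma psi0 in
  let kappa := kappa_sqrt_husimi eps Gamma psi0 in
  let mean_sq := normc (mc_mean eps Gamma psi0 zt S Rt A t) ^+ 2 in
  let var := mc_variance eps Gamma psi0 zt S Rt A t in
  let var_H := var (dbl (husimi eps Gamma psi0)) in
  let var_sqrtH := var (dbl (sqrt_husimi eps Gamma psi0)) in
  (var_H = (((2 * pi * eps) ^- (2 * D))%:E
              * \int[lebesgue_dbl R D]_w (normc (Phi w * O w) ^+ 2)%:E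
            - mean_sq%:E)%E /\
   (var_H \is a fin_num <-> zero_operator A)) /\
  (var_sqrtH = ((kappa ^+ 2)%:E
              * \int[lebesgue_dbl R D]_w
                  (normc (f w) * normc (Phi w) ^+ 2 * normc (O w) ^+ 2)%:E
            - mean_sq%:E)%E /\
   var_sqrtH \is a fin_num).
Proof.
move=> Phi O f kappa mean_sq var var_H var_sqrtH.
have [m [a [F [hsym cases]]]] := operator_symbol heps Gamma_sym Gamma_pos V_smooth V_subquad hA.
have varE rho : var rho = (\int[lebesgue_dbl R D]_w
      ((rho w)^-1 * normc (f w * Phi w * O w) ^+ 2)%:E - mean_sq%:E)%E by [].
have zero_case : zero_operator A ->
    var_H = (((2 * pi * eps) ^- (2 * D))%:E
              * \int[lebesgue_dbl R D]_w (normc (Phi w * O w) ^+ 2)%:E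
            - mean_sq%:E)%E /\ var_H \is a fin_num.
  move=> zA; have O0 w : O w = 0 by exact: (zero_matrix_element heps Gamma_sym Gamma_pos zt t zA w).
  have E : var_H = (- mean_sq%:E)%E.
    rewrite /var_H varE integral0_eq ?add0e// => w _.
    by rewrite O0 mulr0 normc0 expr0n /= mulr0.
  split; last by rewrite E.
  rewrite E integral0_eq ?mule0 ?add0e// => w _.
  by rewrite O0 mulr0 normc0 expr0n.
split.
- case: cases => [nzF|zA]; last first.
    by have [h1 h2] := zero_case zA; split.
  have [i1 i2] := husimi_integrals_infinite heps Gamma_sym Gamma_pos V_smooth V_subquad
    hzt S hM hRt psi0_schwartz psi0_norm t hsym nzF.
  have E : var_H = +oo%E by rewrite /var_H varE i1.
  split.
    by rewrite E i2 gt0_muley ?lte_fin ?invr_gt0 ?exprn_gt0 ?mulr_gt0 ?pi_gt0.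
  by split => [|/zero_case[]//]; rewrite E.
- have h := sqrt_husimi_scaling heps Gamma_sym Gamma_pos zt S Rt psi0_schwartz A t.
  have E : var_sqrtH = ((kappa ^+ 2)%:E * \int[lebesgue_dbl R D]_w
      (normc (f w) * normc (Phi w) ^+ 2 * normc (O w) ^+ 2)%:E - mean_sq%:E)%E.
    by rewrite /var_sqrtH varE h.
  split; first exact: E.
  rewrite E fin_numB fin_numM//.
  exact: (sqrt_husimi_integral_finite heps Gamma_sym Gamma_pos V_smooth V_subquad hzt S hM hRt
    psi0_schwartz t hsym).
Qed.
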